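(* Let $k$ be a field, $A$ a central simple $k$-algebra, $\mathrm{per}(A)=\prod_ip_i^{r_i}$ the factorization of its period into powers of distinct primes, and $p_A(t):=\prod_i(1+t+\cdots+t^{p_i^{r_i}-1})\in\mathbb{N}[t]$. Then for every additive invariant $E:\mathrm{dgcat}(k)\to\mathrm{D}$ with values in an additive category $\mathrm{D}$ there is an isomorphism $E(A;p_A(t))\simeq E(A;t\,p_A(t))$ in $\mathrm{D}$.
   Context: Tensor products are over $k$. The period $\mathrm{per}(A)$ is the order of $[A]$ in the Brauer group $\mathrm{Br}(k)$. For a polynomial $p(t)=a_0+a_1t+\cdots+a_nt^n\in\mathbb{N}[t]$ and an additive invariant $E$, $$E(A;p(t)):=E(k)^{\oplus a_0}\oplus E(A)^{\oplus a_1}\oplus E(A^{\otimes2})^{\oplus a_2}\oplus\cdots\oplus E(A^{\otimes n})^{\oplus a_n}.$$ $\mathrm{dgcat}(k)$ is the category of (small) dg categories over $k$ (categories enriched over cochain complexes of $k$-vector spaces); a $k$-algebra is viewed as a dg category with one object. A dg functor $\mathcal{A}\to\mathcal{B}$ is a Morita equivalence if it induces an equivalence $\mathcal{D}(\mathcal{A})\simeq\mathcal{D}(\mathcal{B})$ of derived categories of right modules. For a dg category $\mathcal{A}$, $T(\mathcal{A})$ is the dg category of pairs $(i,x)$, $i\in\{1,2\}$, $x\in\mathcal{A}$, with morphism complex from $(i,x)$ to $(i',x')$ equal to $\mathcal{A}(x,x')$ if $i'\ge i$ and zero otherwise, and composition induced by $\mathcal{A}$; there are two inclusions $i_1,i_2:\mathcal{A}\hookrightarrow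 T(\mathcal{A})$. A functor $E:\mathrm{dgcat}(k)\to\mathrm{D}$ with values in an additive category is an additive invariant if it sends Morita equivalences to isomorphisms and, for every $\mathcal{A}$, $i_1$ and $i_2$ induce an isomorphism $E(\mathcal{A})\oplus E(\mathcal{A})\simeq E(T(\mathcal{A}))$. *)

(* Defs.v *)
From HB Require Import structures.
From mathcomp Require Import all_boot all_order all_algebra all_field.
From mathcomp Require Import boolp.

Set Implicit Arguments.
Unset Strict Implicit.
Unset Printing Implicit Defensive.

Import GRing.Theory VectorInternalTheory.
Local Open Scope ring_scope.

#[local] Obligation Tactic := idtac.

(* A tensor is stored as the matrix of its coordinates in the product of the
   reference bases of A and B given by their [vectType] structures. *)
Definition tens (k : fieldType) (A B : falgType k) : Type :=
  'M[k]_(dim A, dim B).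

HB.instance Definition _ (k : fieldType) (A B : falgType k) :=
  Vector.on (tens A B).

Section Tensor.
Context (k : fieldType) (A B : falgType k).
Implicit Types (a : A) (b : B) (u v w : tens A B).

Definition pure a b : tens A B := (v2r a)^T *m v2r b.

Definition refb (V : falgType k) (i : 'I_(dim V)) : V := r2v (delta_mx 0 i).

Definition tens_mul u v : tens A B :=
  \sum_i \sum_j \sum_p \sum_q
    (u i j * v p q) *: pure (refb i * refb p) (refb j * refb q).

Definition tens_one : tens A B := pure 1 1.

Fact pureDl b : {morph pure^~ b : x y / x + y}.
Proof. by move=> x y; rewrite /pure linearD /= linearD /= mulmxDl. Qed.

Fact pureDr a : {morph pure a : x y / x + y}.
Proof. by move=> x y; rewrite /pure linearD /= mulmxDr. Qed.

Fact pureZl c a b : pure (c *: a) b = c *: pure a b.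
Proof. by rewrite /pure linearZ /= linearZ /= scalemxAl. Qed.

Fact pureZr c a b : pure a (c *: b) = c *: pure a b.
Proof. by rewrite /pure linearZ /= scalemxAr. Qed.

Fact pure0l b : pure 0 b = 0.
Proof. by rewrite -(scale0r (0 : A)) pureZl scale0r. Qed.

Fact pure0r a : pure a 0 = 0.
Proof. by rewrite -(scale0r (0 : B)) pureZr scale0r. Qed.

Fact refb_decomp (V : falgType k) (x : V) :
  x = \sum_i v2r x 0 i *: refb i.
Proof.
apply: (can_inj v2rK); rewrite linear_sum [LHS]row_sum_delta.
by apply: eq_bigr => i _; rewrite linearZ /= r2vK.
Qed.

Fact pure_refb i j : pure (refb i) (refb j) = delta_mx i j.
Proof. by rewrite /pure !r2vK trmx_delta mul_delta_mx. Qed.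

Fact tens_decomp u : u = \sum_i \sum_j u i j *: pure (refb i) (refb j).
Proof.
rewrite [LHS]matrix_sum_delta.
by apply: eq_bigr => i _; apply: eq_bigr => j _; rewrite pure_refb.
Qed.

Fact tens_mulDl u v w : tens_mul (u + v) w = tens_mul u w + tens_mul v w.
Proof.
rewrite /tens_mul; do 4![rewrite -big_split /=; apply: eq_bigr => ? _].
by rewrite mxE mulrDl scalerDl.
Qed.

Fact tens_mulDr u v w : tens_mul u (v + w) = tens_mul u v + tens_mul u w.
Proof.
rewrite /tens_mul; do 4![rewrite -big_split /=; apply: eq_bigr => ? _].
by rewrite mxE mulrDr scalerDl.
Qed.

Fact tens_mulZl c u v : tens_mul (c *: u) v = c *: tens_mul u v.
Proof.
rewrite /tens_mul; do 4![rewrite scaler_sumr; apply: eq_bigr => ? _].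
by rewrite mxE -mulrA scalerA.
Qed.

Fact tens_mulZr c u v : tens_mul u (c *: v) = c *: tens_mul u v.
Proof.
rewrite /tens_mul; do 4![rewrite scaler_sumr; apply: eq_bigr => ? _].
by rewrite mxE mulrCA scalerA.
Qed.

Fact tens_mul0 u : tens_mul u 0 = 0.
Proof. by rewrite -{1}(scale0r (0 : tens A B)) tens_mulZr scale0r. Qed.

Fact tens_0mul u : tens_mul 0 u = 0.
Proof. by rewrite -{1}(scale0r (0 : tens A B)) tens_mulZl scale0r. Qed.

Fact tens_ind (P : tens A B -> Prop) :
  P 0 -> (forall u v, P u -> P v -> P (u + v)) -> (forall a b, P (pure a b)) ->
  forall u, P u.
Proof.
move=> P0 PD Pp u; rewrite (tens_decomp u).
apply: (big_ind P) => // i _; apply: (big_ind P) => // j _.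
by rewrite -pureZl.
Qed.

Fact pure_sum (I J : finType) (F : I -> A) (G : J -> B) :
  pure (\sum_i F i) (\sum_j G j) = \sum_i \sum_j pure (F i) (G j).
Proof.
rewrite (big_morph _ (pureDl _) (pure0l _)); apply: eq_bigr => i _.
by rewrite (big_morph _ (pureDr _) (pure0r _)).
Qed.

Fact pureE a b i j : pure a b i j = v2r a 0 i * v2r b 0 j.
Proof. by rewrite mxE big_ord1 mxE. Qed.

Fact tens_mul_pure a b a' b' :
  tens_mul (pure a b) (pure a' b') = pure (a * a') (b * b').
Proof.
have mul_refb (V : falgType k) (x y : V) : x * y =
    \sum_ip (v2r x 0 ip.1 * v2r y 0 ip.2) *: (refb ip.1 * refb ip.2).
  rewrite -(pair_bigA _ (fun i p => (v2r x 0 i * v2r y 0 p) *: (refb i * refb p))).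
  rewrite {1}(refb_decomp x) mulr_suml; apply: eq_bigr => i _.
  rewrite {1}(refb_decomp y) mulr_sumr; apply: eq_bigr => p _.
  by rewrite -scalerAl -scalerAr scalerA.
rewrite (mul_refb A a a') (mul_refb B b b') pure_sum.
rewrite -(pair_bigA _ (fun i p => \sum_(jq : 'I_(dim B) * 'I_(dim B))
  pure ((v2r a 0 i * v2r a' 0 p) *: (refb i * refb p))
    ((v2r b 0 jq.1 * v2r b' 0 jq.2) *: (refb jq.1 * refb jq.2)))) /=.
apply: eq_bigr => i _; rewrite exchange_big; apply: eq_bigr => p _.
rewrite -(pair_bigA _ (fun j q =>
  pure ((v2r a 0 i * v2r a' 0 p) *: (refb i * refb p))
    ((v2r b 0 j * v2r b' 0 q) *: (refb j * refb q)))) /=.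
apply: eq_bigr => j _; apply: eq_bigr => q _.
by rewrite pureZl pureZr scalerA !pureE mulrACA.
Qed.

Fact tens_mulA : associative tens_mul.
Proof.
move=> u v w; elim/tens_ind: u => [|u u' IH IH'|a b].
- by rewrite !tens_0mul.
- by rewrite !tens_mulDl IH IH'.
elim/tens_ind: v => [|v v' IH IH'|a' b'].
- by rewrite tens_mul0 !tens_0mul tens_mul0.
- by rewrite tens_mulDr !tens_mulDl tens_mulDr IH IH'.
elim/tens_ind: w => [|w w' IH IH'|a'' b''].
- by rewrite !tens_mul0.
- by rewrite !tens_mulDr IH IH'.
by rewrite !tens_mul_pure !mulrA.
Qed.

Fact tens_mul1l : left_id tens_one tens_mul.
Proof.
elim/tens_ind=> [|u v IHu IHv|a b]; first by rewrite tens_mul0.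
  by rewrite tens_mulDr IHu IHv.
by rewrite tens_mul_pure !mul1r.
Qed.

Fact tens_mul1r : right_id tens_one tens_mul.
Proof.
elim/tens_ind=> [|u v IHu IHv|a b]; first by rewrite tens_0mul.
  by rewrite tens_mulDl IHu IHv.
by rewrite tens_mul_pure !mulr1.
Qed.

Fact tens_one_neq0 : tens_one != 0.
Proof.
have nz (V : falgType k) : exists i, v2r (1 : V) 0 i != 0.
  apply/existsP; apply: contraT => /existsPn z; case/eqP: (oner_neq0 V).
  by apply: (can_inj v2rK); rewrite linear0; apply/rowP=> i;
    rewrite [RHS]mxE; apply/eqP; rewrite -[_ == _]negbK z.
have [[i hi] [j hj]] := (nz A, nz B).
apply: contraNneq (mulf_neq0 hi hj) => z.
by rewrite -pureE -/tens_one z mxE.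
Qed.

HB.instance Definition _ := GRing.Zmodule_isNzRing.Build (tens A B)
  tens_mulA tens_mul1l tens_mul1r tens_mulDl tens_mulDr tens_one_neq0.

Fact tens_scaleAl (c : k) (u v : tens A B) : c *: (u * v) = (c *: u) * v.
Proof. by rewrite [RHS]tens_mulZl. Qed.

HB.instance Definition _ :=
  GRing.Lmodule_isLalgebra.Build k (tens A B) tens_scaleAl.

Fact tens_scaleAr (c : k) (u v : tens A B) : c *: (u * v) = u * (c *: v).
Proof. by rewrite [RHS]tens_mulZr. Qed.

HB.instance Definition _ :=
  GRing.Lalgebra_isAlgebra.Build k (tens A B) tens_scaleAr.

HB.instance Definition _ := Algebra_isFalgebra.Build k (tens A B).

End Tensor.

Section Brauer.
Context (k : fieldType).
Implicit Types A B : falgType k.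

Definition tens_alg A B : falgType k := tens A B.

(* k for n = 0, A for n = 1, A (x) (A (x) ... (x) A) for n > 1 *)
Definition tens_pow A (n : nat) : falgType k :=
  iterop n tens_alg A (k^o : falgType k).

Definition alg_iso A B : Prop := exists f : {lrmorphism A -> B}, bijective f.

Definition is_central_simple A : Prop :=
  ('Z({:A}) = 1)%VS /\
  forall I : {vspace A}, ({:A} * I <= I)%VS -> (I * {:A} <= I)%VS ->
    (I = 0 \/ I = fullv)%VS.

(* M_m(A) ~= M_n(B) for some m, n > 0, where M_m(A) is A (x) M_m(k) *)
Definition brauer_equiv A B : Prop :=
  exists m n : nat,
    alg_iso (tens_alg A 'M[k]_m.+1) (tens_alg B 'M[k]_n.+1).

(* [A]^n = 1 in Br(k) *)
Definition brauer_torsion A : pred nat :=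
  fun n => (0 < n)%N && `[< brauer_equiv (tens_pow A n) (k^o : falgType k) >].

(* The order of [A] in Br(k), with the convention that infinite order is 0. *)
Definition period A : nat :=
  if pselect (exists n, brauer_torsion A n) is left tor then ex_minn tor
  else 0%N.

(* prod_i (1 + t + ... + t^(q_i - 1)), where the q_i are the prime powers of
   the factorization of per(A) *)
Definition period_poly A : {poly nat} :=
  \prod_(p <- primes (period A)) \sum_(j < (p ^ logn p (period A))%N) 'X^j.

End Brauer.

Record category := Category {
  cat_ob :> Type;
  cat_hom : cat_ob -> cat_ob -> Type;
  cat_id : forall X, cat_hom X X;
  cat_comp : forall X Y Z, cat_hom Y Z -> cat_hom X Y -> cat_hom X Z;
  cat_comp1f : forall X Y (f : cat_hom X Y), cat_comp (cat_id Y) f = f;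
  cat_compf1 : forall X Y (f : cat_hom X Y), cat_comp f (cat_id X) = f;
  cat_compA : forall W X Y Z (f : cat_hom Y Z) (g : cat_hom X Y)
      (h : cat_hom W X),
    cat_comp f (cat_comp g h) = cat_comp (cat_comp f g) h }.

Arguments cat_hom {c} X Y.
Arguments cat_id {c} X.
Arguments cat_comp {c X Y Z} f g.

Definition is_iso_pair (C : category) (X Y : C) (f : cat_hom X Y)
    (g : cat_hom Y X) : Prop :=
  cat_comp f g = cat_id Y /\ cat_comp g f = cat_id X.

Definition is_iso (C : category) (X Y : C) (f : cat_hom X Y) : Prop :=
  exists g, is_iso_pair f g.

Definition isomorphic (C : category) (X Y : C) : Prop :=
  exists f : cat_hom X Y, is_iso f.

Record functor (C D : category) := Functor {
  fun_ob :> C -> D;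
  fun_hom : forall X Y, cat_hom X Y -> cat_hom (fun_ob X) (fun_ob Y);
  fun_id : forall X, fun_hom (cat_id X) = cat_id (fun_ob X);
  fun_comp : forall X Y Z (f : cat_hom Y Z) (g : cat_hom X Y),
    fun_hom (cat_comp f g) = cat_comp (fun_hom f) (fun_hom g) }.

Arguments fun_hom {C D} f0 {X Y} f.

Definition is_equivalence (C D : category) (F : functor C D) : Prop :=
  exists (G : functor D C)
         (eta : forall X : C, cat_hom X (G (F X)))
         (eps : forall Y : D, cat_hom (F (G Y)) Y),
  [/\ forall X, is_iso (eta X),
      forall Y, is_iso (eps Y),
      forall X X' (f : cat_hom X X'),
        cat_comp (fun_hom G (fun_hom F f)) (eta X) = cat_comp (eta X') f
    & forall Y Y' (g : cat_hom Y Y'),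
        cat_comp g (eps Y) = cat_comp (eps Y') (fun_hom F (fun_hom G g))].

Record additive_category := AdditiveCategory {
  add_ob : Type;
  add_hom : add_ob -> add_ob -> zmodType;
  add_id : forall X, add_hom X X;
  add_comp : forall X Y Z, add_hom Y Z -> add_hom X Y -> add_hom X Z;
  add_comp1f : forall X Y (f : add_hom X Y), add_comp (add_id Y) f = f;
  add_compf1 : forall X Y (f : add_hom X Y), add_comp f (add_id X) = f;
  add_compA : forall W X Y Z (f : add_hom Y Z) (g : add_hom X Y)
      (h : add_hom W X),
    add_comp f (add_comp g h) = add_comp (add_comp f g) h;
  add_compDl : forall X Y Z (f f' : add_hom Y Z) (g : add_hom X Y),
    add_comp (f + f') g = add_comp f g + add_comp f' g;
  add_compDr : forall X Y Z (f : add_hom Y Z) (g g' : add_hom X Y),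
    add_comp f (g + g') = add_comp f g + add_comp f g';
  add_zero : add_ob;
  add_zeroP : add_id add_zero = 0;
  oplus : add_ob -> add_ob -> add_ob;
  inj1 : forall X Y, add_hom X (oplus X Y);
  inj2 : forall X Y, add_hom Y (oplus X Y);
  pr1 : forall X Y, add_hom (oplus X Y) X;
  pr2 : forall X Y, add_hom (oplus X Y) Y;
  pr1_inj1 : forall X Y, add_comp (pr1 X Y) (inj1 X Y) = add_id X;
  pr2_inj2 : forall X Y, add_comp (pr2 X Y) (inj2 X Y) = add_id Y;
  pr1_inj2 : forall X Y, add_comp (pr1 X Y) (inj2 X Y) = 0;
  pr2_inj1 : forall X Y, add_comp (pr2 X Y) (inj1 X Y) = 0;
  inj_pr : forall X Y, add_comp (inj1 X Y) (pr1 X Y)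
    + add_comp (inj2 X Y) (pr2 X Y) = add_id (oplus X Y) }.

Arguments add_zero {a}.
Arguments oplus {a} X Y.

Definition cat_of_additive (D : additive_category) : category :=
  Category (@add_comp1f D) (@add_compf1 D) (@add_compA D).
Coercion cat_of_additive : additive_category >-> category.

(* The morphism X (+) Y -> Z with components f and g. *)
Definition copair (D : additive_category) (X Y Z : add_ob D)
    (f : add_hom X Z) (g : add_hom Y Z) : add_hom (oplus X Y) Z :=
  add_comp f (pr1 X Y) + add_comp g (pr2 X Y).

Section Localization.
Context (C : category) (W : forall X Y : C, cat_hom X Y -> Prop).

Inductive zigzag (X : C) : C -> Type :=
| zz_nil : zigzag X X
| zz_fwd Y Z (f : cat_hom Y Z) of zigzag X Y : zigzag X Z
| zz_bwd Y Z (w : cat_hom Z Y) of W w & zigzag X Y : zigzag X Z.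

Inductive zz_eq (X : C) : forall Y, zigzag X Y -> zigzag X Y -> Prop :=
| zz_refl Y (s : zigzag X Y) : zz_eq s s
| zz_sym Y (s t : zigzag X Y) of zz_eq s t : zz_eq t s
| zz_trans Y (s t u : zigzag X Y) of zz_eq s t & zz_eq t u : zz_eq s u
| zz_congr_fwd Y Z (f : cat_hom Y Z) (s t : zigzag X Y) of zz_eq s t :
    zz_eq (zz_fwd f s) (zz_fwd f t)
| zz_congr_bwd Y Z (w : cat_hom Z Y) (Ww : W w) (s t : zigzag X Y) of
    zz_eq s t : zz_eq (zz_bwd Ww s) (zz_bwd Ww t)
| zz_fwd_id Y (s : zigzag X Y) : zz_eq (zz_fwd (cat_id Y) s) s
| zz_fwd_comp Y Z T (g : cat_hom Z T) (f : cat_hom Y Z) (s : zigzag X Y) :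
    zz_eq (zz_fwd g (zz_fwd f s)) (zz_fwd (cat_comp g f) s)
| zz_fwd_bwd Y Z (w : cat_hom Z Y) (Ww : W w) (s : zigzag X Y) :
    zz_eq (zz_fwd w (zz_bwd Ww s)) s
| zz_bwd_fwd Y Z (w : cat_hom Z Y) (Ww : W w) (s : zigzag X Z) :
    zz_eq (zz_bwd Ww (zz_fwd w s)) s.

Fixpoint zz_cat (X Y Z : C) (s : zigzag X Y) (t : zigzag Y Z) : zigzag X Z :=
  match t in zigzag _ Z return zigzag X Z with
  | zz_nil => s
  | zz_fwd _ _ f t' => zz_fwd f (zz_cat s t')
  | zz_bwd _ _ _ Ww t' => zz_bwd Ww (zz_cat s t')
  end.

Fact zz_cat_congr X Y Z (s s' : zigzag X Y) (t t' : zigzag Y Z) :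
  zz_eq s s' -> zz_eq t t' -> zz_eq (zz_cat s t) (zz_cat s' t').
Proof.
move=> ss' tt'; apply: (@zz_trans _ _ _ (zz_cat s' t)).
  by elim: t {t' tt'} => //= *; [apply: zz_congr_fwd | apply: zz_congr_bwd].
elim: tt' => /=; try by constructor.
- by move=> Y0 s0 t0 u _ h _ h'; apply: zz_trans h h'.
Qed.

Fact zz_cat0s X Y (s : zigzag X Y) : zz_cat (zz_nil X) s = s.
Proof. by elim: s => //= [? ? ? ? ->|? ? ? ? ? ->]. Qed.

Fact zz_catA X Y Z T (s : zigzag X Y) (t : zigzag Y Z) (u : zigzag Z T) :
  zz_cat (zz_cat s t) u = zz_cat s (zz_cat t u).
Proof. by elim: u => //= [? ? ? ? ->|? ? ? ? ? ->]. Qed.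

Definition loc_hom (X Y : C) : Type :=
  {S : zigzag X Y -> Prop | exists s, S = zz_eq s}.

Fact loc_hom_eq X Y (S T : loc_hom X Y) : sval S = sval T -> S = T.
Proof.
case: S T => [S p] [T q] /= e; case: T / e q => q.
by congr exist; exact: Prop_irrelevance.
Qed.

Definition zz_class X Y (s : zigzag X Y) : loc_hom X Y :=
  exist _ (zz_eq s) (ex_intro _ s erefl).

Definition zz_repr X Y (S : loc_hom X Y) : zigzag X Y :=
  projT1 (cid (proj2_sig S)).

Fact zz_reprK X Y (S : loc_hom X Y) : zz_class (zz_repr S) = S.
Proof.
by apply: loc_hom_eq; rewrite /= /zz_repr; case: (cid _) => s /= ->.
Qed.

Fact zz_classP X Y (s t : zigzag X Y) : zz_class s = zz_class t <-> zz_eq s t.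
Proof.
split=> [[e]|st]; first by rewrite e; apply: zz_refl.
apply: loc_hom_eq; apply/funext => u; apply/propext; split=> h /=.
  by apply: zz_trans h; apply: zz_sym.
by apply: zz_trans h.
Qed.

Fact zz_class_repr X Y (s : zigzag X Y) : zz_eq (zz_repr (zz_class s)) s.
Proof. by apply/zz_classP; rewrite zz_reprK. Qed.

Definition loc_comp X Y Z (S : loc_hom Y Z) (T : loc_hom X Y) : loc_hom X Z :=
  zz_class (zz_cat (zz_repr T) (zz_repr S)).

Fact loc_comp1f X Y (S : loc_hom X Y) : loc_comp (zz_class (zz_nil Y)) S = S.
Proof.
rewrite -[RHS]zz_reprK; apply/zz_classP.
exact: zz_cat_congr (zz_refl _) (zz_class_repr _).
Qed.

Fact loc_compf1 X Y (S : loc_hom X Y) : loc_comp S (zz_class (zz_nil X)) = S.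
Proof.
rewrite -[RHS]zz_reprK -[in RHS](zz_cat0s (zz_repr S)); apply/zz_classP.
exact: zz_cat_congr (zz_class_repr _) (zz_refl _).
Qed.

Fact loc_compA X Y Z T (S : loc_hom Z T) (R : loc_hom Y Z) (Q : loc_hom X Y) :
  loc_comp S (loc_comp R Q) = loc_comp (loc_comp S R) Q.
Proof.
apply/zz_classP; apply: (@zz_trans _ _ _
  (zz_cat (zz_cat (zz_repr Q) (zz_repr R)) (zz_repr S))).
  exact: zz_cat_congr (zz_class_repr _) (zz_refl _).
rewrite zz_catA; apply: zz_cat_congr (zz_refl _) _.
exact/zz_sym/zz_class_repr.
Qed.

Definition localization : category := Category loc_comp1f loc_compf1 loc_compA.

End Localization.

Section LocalizedFunctor.
Context (C C' : category).
Context (W : forall X Y : C, cat_hom X Y -> Prop).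
Context (W' : forall X Y : C', cat_hom X Y -> Prop).
Context (F : functor C C').
Context (FW : forall X Y (f : cat_hom X Y), W f -> W' (fun_hom F f)).

Fixpoint zz_map X Y (s : zigzag W X Y) : zigzag W' (F X) (F Y) :=
  match s in zigzag _ _ Y return zigzag W' (F X) (F Y) with
  | zz_nil => zz_nil W' (F X)
  | zz_fwd _ _ f t => zz_fwd (fun_hom F f) (zz_map t)
  | zz_bwd _ _ _ Ww t => zz_bwd (FW Ww) (zz_map t)
  end.

Fact zz_map_congr X Y (s t : zigzag W X Y) :
  zz_eq s t -> zz_eq (zz_map s) (zz_map t).
Proof.
elim=> /=; try by constructor.
- by move=> Y0 s0 t0 u _ h _ h'; apply: zz_trans h h'.
- by move=> Z u; rewrite fun_id; apply: zz_fwd_id.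
- by move=> ??? g f u; rewrite fun_comp; apply: zz_fwd_comp.
Qed.

Fact zz_map_cat X Y Z (s : zigzag W X Y) (t : zigzag W Y Z) :
  zz_map (zz_cat s t) = zz_cat (zz_map s) (zz_map t).
Proof. by elim: t => //= [? ? ? ? ->|? ? ? ? ? ->]. Qed.

Definition loc_map X Y (S : @cat_hom (localization W) X Y) :
    @cat_hom (localization W') (F X) (F Y) := zz_class (zz_map (zz_repr S)).

Fact loc_map_id X : loc_map (cat_id X) = cat_id (F X : localization W').
Proof. exact/zz_classP/(zz_map_congr (zz_class_repr _)). Qed.

Fact loc_map_comp X Y Z (S : @cat_hom (localization W) Y Z)
    (T : @cat_hom (localization W) X Y) :
  loc_map (cat_comp S T) = cat_comp (loc_map S) (loc_map T).
Proof.
apply/zz_classP; apply: zz_trans (zz_map_congr (zz_class_repr _)) _.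
rewrite zz_map_cat; apply: zz_cat_congr; exact/zz_sym/zz_class_repr.
Qed.

Definition localized_functor : functor (localization W) (localization W') :=
  @Functor (localization W) (localization W') F loc_map loc_map_id
    loc_map_comp.

End LocalizedFunctor.

Section DG.
Context (k : fieldType).

Record complex := Complex {
  cplx :> int -> lmodType k;
  diff : forall n, cplx n -> cplx (n + 1);
  diff_linear : forall n, linear (@diff n);
  diffK : forall n (x : cplx n), diff (diff x) = 0 }.

Arguments diff {c n} x.

(* Composition takes degrees p, q, r together with a proof of p + q = r, so
   that the axioms need no transport along equalities of degrees. *)
Record dgcat := DgCat {
  dg_ob :> Type;
  dg_hom : dg_ob -> dg_ob -> complex;
  dg_id : forall x, dg_hom x x 0;
  dg_comp : forall x y z p q r, p + q = r ->
    dg_hom y z p -> dg_hom x y q -> dg_hom x z r;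
  dg_comp_linearl : forall x y z p q r (e : p + q = r) (g : dg_hom x y q),
    linear (fun f : dg_hom y z p => dg_comp e f g);
  dg_comp_linearr : forall x y z p q r (e : p + q = r) (f : dg_hom y z p),
    linear (fun g : dg_hom x y q => dg_comp e f g);
  dg_comp1f : forall x y p (e : 0 + p = p) (f : dg_hom x y p),
    dg_comp e (dg_id y) f = f;
  dg_compf1 : forall x y p (e : p + 0 = p) (f : dg_hom x y p),
    dg_comp e f (dg_id x) = f;
  dg_compA : forall w x y z p q r pq qr pqr
      (e1 : p + q = pq) (e2 : q + r = qr) (e3 : p + qr = pqr)
      (e4 : pq + r = pqr)
      (f : dg_hom y z p) (g : dg_hom x y q) (h : dg_hom w x r),
    dg_comp e3 f (dg_comp e2 g h) = dg_comp e4 (dg_comp e1 f g) h;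
  dg_diff_id : forall x, diff (dg_id x) = 0;
  dg_leibniz : forall x y z p q r (e : p + q = r)
      (e1 : p + 1 + q = r + 1) (e2 : p + (q + 1) = r + 1)
      (f : dg_hom y z p) (g : dg_hom x y q),
    diff (dg_comp e f g) =
      dg_comp e1 (diff f) g + (-1) ^ p *: dg_comp e2 f (diff g) }.

Arguments dg_hom {d} x y.
Arguments dg_id {d} x.
Arguments dg_comp {d x y z p q r} e f g.

Record dgfunctor (A B : dgcat) := DgFunctor {
  dgf_ob :> A -> B;
  dgf_hom : forall x y n, dg_hom x y n -> dg_hom (dgf_ob x) (dgf_ob y) n;
  dgf_linear : forall x y n, linear (@dgf_hom x y n);
  dgf_diff : forall x y n (f : dg_hom x y n),
    dgf_hom (diff f) = diff (dgf_hom f);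
  dgf_id : forall x, dgf_hom (dg_id x) = dg_id (dgf_ob x);
  dgf_comp : forall x y z p q r (e : p + q = r)
      (f : dg_hom y z p) (g : dg_hom x y q),
    dgf_hom (dg_comp e f g) = dg_comp e (dgf_hom f) (dgf_hom g) }.

Arguments dgf_hom {A B} d {x y n} f.

Fact dgfunctor_eq (A B : dgcat) (F G : dgfunctor A B) (e : dgf_ob F = dgf_ob G) :
  (forall x y n, eq_rect (dgf_ob F)
     (fun ob => dg_hom x y n -> dg_hom (ob x) (ob y) n)
     (@dgf_hom A B F x y n) (dgf_ob G) e = @dgf_hom A B G x y n) ->
  F = G.
Proof.
case: F G e => [F0 F1 Fl Fd Fi Fc] [G0 G1 Gl Gd Gi Gc] /= e.
case: G0 / e G1 Gl Gd Gi Gc => /= G1 Gl Gd Gi Gc h.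
have E : F1 = G1.
  by apply: functional_extensionality_dep => x;
    apply: functional_extensionality_dep => y;
    apply: functional_extensionality_dep => n; exact: h.
case: G1 / E Gl Gd Gi Gc {h} => Gl Gd Gi Gc.
by congr DgFunctor; exact: Prop_irrelevance.
Qed.

Definition dgf_one (A : dgcat) : dgfunctor A A :=
  @DgFunctor A A id (fun x y n f => f) (fun _ _ _ _ _ _ => erefl)
    (fun _ _ _ _ => erefl) (fun _ => erefl)
    (fun _ _ _ _ _ _ _ _ _ => erefl).

Program Definition dgf_mul (A B C : dgcat) (F : dgfunctor B C)
    (G : dgfunctor A B) : dgfunctor A C :=
  @DgFunctor A C (fun x => F (G x)) (fun x y n f => dgf_hom F (dgf_hom G f))
    _ _ _ _.
Next Obligation. by move=> A B C F G x y n a u v; rewrite !dgf_linear. Qed.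
Next Obligation. by move=> * /=; rewrite !dgf_diff. Qed.
Next Obligation. by move=> * /=; rewrite !dgf_id. Qed.
Next Obligation. by move=> * /=; rewrite !dgf_comp. Qed.

Fact dgf_mul1f (A B : dgcat) (F : dgfunctor A B) : dgf_mul (dgf_one B) F = F.
Proof.
by apply: (@dgfunctor_eq _ _ (dgf_mul (dgf_one B) F) F erefl).
Qed.

Fact dgf_mulf1 (A B : dgcat) (F : dgfunctor A B) : dgf_mul F (dgf_one A) = F.
Proof.
by apply: (@dgfunctor_eq _ _ (dgf_mul F (dgf_one A)) F erefl).
Qed.

Fact dgf_mulA (A B C D : dgcat) (F : dgfunctor C D) (G : dgfunctor B C)
  (H : dgfunctor A B) : dgf_mul F (dgf_mul G H) = dgf_mul (dgf_mul F G) H.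
Proof.
by apply: (@dgfunctor_eq _ _ (dgf_mul F (dgf_mul G H))
  (dgf_mul (dgf_mul F G) H) erefl).
Qed.

Definition dgCat : category := Category dgf_mul1f dgf_mulf1 dgf_mulA.

Record dgmod (A : dgcat) := DgMod {
  dgm_cplx :> A -> complex;
  dgm_act : forall x y p q r, p + q = r ->
    dgm_cplx y p -> dg_hom x y q -> dgm_cplx x r;
  dgm_act_linearl : forall x y p q r (e : p + q = r) (f : dg_hom x y q),
    linear (fun m : dgm_cplx y p => dgm_act e m f);
  dgm_act_linearr : forall x y p q r (e : p + q = r) (m : dgm_cplx y p),
    linear (fun f : dg_hom x y q => dgm_act e m f);
  dgm_act1 : forall x p (e : p + 0 = p) (m : dgm_cplx x p),
    dgm_act e m (dg_id x) = m;
  dgm_actA : forall x y z p q r pq qr pqr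
      (e1 : p + q = pq) (e2 : q + r = qr) (e3 : p + qr = pqr)
      (e4 : pq + r = pqr)
      (m : dgm_cplx z p) (f : dg_hom y z q) (g : dg_hom x y r),
    dgm_act e3 m (dg_comp e2 f g) = dgm_act e4 (dgm_act e1 m f) g;
  dgm_leibniz : forall x y p q r (e : p + q = r)
      (e1 : p + 1 + q = r + 1) (e2 : p + (q + 1) = r + 1)
      (m : dgm_cplx y p) (f : dg_hom x y q),
    diff (dgm_act e m f) =
      dgm_act e1 (diff m) f + (-1) ^ p *: dgm_act e2 m (diff f) }.

Arguments dgm_act {A} d {x y p q r} e m f.

Record dgmod_hom (A : dgcat) (M N : dgmod A) := DgModHom {
  dgmh_fun :> forall x n, M x n -> N x n;
  dgmh_linear : forall x n, linear (@dgmh_fun x n);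
  dgmh_diff : forall x n (m : M x n), dgmh_fun (diff m) = diff (dgmh_fun m);
  dgmh_act : forall x y p q r (e : p + q = r) (m : M y p) (f : dg_hom x y q),
    dgmh_fun (dgm_act M e m f) = dgm_act N e (dgmh_fun m) f }.

Arguments dgmh_fun {A M N} d {x n} m.

Fact dgmod_hom_eq (A : dgcat) (M N : dgmod A) (f g : dgmod_hom M N) :
  @dgmh_fun A M N f = @dgmh_fun A M N g -> f = g.
Proof.
case: f g => [f fl fd fa] [g gl gd ga] /= e.
case: g / e gl gd ga => gl gd ga.
by congr DgModHom; exact: Prop_irrelevance.
Qed.

Definition dgmh_one (A : dgcat) (M : dgmod A) : dgmod_hom M M :=
  @DgModHom A M M (fun x n m => m) (fun _ _ _ _ _ => erefl)
    (fun _ _ _ => erefl) (fun _ _ _ _ _ _ _ _ => erefl).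

Program Definition dgmh_mul (A : dgcat) (M N P : dgmod A) (f : dgmod_hom N P)
    (g : dgmod_hom M N) : dgmod_hom M P :=
  @DgModHom A M P (fun x n m => f x n (g x n m)) _ _ _.
Next Obligation. by move=> A M N P f g x n a u v; rewrite !dgmh_linear. Qed.
Next Obligation. by move=> * /=; rewrite !dgmh_diff. Qed.
Next Obligation. by move=> * /=; rewrite !dgmh_act. Qed.

Fact dgmh_mul1f (A : dgcat) (M N : dgmod A) (f : dgmod_hom M N) :
  dgmh_mul (dgmh_one N) f = f.
Proof. exact: dgmod_hom_eq. Qed.

Fact dgmh_mulf1 (A : dgcat) (M N : dgmod A) (f : dgmod_hom M N) :
  dgmh_mul f (dgmh_one M) = f.
Proof. exact: dgmod_hom_eq. Qed.

Fact dgmh_mulA (A : dgcat) (M N P Q : dgmod A) (f : dgmod_hom P Q)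
  (g : dgmod_hom N P) (h : dgmod_hom M N) :
  dgmh_mul f (dgmh_mul g h) = dgmh_mul (dgmh_mul f g) h.
Proof. exact: dgmod_hom_eq. Qed.

Definition dgMod (A : dgcat) : category :=
  Category (@dgmh_mul1f A) (@dgmh_mulf1 A) (@dgmh_mulA A).

(* In degree n, the class of a cocycle vanishes in cohomology when it is the
   differential of an element of some degree p with p + 1 = n. *)
Definition is_boundary (M : complex) n (m : M n) : Prop :=
  exists p (e : p + 1 = n) (b : M p), m = eq_rect _ (fun i => M i) (diff b) n e.

(* Bijectivity of H^n(M x) -> H^n(N x) for all x and n: injectivity, then
   surjectivity. *)
Definition quasi_iso (A : dgcat) (M N : dgMod A) (f : cat_hom M N) : Prop :=
  forall x n,
    (forall m : M x n, diff m = 0 -> is_boundary (f x n m) -> is_boundary m) /\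
    (forall m' : N x n, diff m' = 0 ->
       exists2 m : M x n, diff m = 0 & is_boundary (m' - f x n m)).

Definition derived_category (A : dgcat) : category :=
  localization (@quasi_iso A).

Section Restriction.
Context (A B : dgcat) (F : dgfunctor A B).

Program Definition restr_ob (M : dgmod B) : dgmod A :=
  @DgMod A (fun x => M (F x))
    (fun x y p q r e m f => dgm_act M e m (dgf_hom F f)) _ _ _ _ _.
Next Obligation. by move=> * /=; apply: dgm_act_linearl. Qed.
Next Obligation.
by move=> M x y p q r e m a u v; rewrite dgf_linear dgm_act_linearr.
Qed.
Next Obligation. by move=> * /=; rewrite dgf_id dgm_act1. Qed.
Next Obligation. by move=> * /=; rewrite dgf_comp; apply: dgm_actA. Qed.
Next Obligation. by move=> * /=; rewrite dgf_diff; apply: dgm_leibniz. Qed.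

Program Definition restr_hom (M N : dgmod B) (f : dgmod_hom M N) :
    dgmod_hom (restr_ob M) (restr_ob N) :=
  @DgModHom A (restr_ob M) (restr_ob N) (fun x n m => f (F x) n m) _ _ _.
Next Obligation. by move=> * /=; apply: dgmh_linear. Qed.
Next Obligation. by move=> * /=; apply: dgmh_diff. Qed.
Next Obligation. by move=> * /=; apply: dgmh_act. Qed.

Fact restr_id (M : dgmod B) : restr_hom (dgmh_one M) = dgmh_one (restr_ob M).
Proof. exact: dgmod_hom_eq. Qed.

Fact restr_comp (M N P : dgmod B) (f : dgmod_hom N P) (g : dgmod_hom M N) :
  restr_hom (dgmh_mul f g) = dgmh_mul (restr_hom f) (restr_hom g).
Proof. exact: dgmod_hom_eq. Qed.

Definition restriction : functor (dgMod B) (dgMod A) :=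
  @Functor (dgMod B) (dgMod A) restr_ob restr_hom restr_id restr_comp.

Fact restr_quasi_iso (M N : dgMod B) (f : cat_hom M N) :
  quasi_iso f -> quasi_iso (fun_hom restriction f).
Proof. by move=> qf x n; exact: (qf (F x) n). Qed.

(* Restriction of scalars preserves quasi-isomorphisms, so it needs no
   deriving. *)
Definition derived_restriction :
    functor (derived_category B) (derived_category A) :=
  localized_functor restr_quasi_iso.

Definition morita_equivalence : Prop := is_equivalence derived_restriction.

End Restriction.

(* The module V if b holds, and the zero module otherwise. *)
Definition when (b : bool) (V : lmodType k) : lmodType k :=
  if b then V else 'rV[k]_0.

Definition of_when (b : bool) (V : lmodType k) : when b V -> V :=
  if b return when b V -> V then id else fun=> 0.

Definition to_when (b : bool) (V : lmodType k) : V -> when b V :=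
  if b return V -> when b V then id else fun=> 0.

Arguments of_when {b V} x.
Arguments to_when b {V} x.

Fact of_when_linear b V : linear (@of_when b V).
Proof. by case: b => // a u v /=; rewrite scaler0 addr0. Qed.

Fact to_when_linear b V : linear (@to_when b V).
Proof. by case: b => // a u v /=; rewrite scaler0 addr0. Qed.

Fact of_whenK b V : cancel (@of_when b V) (to_when b).
Proof. by case: b => // x; apply/rowP; case. Qed.

Fact to_whenK b (V : lmodType k) (x : V) :
  of_when (to_when b x) = if b then x else 0.
Proof. by case: b. Qed.

Fact to_when0 b (V : lmodType k) : to_when b (0 : V) = 0.
Proof. by case: b. Qed.

Fact of_when0 b (V : lmodType k) : of_when (0 : when b V) = 0.
Proof. by case: b. Qed.

Fact of_when_false b (V : lmodType k) (x : when b V) : ~~ b -> of_when x = 0.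
Proof. by case: b x. Qed.

Section AlgebraDg.
Context (A : algType k).

Program Definition alg_complex : complex :=
  @Complex (fun n => when (n == 0) A) (fun _ _ => 0) _ _.
Next Obligation. by move=> n a u v; rewrite scaler0 addr0. Qed.
Next Obligation. by []. Qed.

Program Definition alg_dgcat : dgcat :=
  @DgCat unit (fun _ _ => alg_complex) (fun _ => to_when (0 == 0 :> int) 1)
    (fun _ _ _ p q r _ f g =>
       to_when (r == 0) (of_when f * of_when g)) _ _ _ _ _ _ _.
Next Obligation.
move=> /= _ _ _ p q r _ g a u v.
by rewrite of_when_linear mulrDl -scalerAl to_when_linear.
Qed.
Next Obligation.
move=> /= _ _ _ p q r _ f a u v.
by rewrite of_when_linear mulrDr -scalerAr to_when_linear.
Qed.
Next Obligation. by move=> /= _ _ p e f; rewrite mul1r of_whenK. Qed.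
Next Obligation. by move=> /= _ _ p e f; rewrite mulr1 of_whenK. Qed.
Next Obligation.
move=> /= _ _ _ _ p q r pq qr pqr e1 e2 e3 e4 f g h; congr to_when.
rewrite !to_whenK -e1 -e2.
have E (i : int) : i = 0 \/ i != 0 by case: (eqVneq i 0); [left | right].
have [p0|p0] := E p; last by rewrite (of_when_false f p0) !(mul0r, if_same).
have [q0|q0] := E q; last first.
  by rewrite (of_when_false g q0) !(mul0r, mulr0, if_same).
have [r0|r0] := E r; last by rewrite (of_when_false h r0) !(mulr0, if_same).
have -> : p + q == 0 by rewrite p0 q0.
have -> : q + r == 0 by rewrite q0 r0.
by rewrite mulrA.
Qed.
Next Obligation. by []. Qed.
Next Obligation.
move=> /= _ _ _ p q r e e1 e2 f g.
by rewrite !of_when0 mul0r mulr0 !to_when0 scaler0 addr0.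
Qed.

End AlgebraDg.

Section TriangularDg.
Context (A : dgcat).

Fact diff0 (M : complex) n : diff (0 : M n) = 0.
Proof.
have := @diff_linear M n 1 0 0.
by rewrite !scale1r addr0 => h; apply: (addrI (diff (0 : M n))); rewrite -h addr0.
Qed.

Fact comp0f (x y z : A) p q r (e : p + q = r) (g : dg_hom x y q) :
  dg_comp e (0 : dg_hom y z p) g = 0.
Proof.
have := @dg_comp_linearl A x y z p q r e g 1 0 0.
by rewrite !scale1r addr0 => h; apply: (addrI (dg_comp e (0 : dg_hom y z p) g)); rewrite -h addr0.
Qed.

Fact compf0 (x y z : A) p q r (e : p + q = r) (f : dg_hom y z p) :
  dg_comp e f (0 : dg_hom x y q) = 0.
Proof.
have := @dg_comp_linearr A x y z p q r e f 1 0 0.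
by rewrite !scale1r addr0 => h; apply: (addrI (dg_comp e f (0 : dg_hom x y q))); rewrite -h addr0.
Qed.

(* The objects (1, x) and (2, x) are encoded as (false, x) and (true, x), so
   that i' >= i reads i ==> i'. *)
Program Definition T_hom (u v : bool * A) : complex :=
  @Complex (fun n => when (u.1 ==> v.1) (dg_hom u.2 v.2 n))
    (fun n f => to_when (u.1 ==> v.1) (diff (of_when f))) _ _.
Next Obligation.
by move=> u v n a f g /=; rewrite of_when_linear diff_linear to_when_linear.
Qed.
Next Obligation.
move=> [u x] [v y] n f /=; rewrite to_whenK.
by case: (u ==> v) f => f /=; rewrite ?diffK.
Qed.

Program Definition T_dg : dgcat :=
  @DgCat (bool * A)%type T_hom
    (fun u => to_when (u.1 ==> u.1) (dg_id u.2))
    (fun u v w p q r e f g =>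
       to_when (u.1 ==> w.1) (dg_comp e (of_when f) (of_when g)))
    _ _ _ _ _ _ _.
Next Obligation.
move=> /= u v w p q r e g a f f'.
by rewrite of_when_linear dg_comp_linearl to_when_linear.
Qed.
Next Obligation.
move=> /= u v w p q r e f a g g'.
by rewrite of_when_linear dg_comp_linearr to_when_linear.
Qed.
Next Obligation.
by move=> [i x] [j y] p e f /=; rewrite to_whenK implybb dg_comp1f of_whenK.
Qed.
Next Obligation.
by move=> [i x] [j y] p e f /=; rewrite to_whenK implybb dg_compf1 of_whenK.
Qed.
Next Obligation.
move=> [a w] [b x] [c y] [d z] p q r pq qr pqr e1 e2 e3 e4 f g h /=.
congr to_when; rewrite !to_whenK.
by case: a b c d f g h => [] [] [] [] f g h /=;
  rewrite ?comp0f ?compf0 ?comp0f //; exact: dg_compA.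
Qed.
Next Obligation.
by move=> [i x] /=; rewrite to_whenK implybb dg_diff_id to_when0.
Qed.
Next Obligation.
move=> [a x] [b y] [c z] p q r e e1 e2 f g /=.
rewrite !to_whenK.
by case: a b c f g => [] [] [] f g /=;
  rewrite ?comp0f ?compf0 ?diff0 ?comp0f ?compf0 ?scaler0 ?addr0 //;
  exact: dg_leibniz.
Qed.

Program Definition T_incl (i : bool) : dgfunctor A T_dg :=
  @DgFunctor A T_dg (fun x => (i, x)) (fun _ _ _ f => to_when (i ==> i) f)
    _ _ _ _.
Next Obligation. by move=> i x y n a f g; apply: to_when_linear. Qed.
Next Obligation. by move=> i x y n f /=; rewrite to_whenK implybb. Qed.
Next Obligation. by []. Qed.
Next Obligation.
by move=> i x y z p q r e f g /=; rewrite !to_whenK implybb.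
Qed.

End TriangularDg.

Definition is_additive_invariant (D : additive_category) (E : functor dgCat D) :
    Prop :=
  (forall (A B : dgCat) (F : cat_hom A B),
     morita_equivalence F -> is_iso (fun_hom E F)) /\
  (forall A : dgCat,
     is_iso (copair (fun_hom E (T_incl A false : cat_hom A (T_dg A)))
                    (fun_hom E (T_incl A true : cat_hom A (T_dg A)))
             : @cat_hom D _ _)).

(* E(A; p(t)) *)
Definition inv_poly (D : additive_category) (E : functor dgCat D)
    (A : falgType k) (p : {poly nat}) : D :=
  \big[oplus/add_zero]_(i < size p) \big[oplus/add_zero]_(j < (p`_i)%R)
    E (alg_dgcat (tens_pow A i)).

End DG.

Arguments is_additive_invariant {k D} E.
Arguments inv_poly {k D} E A p.

(* Main.v *)
(** For central simple k-algebras S and T, a functor from S to the matrices over T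
    is determined up to isomorphism by its size m, as modules over simple algebras
    are classified by their dimension. Hence E(S) and E(T) are related by canonical
    morphisms indexed by their rank m, which add up and compose like numbers, and
    which are invertible when dim S = m^2 dim T.

    Let d be the degree of A. After replacing A^(u) by a Brauer equivalent algebra
    of a common dimension, the u-th and v-th classes are joined by a morphism of rank
    C(d, i) whenever u = v + i, because the i-th exterior power of A, built from the
    swap in A (x) A, is a right A^(i)-module of dimension d^i C(d, i); and by one of
    rank 1 when u = v + n, n the period. For i the p-part of d, C(d, i) is prime to
    the prime p. If two classes x1, x2 exchange their components modulo a
    primary part of n, giving y1, y2, then one finds coprime ranks b from x1 to y1
    and a from x1 to y2, and a matrix of determinant 1 with first column (b, a) gives
    E(x1) + E(x2) = E(y1) + E(y2). So a direct sum of classes depends only on the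
    multisets of its exponents modulo each primary part q of n, and those of p_A(t)
    are uniformly distributed modulo q, hence invariant under multiplication by t. *)

From HB Require Import structures.
From mathcomp Require Import all_boot all_fingroup all_order all_algebra all_field.
From mathcomp Require Import boolp zify ring mxtens.
Require Import Defs.

Set Implicit Arguments.
Unset Strict Implicit.
Unset Printing Implicit Defensive.

Import GRing.Theory VectorInternalTheory.
Local Open Scope ring_scope.

#[local] Obligation Tactic := idtac.

Arguments diff {k c n} x.
Arguments dg_hom {k d} x y.
Arguments dg_id {k d} x.
Arguments dg_comp {k d x y z p q r} e f g.
Arguments dgf_hom {k A B} d {x y n} f.
Arguments dgm_act {k A} d {x y p q r} e m f.
Arguments dgmh_fun {k A M N} d {x n} m.
Arguments to_when {k} b {V} x.
Arguments of_when {k b V} x.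

(** Binomial ranks stand in for the primary decomposition of division algebras and for the theorem
    that period and index have the same prime factors: the p-part i of d gives a rank prime to p,
    and i is invertible modulo any h prime to p, so that steps of length i reach every shift that is
    needed. The obstacle is that the swap must lie in A (x) A over k itself. Over a field L that
    splits A, the equations x (a (x) b) = (b (x) a) x are solved by the swap, so they have a nonzero
    solution over k, which maps to c times the swap. That c comes from k is a question about square
    roots if 2 is invertible, and about traces in characteristic 2. The field L is found among
    matrices over k, as a largest commuting family of endomorphisms of a simple module, so that no
    algebraic closure enters. An invariant is defined on dg functors only, so a sum of morphisms in
    D has to be traced back to a functor; this is the use of T(A). Differences of ranks come from no
    functor: only the signs in the inverse of the 2 x 2 matrix use subtraction in D, and its
    determinant condition is an equality of natural numbers. *)

Section CategoryFacts.
Context (C : category).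
Implicit Types X Y Z : C.

Lemma is_iso_id X : is_iso (cat_id X).
Proof. by exists (cat_id X); split; rewrite cat_comp1f. Qed.

Lemma is_iso_comp X Y Z (f : cat_hom Y Z) (g : cat_hom X Y) :
  is_iso f -> is_iso g -> is_iso (cat_comp f g).
Proof.
move=> [f' [ff' f'f]] [g' [gg' g'g]]; exists (cat_comp g' f'); split.
  by rewrite cat_compA -(cat_compA f) gg' cat_compf1.
by rewrite cat_compA -(cat_compA g') f'f cat_compf1.
Qed.

Lemma is_iso_cancel X Y Z (f : cat_hom Y Z) (g h : cat_hom X Y) :
  is_iso f -> cat_comp f g = cat_comp f h -> g = h.
Proof.
move=> [f' [_ f'f]] e.
by rewrite -(cat_comp1f g) -(cat_comp1f h) -f'f -!cat_compA e.
Qed.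

Lemma is_iso_cancelr X Y Z (f : cat_hom X Y) (g h : cat_hom Y Z) :
  is_iso f -> cat_comp g f = cat_comp h f -> g = h.
Proof.
move=> [f' [ff' _]] e.
by rewrite -(cat_compf1 g) -(cat_compf1 h) -ff' !cat_compA e.
Qed.

Lemma is_iso_retraction X Y (f : cat_hom X Y) (g : cat_hom Y X) :
  is_iso f -> cat_comp g f = cat_id X -> is_iso g.
Proof.
move=> fi gf; exists f; split=> //; apply: (is_iso_cancelr fi).
by rewrite -cat_compA gf cat_comp1f cat_compf1.
Qed.

Lemma isomorphic_refl X : isomorphic X X.
Proof. by exists (cat_id X); apply: is_iso_id. Qed.

Lemma isomorphic_sym X Y : isomorphic X Y -> isomorphic Y X.
Proof. by move=> [f [g [fg gf]]]; exists g; exists f. Qed.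

Lemma isomorphic_trans Y X Z :
  isomorphic X Y -> isomorphic Y Z -> isomorphic X Z.
Proof.
by move=> [f fi] [g gi]; exists (cat_comp g f); apply: is_iso_comp.
Qed.

End CategoryFacts.

(** * Localizations of categories *)

Section LocalizationFacts.
Context (C : category) (W : forall X Y : C, cat_hom X Y -> Prop).

Implicit Types X Y Z : C.

Definition loc_of X Y (f : cat_hom X Y) : @cat_hom (localization W) X Y :=
  zz_class (zz_fwd f (zz_nil W X)).

Lemma zz_class_comp X Y Z (s : zigzag W X Y) (t : zigzag W Y Z) :
  @cat_comp (localization W) _ _ _ (zz_class t) (zz_class s)
    = zz_class (zz_cat s t).
Proof.
by apply/zz_classP/zz_cat_congr; apply: zz_class_repr.
Qed.

Lemma loc_of_comp X Y Z (f : cat_hom Y Z) (g : cat_hom X Y) :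
  @cat_comp (localization W) _ _ _ (loc_of f) (loc_of g)
    = loc_of (cat_comp f g).
Proof. by rewrite zz_class_comp; apply/zz_classP/zz_fwd_comp. Qed.

Lemma loc_of_id X : loc_of (cat_id X) = @cat_id (localization W) X.
Proof. exact/zz_classP/zz_fwd_id. Qed.

Lemma loc_of_iso (X Y : C) (f : cat_hom X Y) :
  is_iso f -> @is_iso (localization W) X Y (loc_of f).
Proof.
by move=> [g [fg gf]]; exists (loc_of g); split;
  rewrite loc_of_comp ?fg ?gf loc_of_id.
Qed.

End LocalizationFacts.

(* An equivalence whose two functors preserve the inverted arrows descends to
   the localizations: naturality is checked letter by letter on zigzags. *)
Section LocalizedEquivalence.
Context (C D : category).
Context (W : forall X Y : C, cat_hom X Y -> Prop).
Context (W' : forall X Y : D, cat_hom X Y -> Prop).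
Context (F : functor C D) (G : functor D C).
Context (FW : forall X Y (f : cat_hom X Y), W f -> W' (fun_hom F f)).
Context (GW : forall X Y (f : cat_hom X Y), W' f -> W (fun_hom G f)).
Context (eta : forall X : C, cat_hom X (G (F X))).
Context (eps : forall Y : D, cat_hom (F (G Y)) Y).
Hypothesis eta_iso : forall X, is_iso (eta X).
Hypothesis eps_iso : forall X, is_iso (eps X).
Hypothesis eta_nat : forall X X' (f : cat_hom X X'),
  cat_comp (fun_hom G (fun_hom F f)) (eta X) = cat_comp (eta X') f.
Hypothesis eps_nat : forall Y Y' (g : cat_hom Y Y'),
  cat_comp g (eps Y) = cat_comp (eps Y') (fun_hom F (fun_hom G g)).

Lemma zz_nat_eta (X Y : C) (s : zigzag W X Y) :
  zz_eq (zz_cat (zz_fwd (eta X) (zz_nil W X)) (@zz_map D C W' W G GW _ _ (@zz_map C D W W' F FW _ _ s)))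
        (zz_fwd (eta Y) s).
Proof.
elim: s => [|Y1 Z f s IH|Y1 Z w Ww s IH] /=; first exact: zz_refl.
  apply: zz_trans (zz_congr_fwd _ IH) _.
  apply: zz_trans (zz_fwd_comp _ _ _) _; rewrite eta_nat.
  exact/zz_sym/zz_fwd_comp.
apply: zz_trans (zz_congr_bwd _ IH) _.
(* A backward letter has no naturality square of its own: [w] and its formal inverse are inserted,
   the square of [w] is used, and the outer pair cancels. *)
apply: (@zz_trans _ _ _ _ _ (zz_bwd (GW (FW Ww))
    (zz_fwd (eta Y1) (zz_fwd w (zz_bwd Ww s))))).
  exact/zz_congr_bwd/zz_congr_fwd/zz_sym/zz_fwd_bwd.
apply: zz_trans (zz_congr_bwd _ (zz_fwd_comp _ _ _)) _.
rewrite -eta_nat.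
apply: zz_trans (zz_congr_bwd _ (zz_sym (zz_fwd_comp _ _ _))) _.
exact: zz_bwd_fwd.
Qed.

Lemma zz_nat_eps (X Y : D) (s : zigzag W' X Y) :
  zz_eq (zz_cat (zz_fwd (eps X) (zz_nil W' _)) s)
        (zz_fwd (eps Y) (@zz_map C D W W' F FW _ _ (@zz_map D C W' W G GW _ _ s))).
Proof.
elim: s => [|Y1 Z f s IH|Y1 Z w Ww s IH] /=; first exact: zz_refl.
  apply: zz_trans (zz_congr_fwd _ IH) _.
  apply: zz_trans (zz_fwd_comp _ _ _) _; rewrite eps_nat.
  exact/zz_sym/zz_fwd_comp.
apply: zz_trans (zz_congr_bwd _ IH) _.
set t := zz_map _ _.
apply: (@zz_trans _ _ _ _ _ (zz_bwd Ww (zz_fwd (eps Y1)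
   (zz_fwd (fun_hom F (fun_hom G w)) (zz_bwd (FW (GW Ww)) t))))).
  exact/zz_congr_bwd/zz_congr_fwd/zz_sym/zz_fwd_bwd.
apply: zz_trans (zz_congr_bwd _ (zz_fwd_comp _ _ _)) _.
rewrite -eps_nat.
apply: zz_trans (zz_congr_bwd _ (zz_sym (zz_fwd_comp _ _ _))) _.
exact: zz_bwd_fwd.
Qed.

Lemma loc_map_class (X Y : C) (s : zigzag W X Y) :
  @loc_map C D W W' F FW X Y (zz_class s) =
  zz_class (@zz_map C D W W' F FW X Y s).
Proof. exact/zz_classP/zz_map_congr/zz_class_repr. Qed.

Lemma localized_equivalence : is_equivalence (@localized_functor C D W W' F FW).
Proof.
have clG (X Y : D) (s : zigzag W' X Y) : @loc_map D C W' W G GW X Y (zz_class s) =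
  zz_class (@zz_map D C W' W G GW X Y s).
  exact/zz_classP/zz_map_congr/zz_class_repr.
exists (@localized_functor D C W' W G GW), (fun X => loc_of W (eta X)),
  (fun Y => loc_of W' (eps Y)); split.
- by move=> X; apply: loc_of_iso; apply: eta_iso.
- by move=> X; apply: (@loc_of_iso D W' (F (G X)) X); apply: eps_iso.
- move=> X X' f; rewrite -(zz_reprK f) /= loc_map_class clG.
  rewrite [LHS]zz_class_comp [RHS]zz_class_comp.
  exact/zz_classP/zz_nat_eta.
- move=> Y Y' g; rewrite -(zz_reprK g) /= clG loc_map_class.
  rewrite [LHS]zz_class_comp [RHS]zz_class_comp.
  exact/zz_classP/zz_nat_eps.
Qed.

End LocalizedEquivalence.

(** * Products of families and spaces of fixed vectors *)

Section DependentProduct.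
Context (k : fieldType) (I : Type) (V : I -> lmodType k).

(** The factors vary with the index, as do the Hom complexes that hold the entries of a matrix over
    a dg category. *)
Definition dprod : Type := forall i, V i.

HB.instance Definition _ := gen_eqMixin dprod.
HB.instance Definition _ := gen_choiceMixin dprod.

Implicit Types x y z : dprod.

Let add x y : dprod := fun i => x i + y i.
Let opp x : dprod := fun i => - x i.
Let zero : dprod := fun=> 0.

Fact dprod_addA : associative add.
Proof. by move=> x y z; apply: functional_extensionality_dep => i; apply: addrA. Qed.
Fact dprod_addC : commutative add.
Proof. by move=> x y; apply: functional_extensionality_dep => i; apply: addrC. Qed.
Fact dprod_add0 : left_id zero add.
Proof. by move=> x; apply: functional_extensionality_dep => i; apply: add0r. Qed.
Fact dprod_addN : left_inverse zero opp add.
Proof. by move=> x; apply: functional_extensionality_dep => i; apply: addNr. Qed.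

HB.instance Definition _ := GRing.isZmodule.Build dprod
  dprod_addA dprod_addC dprod_add0 dprod_addN.

Let scale (a : k) x : dprod := fun i => a *: x i.

Fact dprod_scaleA a b x : scale a (scale b x) = scale (a * b) x.
Proof. by apply: functional_extensionality_dep => i; apply: scalerA. Qed.
Fact dprod_scale1 : left_id 1 scale.
Proof. by move=> x; apply: functional_extensionality_dep => i; apply: scale1r. Qed.
Fact dprod_scaleDr : right_distributive scale +%R.
Proof. by move=> a x y; apply: functional_extensionality_dep => i; apply: scalerDr. Qed.
Fact dprod_scaleDl x : {morph scale^~ x : a b / a + b}.
Proof. by move=> a b; apply: functional_extensionality_dep => i; apply: scalerDl. Qed.

HB.instance Definition _ := GRing.Zmodule_isLmodule.Build k dprod
  dprod_scaleA dprod_scale1 dprod_scaleDr dprod_scaleDl.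

Lemma dprodP x y : (forall i, x i = y i) -> x = y.
Proof. by move=> e; apply: functional_extensionality_dep. Qed.

Lemma dprod_addE x y i : (x + y) i = x i + y i. Proof. by []. Qed.
Lemma dprod_scaleE a x i : (a *: x) i = a *: x i. Proof. by []. Qed.
Lemma dprod_sumE (J : Type) (r : seq J) (P : pred J) (F : J -> dprod) i :
  (\sum_(j <- r | P j) F j) i = \sum_(j <- r | P j) F j i.
Proof. by elim/big_rec2: _ => // j y1 y2 _ <-. Qed.

End DependentProduct.

Section FixedPoints.
Context (k : fieldType) (V : lmodType k) (e : {linear V -> V}).

Definition fixpred : {pred V} := fun x => e x == x.

Fact fixpred_submod : submod_closed fixpred.
Proof.
split=> [|a x y]; rewrite !unfold_in ?linear0 // => /eqP ex /eqP ey.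
by rewrite linearP ex ey.
Qed.
HB.instance Definition _ := GRing.isSubmodClosed.Build k V fixpred fixpred_submod.

Record fixmod := Fixmod { fval :> V; fvalP : fval \in fixpred }.
HB.instance Definition _ := [isSub for fval].
HB.instance Definition _ := [Choice of fixmod by <:].
HB.instance Definition _ := [SubChoice_isSubLmodule of fixmod by <:].

Lemma fixmod_eq (x : fixmod) : e (fval x) = fval x.
Proof. exact/eqP/fvalP. Qed.

Lemma fval_inj : injective fval.
Proof. exact: val_inj. Qed.

End FixedPoints.

(** * Morita equivalences and matrices of dg categories *)

Section LinearLemmas.
Context (k : fieldType) (U V : lmodType k) (f : U -> V) (fl : linear f).

Lemma lin0 : f 0 = 0.
Proof. by have := fl (-1) 0 0; rewrite scaleN1r addNr scaleN1r addNr. Qed.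

Lemma linD x y : f (x + y) = f x + f y.
Proof. by have := fl 1 x y; rewrite !scale1r. Qed.

Lemma linZ a x : f (a *: x) = a *: f x.
Proof. by have := fl a x 0; rewrite lin0 !addr0. Qed.

Lemma lin_sum (J : Type) (r : seq J) (P : pred J) (F : J -> U) :
  f (\sum_(j <- r | P j) F j) = \sum_(j <- r | P j) f (F j).
Proof. exact: (big_morph f linD lin0). Qed.

End LinearLemmas.

Section DgSums.
Context (k : fieldType) (A : dgcat k).

Lemma comp_suml (J : Type) (r : seq J) (P : pred J) (x y z : A) p q s
    (e : p + q = s) (F : J -> dg_hom y z p) (g : dg_hom x y q) :
  dg_comp e (\sum_(j <- r | P j) F j) g = \sum_(j <- r | P j) dg_comp e (F j) g.
Proof. exact: (lin_sum (dg_comp_linearl e g)). Qed.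

Lemma comp_sumr (J : Type) (r : seq J) (P : pred J) (x y z : A) p q s
    (e : p + q = s) (f : dg_hom y z p) (F : J -> dg_hom x y q) :
  dg_comp e f (\sum_(j <- r | P j) F j) = \sum_(j <- r | P j) dg_comp e f (F j).
Proof. exact: (lin_sum (dg_comp_linearr e f)). Qed.

Context (M : dgmod A).

Lemma act_suml (J : Type) (r : seq J) (P : pred J) (x y : A) p q s
    (e : p + q = s) (F : J -> M y p) (g : dg_hom x y q) :
  dgm_act M e (\sum_(j <- r | P j) F j) g
    = \sum_(j <- r | P j) dgm_act M e (F j) g.
Proof. exact: (lin_sum (dgm_act_linearl e g)). Qed.

Lemma act_sumr (J : Type) (r : seq J) (P : pred J) (x y : A) p q s
    (e : p + q = s) (m : M y p) (F : J -> dg_hom x y q) :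
  dgm_act M e m (\sum_(j <- r | P j) F j)
    = \sum_(j <- r | P j) dgm_act M e m (F j).
Proof. exact: (lin_sum (dgm_act_linearr e m)). Qed.

Lemma act_m0 (x y : A) p q s (e : p + q = s) (m : M y p) :
  dgm_act M e m (0 : dg_hom x y q) = 0.
Proof. exact: (lin0 (dgm_act_linearr e m)). Qed.

End DgSums.

Lemma diff_sum (k : fieldType) (M : complex k) n (J : Type) (r : seq J)
    (P : pred J) (F : J -> M n) :
  diff (\sum_(j <- r | P j) F j) = \sum_(j <- r | P j) diff (F j).
Proof. exact: (lin_sum (@diff_linear k M n)). Qed.

Lemma dgmod_hom_bij_iso (k : fieldType) (A : dgcat k) (M N : dgMod A)
    (f : dgmod_hom M N) (g : forall x n, N x n -> M x n) :
  (forall x n, cancel (@dgmh_fun k A M N f x n) (@g x n)) ->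
  (forall x n, cancel (@g x n) (@dgmh_fun k A M N f x n)) ->
  @is_iso (dgMod A) M N f.
Proof.
move=> fK gK.
have inj x n : injective (@dgmh_fun k A M N f x n) by exact: can_inj (fK x n).
have gl x n : linear (@g x n).
  by move=> c u v; apply: (@inj x n); rewrite gK dgmh_linear !gK.
have gd x n (m : N x n) : g x (n + 1) (diff m) = diff (g x n m).
  by apply: (@inj x (n + 1)); rewrite gK dgmh_diff gK.
have ga x y p q r (e : p + q = r) (m : N y p) (h : @dg_hom k A x y q) :
    g x r (dgm_act N e m h) = dgm_act M e (g y p m) h.
  by apply: (@inj x r); rewrite gK dgmh_act gK.
exists (DgModHom gl gd ga); split; apply: dgmod_hom_eq => /=;
  apply: functional_extensionality_dep => x;
  apply: functional_extensionality_dep => n;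
  by apply: functional_extensionality_dep => m /=; rewrite (gK, fK).
Qed.

Section Morita.
Context (k : fieldType) (A B : dgcat k) (F : dgfunctor A B).
Context (Finv : forall x y n, @dg_hom k B (F x) (F y) n -> @dg_hom k A x y n).
Hypothesis FK : forall x y n, cancel (@dgf_hom k A B F x y n) (@Finv x y n).
Hypothesis FinvK : forall x y n, cancel (@Finv x y n) (@dgf_hom k A B F x y n).
Context (I : B -> finType) (X : forall y, I y -> A).
Context (a : forall y (i : I y), dg_hom (F (X i)) y 0).
Context (b : forall y (i : I y), dg_hom y (F (X i)) 0).
Hypothesis da : forall y (i : I y), diff (a i) = 0.
Hypothesis db : forall y (i : I y), diff (b i) = 0.
Hypothesis ab : forall y, \sum_(i : I y) dg_comp (addr0 0) (a i) (b i) = dg_id y.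

Lemma Finv_inj x y n : injective (@dgf_hom k A B F x y n).
Proof. exact: can_inj (@FK x y n). Qed.

Lemma Finv_linear x y n : linear (@Finv x y n).
Proof.
move=> c u v; apply: (@Finv_inj x y n); rewrite FinvK dgf_linear.
by rewrite !FinvK.
Qed.

Lemma Finv_comp x y z p q r (e : p + q = r) (f : dg_hom (F y) (F z) p)
  (g : dg_hom (F x) (F y) q) :
  Finv (dg_comp e f g) = dg_comp e (Finv f) (Finv g).
Proof. by apply: (@Finv_inj x z r); rewrite FinvK dgf_comp !FinvK. Qed.

Lemma Finv_diff x y p (f : dg_hom (F x) (F y) p) : Finv (diff f) = diff (Finv f).
Proof. by apply: (@Finv_inj x y (p + 1)); rewrite FinvK dgf_diff FinvK. Qed.

Lemma Finv_id x : Finv (dg_id (F x)) = dg_id x.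
Proof. by apply: (@Finv_inj x x 0); rewrite FinvK dgf_id. Qed.

(* The idempotent matrix over A through which y is a summand of the sum of
   the F (X i), and the matrices of the maps of B with respect to it. *)
Definition cmx (y' y : B) q (f : dg_hom y' y q) (i : I y) (j : I y') :
    dg_hom (X j) (X i) q :=
  Finv (dg_comp (addr0 q) (dg_comp (add0r q) (b i) f) (a j)).

Lemma cmx_linear y' y q i j : linear (fun f : dg_hom y' y q => cmx f i j).
Proof.
by move=> c u v; rewrite /cmx dg_comp_linearr dg_comp_linearl Finv_linear.
Qed.

(** Inserting [ab] between the two maps turns composition into multiplication of matrices. *)
Lemma cmx_comp y y' y'' (p q r : int) (e : p + q = r) (f : dg_hom y' y p)
    (g : dg_hom y'' y' q) i j :
  cmx (dg_comp e f g) i j = \sum_l dg_comp e (cmx f i l) (cmx g l j).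
Proof.
rewrite /cmx; under eq_bigr do rewrite -Finv_comp.
rewrite -(lin_sum (@Finv_linear _ _ _)); congr Finv.
transitivity (dg_comp e (dg_comp (add0r p) (b i) f)
  (\sum_l dg_comp (add0r q) (a l) (dg_comp (addr0 q) (dg_comp (add0r q) (b l) g) (a j)))).
  rewrite (dg_compA (add0r p) e (add0r r) e).
  rewrite -(dg_compA e (addr0 q) e (addr0 r)); congr (dg_comp _ _ _).
  under eq_bigr => l _ do rewrite
    -(dg_compA (add0r q) (addr0 q) (add0r q) (addr0 q))
    (dg_compA (addr0 0) (add0r q) (add0r q) (add0r q)).
  by rewrite -comp_suml ab dg_comp1f.
rewrite comp_sumr; apply: eq_bigr => l _.
by rewrite (dg_compA (addr0 p) (add0r q) e e).
Qed.

Lemma cmx_diff y' y q (f : dg_hom y' y q) i j :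
  diff (cmx f i j) = cmx (diff f) i j.
Proof.
rewrite /cmx -Finv_diff; congr Finv.
have e1 : q + 1 + 0 = q + 1 by rewrite addr0.
have e2 : q + (0 + 1) = q + 1 by rewrite add0r.
have e3 : 0 + 1 + q = q + 1 by rewrite add0r addrC.
rewrite (dg_leibniz (addr0 q) e1 e2) (dg_leibniz (add0r q) e3 (add0r (q + 1))).
rewrite da (lin0 (dg_comp_linearr e2 _)) scaler0 addr0.
rewrite db (lin0 (dg_comp_linearl e3 _)) add0r expr0z scale1r.
by rewrite (eq_irrelevance e1 (addr0 (q + 1))).
Qed.

Section Coinduced.
Context (M : dgmod A).

Definition cfam y (n : int) : lmodType k := @dprod k (I y) (fun i => M (X i) n).

Definition ract y' y (p q r : int) (e : p + q = r) (m : cfam y p)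
    (f : dg_hom y' y q) : cfam y' r :=
  fun j => \sum_i dgm_act M e (m i) (cmx f i j).

Lemma ract_linearl y' y p q r (e : p + q = r) (f : dg_hom y' y q) :
  linear (fun m : cfam y p => ract e m f).
Proof.
move=> c u v; apply: dprodP => j; rewrite dprod_addE dprod_scaleE /ract.
rewrite scaler_sumr -big_split /=; apply: eq_bigr => i _.
exact: dgm_act_linearl.
Qed.

Lemma ract_linearr y' y p q r (e : p + q = r) (m : cfam y p) :
  linear (fun f : dg_hom y' y q => ract e m f).
Proof.
move=> c u v; apply: dprodP => j; rewrite dprod_addE dprod_scaleE /ract.
rewrite scaler_sumr -big_split /=; apply: eq_bigr => i _.
by rewrite cmx_linear dgm_act_linearr.
Qed.

Lemma ractA x y z (p q r pq qr pqr : int) (e1 : p + q = pq) (e2 : q + r = qr)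
    (e3 : p + qr = pqr) (e4 : pq + r = pqr)
    (m : cfam z p) (f : dg_hom y z q) (g : dg_hom x y r) :
  ract e3 m (dg_comp e2 f g) = ract e4 (ract e1 m f) g.
Proof.
apply: dprodP => j; rewrite /ract.
under [RHS]eq_bigr do rewrite act_suml.
rewrite exchange_big /=; apply: eq_bigr => i _.
rewrite cmx_comp act_sumr; apply: eq_bigr => l _.
exact: dgm_actA.
Qed.

Lemma ract_leibniz x y (p q r : int) (e : p + q = r)
    (e1 : p + 1 + q = r + 1) (e2 : p + (q + 1) = r + 1)
    (m : cfam y p) (f : dg_hom x y q) :
  (fun j => diff (ract e m f j)) =
    ract e1 (fun i => diff (m i)) f + (-1) ^ p *: ract e2 m (diff f).
Proof.
apply: dprodP => j; rewrite dprod_addE dprod_scaleE /ract diff_sum.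
rewrite scaler_sumr -big_split /=; apply: eq_bigr => i _.
by rewrite -cmx_diff; apply: dgm_leibniz.
Qed.

(** The matrix of [dg_id y] is idempotent but in general not the identity. Hence the families that
    it fixes, and not all of [cfam], carry a unital action of [B]. *)
Definition cproj y n (m : cfam y n) : cfam y n := ract (addr0 n) m (dg_id y).

HB.instance Definition _ y n := GRing.isLinear.Build k _ _ _ (@cproj y n)
  (@ract_linearl y y n 0 n (addr0 n) (dg_id y)).

Lemma cproj_ract x y p q r (e : p + q = r) (m : cfam y p) (f : dg_hom x y q) :
  cproj (ract e m f) = ract e m f.
Proof.
rewrite /cproj -(ractA e (addr0 q) e (addr0 r)).
by rewrite dg_compf1.
Qed.

Lemma cproj_diff y n (m : cfam y n) :
  cproj (fun i => diff (m i)) = (fun j => diff (cproj m j)).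
Proof.
have e1 : n + 1 + 0 = n + 1 by rewrite addr0.
have e2 : n + (0 + 1) = n + 1 by rewrite add0r.
rewrite /cproj (ract_leibniz (addr0 n) e1 e2) dg_diff_id.
rewrite (lin0 (ract_linearr e2 _)) scaler0 addr0.
by rewrite (eq_irrelevance e1 (addr0 (n + 1))).
Qed.

Definition coind_deg y n : lmodType k := fixmod (@cproj y n).

Definition to_coind y n (m : cfam y n) (h : cproj m = m) : coind_deg y n :=
  Fixmod (introT eqP h).

Lemma coind_diff_subproof y n (m : coind_deg y n) :
  cproj ((fun i => diff (fval m i)) : cfam y (n + 1)) = (fun i => diff (fval m i)).
Proof.
by rewrite cproj_diff; apply: dprodP => j; rewrite (fixmod_eq m).
Qed.

Program Definition coind_cplx y : complex k :=
  @Complex k (coind_deg y) (fun n m => to_coind (coind_diff_subproof m)) _ _.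
Next Obligation.
move=> y n c u v; apply: fval_inj; apply: dprodP => i /=.
exact: diff_linear.
Qed.
Next Obligation.
by move=> y n m; apply: fval_inj; apply: dprodP => i /=; apply: diffK.
Qed.

(** Coinduction, Hom_A(B(F -, y), M): the module B(F -, y) is a summand of the sum of the
    representables A(-, X i), so these maps are the families of elements of the M (X i) fixed by the
    idempotent. *)
Program Definition coind : dgmod B :=
  @DgMod k B coind_cplx
    (fun x y p q r e m f => to_coind (cproj_ract e (fval m) f)) _ _ _ _ _.
Next Obligation.
by move=> x y p q r e f c u v; apply: fval_inj; apply: ract_linearl.
Qed.
Next Obligation.
by move=> x y p q r e m c u v; apply: fval_inj; apply: ract_linearr.
Qed.
Next Obligation.
move=> x p e m; apply: fval_inj => /=.
by rewrite (eq_irrelevance e (addr0 p)); apply: (fixmod_eq m).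
Qed.
Next Obligation. by move=> *; apply: fval_inj; apply: ractA. Qed.
Next Obligation. by move=> *; apply: fval_inj; apply: ract_leibniz. Qed.

End Coinduced.

Section CoinducedMap.
Context (M N : dgmod A) (h : dgmod_hom M N).

Lemma ract_map y' y p q r (e : p + q = r) (m : cfam M y p) (f : dg_hom y' y q) :
  ract e ((fun i => h _ _ (m i)) : cfam N y p) f = (fun j => h _ _ (ract e m f j)).
Proof.
apply: dprodP => j; rewrite /ract (lin_sum (@dgmh_linear k A M N h (X j) r)).
by apply: eq_bigr => i _; rewrite dgmh_act.
Qed.

Lemma coind_hom_subproof y n (m : coind_deg M y n) :
  cproj ((fun i => h _ _ (fval m i)) : cfam N y n) = (fun i => h _ _ (fval m i)).
Proof.
rewrite /cproj ract_map; apply: dprodP => j.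
by congr (h _ _ _); exact: (congr1 (fun u : cfam M y n => u j) (fixmod_eq m)).
Qed.

Program Definition coind_hom : dgmod_hom (coind M) (coind N) :=
  @DgModHom k B (coind M) (coind N)
    (fun y n m => to_coind (coind_hom_subproof m)) _ _ _.
Next Obligation.
move=> y n c u v; apply: fval_inj; apply: dprodP => i /=.
exact: dgmh_linear.
Qed.
Next Obligation.
by move=> y n m; apply: fval_inj; apply: dprodP => i /=; apply: dgmh_diff.
Qed.
Next Obligation.
by move=> x y p q r e m f; apply: fval_inj => /=; rewrite ract_map.
Qed.

(* The boundaries in degree n only come from degree n - 1. *)
Lemma is_boundaryP (C : complex k) (n : int) (m : C (n + 1)) :
  is_boundary m <-> exists u : C n, m = diff u.
Proof.
split=> [[p [e [u ->]]]|[u ->]]; last by exists n, erefl, u.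
have ep := addIr _ e; case: n / ep e m u => e m u.
by exists u; rewrite (eq_irrelevance e erefl).
Qed.

(** Primitives and preimages of cocycles are chosen in each component separately; [cproj], which
    commutes with the differentials and with [h], brings the choice back into the summand. *)
Lemma coind_quasi_iso : @quasi_iso k A M N h -> @quasi_iso k B (coind M) (coind N) coind_hom.
Proof.
move=> qh y n; have -> : n = (n - 1) + 1 by rewrite subrK.
move: (n - 1) => {}n; split.
  move=> m dm /is_boundaryP [u hu]; apply/is_boundaryP.
  have bi (i : I y) : exists v : M (X i) n, fval m i = diff v.
    apply/is_boundaryP; apply: (qh (X i) (n + 1)).1.
      exact: (congr1 (fun w : coind_deg M y (n + 1 + 1) => fval w i) dm).
    apply/is_boundaryP; exists (fval u i).
    exact: (congr1 (fun w : coind_deg N y (n + 1) => fval w i) hu).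
  pose v : cfam M y n := fun i => sval (cid (bi i)).
  have dv : (fun i => diff (v i)) = fval m.
    by apply: dprodP => i; rewrite /v; case: (cid (bi i)).
  exists (to_coind (cproj_ract (addr0 n) v (dg_id y))); apply: fval_inj => /=.
  apply: dprodP => j; rewrite -(fixmod_eq m) -dv.
  exact: (congr1 (fun w : cfam M y (n + 1) => w j) (cproj_diff v)).
move=> m' dm'.
have ci (i : I y) : exists m : M (X i) (n + 1), diff m = 0 /\
    exists u, fval m' i - h _ _ m = diff u.
  have [|m dm /is_boundaryP hm] := (qh (X i) (n + 1)).2 (fval m' i).
    exact: (congr1 (fun w : coind_deg N y (n + 1 + 1) => fval w i) dm').
  by exists m.
pose m : cfam M y (n + 1) := fun i => sval (cid (ci i)).
have dm i : diff (m i) = 0 by rewrite /m; case: (cid (ci i)) => ? [].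
have bm i : exists u, fval m' i - h _ _ (m i) = diff u.
  by rewrite /m; case: (cid (ci i)) => ? [].
pose u : cfam N y n := fun i => sval (cid (bm i)).
have du : (fun i => diff (u i)) = fval m' - ((fun i => h _ _ (m i)) : cfam N y (n + 1)).
  apply: dprodP => i; rewrite /u; case: (cid (bm i)) => /= ? <-.
  by [].
exists (to_coind (cproj_ract (addr0 (n + 1)) m (dg_id y))).
  apply: fval_inj; apply: dprodP => j /=.
  rewrite -[LHS](congr1 (fun w : cfam M y (n + 1 + 1) => w j) (cproj_diff m)).
  have -> : (fun i => diff (m i)) = (0 : cfam M y (n + 1 + 1)).
    by apply: dprodP => i; rewrite dm.
  by rewrite linear0.
apply/is_boundaryP.
exists (to_coind (cproj_ract (addr0 n) u (dg_id y))); apply: fval_inj => /=.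
rewrite [RHS](_ : _ = cproj ((fun i => diff (u i)) : cfam N y (n + 1))); last first.
  by rewrite cproj_diff.
rewrite du linearB /= (fixmod_eq m') /cproj ract_map.
by apply: dprodP => j.
Qed.

End CoinducedMap.

Lemma coind_hom_id M : coind_hom (dgmh_one M) = dgmh_one (coind M).
Proof.
apply: dgmod_hom_eq; apply: functional_extensionality_dep => x;
  apply: functional_extensionality_dep => n;
  by apply: functional_extensionality_dep => m /=; apply: fval_inj.
Qed.

Lemma coind_hom_comp (M N P : dgmod A) (f : dgmod_hom N P) (g : dgmod_hom M N) :
  coind_hom (dgmh_mul f g) = dgmh_mul (coind_hom f) (coind_hom g).
Proof.
apply: dgmod_hom_eq; apply: functional_extensionality_dep => x;
  apply: functional_extensionality_dep => n;
  by apply: functional_extensionality_dep => m /=; apply: fval_inj.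
Qed.

Definition coinduction : functor (dgMod A) (dgMod B) :=
  @Functor (dgMod A) (dgMod B) coind coind_hom coind_hom_id coind_hom_comp.

Lemma Fcmx y' y q (f : dg_hom y' y q) (i : I y) (j : I y') :
  dgf_hom F (cmx f i j)
  = dg_comp (addr0 q) (dg_comp (add0r q) (b i) f) (a j).
Proof. exact: FinvK. Qed.

Section Unit.
Context (N : dgmod B).

Lemma unit_subproof y n (m : N y n) :
  cproj ((fun i => dgm_act N (addr0 n) m (a i)) : cfam (restr_ob F N) y n)
  = (fun i => dgm_act N (addr0 n) m (a i)).
Proof.
apply: dprodP => j; rewrite /cproj /ract /=.
transitivity (dgm_act N (addr0 n) m (dg_comp (add0r 0) (\sum_i dg_comp (addr0 0) (a i) (b i)) (a j))).
  rewrite comp_suml act_sumr; apply: eq_bigr => i _.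
  rewrite Fcmx dg_compf1 -(dgm_actA (addr0 n) (addr0 0) (addr0 n) (addr0 n)).
  by rewrite (dg_compA (addr0 0) (addr0 0) (addr0 0) (addr0 0)) (eq_irrelevance (add0r 0) (addr0 0)).
by rewrite ab dg_comp1f.
Qed.

Program Definition unit_hom : dgmod_hom N (coind (restr_ob F N)) :=
  @DgModHom k B N (coind (restr_ob F N))
    (fun y n m => to_coind (unit_subproof m)) _ _ _.
Next Obligation.
move=> y n c u v; apply: fval_inj; apply: dprodP => i /=.
exact: dgm_act_linearl.
Qed.
Next Obligation.
move=> y n m; apply: fval_inj; apply: dprodP => i /=.
have e1 : n + 1 + 0 = n + 1 by rewrite addr0.
have e2 : n + (0 + 1) = n + 1 by rewrite add0r.
rewrite (dgm_leibniz (addr0 n) e1 e2) da act_m0 scaler0 addr0.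
by rewrite (eq_irrelevance e1 (addr0 (n + 1))).
Qed.
Next Obligation.
move=> x y p q r e m f; apply: fval_inj; apply: dprodP => j /=.
rewrite /ract /=.
transitivity (dgm_act N e m (dg_comp (addr0 q) (dg_comp (add0r q)
  (\sum_i dg_comp (addr0 0) (a i) (b i)) f) (a j))).
  by rewrite ab dg_comp1f (dgm_actA e (addr0 q) e (addr0 r)).
rewrite comp_suml comp_suml act_sumr; apply: eq_bigr => i _.
rewrite Fcmx -(dgm_actA (addr0 p) (add0r q) e e).
rewrite (dg_compA (add0r q) (addr0 q) (add0r q) (addr0 q)).
by rewrite (dg_compA (addr0 0) (add0r q) (add0r q) (add0r q)).
Qed.

Definition unit_inv y n (m : coind (restr_ob F N) y n) : N y n :=
  \sum_i dgm_act N (addr0 n) (fval m i : N (F (X i)) n) (b i).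

Lemma unit_iso : @is_iso (dgMod B) _ _ unit_hom.
Proof.
apply: (@dgmod_hom_bij_iso k B N (coind (restr_ob F N)) unit_hom unit_inv) => y n m.
  rewrite /unit_inv /=.
  under eq_bigr do rewrite -(dgm_actA (addr0 n) (addr0 0) (addr0 n) (addr0 n)).
  by rewrite -act_sumr ab dgm_act1.
apply: fval_inj; rewrite -[RHS](fixmod_eq m); apply: dprodP => j /=.
rewrite /unit_inv act_suml /cproj /ract /=; apply: eq_bigr => i _.
rewrite Fcmx dg_compf1.
by rewrite -(dgm_actA (addr0 n) (addr0 0) (addr0 n) (addr0 n)).
Qed.

End Unit.

Section Counit.
Context (M : dgmod A).

Definition counit_fun x n (m : coind M (F x) n) : M x n :=
  \sum_i dgm_act M (addr0 n) (fval m i) (Finv (b i)).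

Program Definition counit_hom : dgmod_hom (restr_ob F (coind M)) M :=
  @DgModHom k A (restr_ob F (coind M)) M counit_fun _ _ _.
Next Obligation.
move=> x n c u v; rewrite /counit_fun scaler_sumr -big_split /=.
by apply: eq_bigr => i _; apply: dgm_act_linearl.
Qed.
Next Obligation.
move=> x n m; rewrite /counit_fun /= diff_sum; apply: eq_bigr => i _.
have e1 : n + 1 + 0 = n + 1 by rewrite addr0.
have e2 : n + (0 + 1) = n + 1 by rewrite add0r.
rewrite (dgm_leibniz (addr0 n) e1 e2) -Finv_diff db.
rewrite (lin0 (@Finv_linear _ _ _)) act_m0 scaler0 addr0.
by rewrite (eq_irrelevance e1 (addr0 (n + 1))).
Qed.
Next Obligation.
move=> x y p q r e m f; rewrite /counit_fun /= /ract /=.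
under eq_bigr do rewrite act_suml.
rewrite exchange_big act_suml /=; apply: eq_bigr => i _.
rewrite -(dgm_actA (addr0 p) (add0r q) e e).
under eq_bigr do rewrite -(dgm_actA e (addr0 q) e (addr0 r)).
rewrite -act_sumr; congr (dgm_act _ _ _ _).
rewrite /cmx; under eq_bigr do rewrite -Finv_comp
  -(dg_compA (addr0 q) (addr0 0) (addr0 q) (addr0 q)).
rewrite -(lin_sum (@Finv_linear _ _ _)) -comp_sumr ab dg_compf1 Finv_comp.
by rewrite FK.
Qed.

Lemma counit_inv_subproof x n (m : M x n) :
  cproj ((fun i => dgm_act M (addr0 n) m (Finv (a i))) : cfam M (F x) n)
  = (fun i => dgm_act M (addr0 n) m (Finv (a i))).
Proof.
apply: dprodP => j; rewrite /cproj /ract.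
under eq_bigr do rewrite /cmx -(dgm_actA (addr0 n) (addr0 0) (addr0 n) (addr0 n))
  -Finv_comp dg_compf1 (dg_compA (addr0 0) (addr0 0) (addr0 0) (addr0 0)).
rewrite -act_sumr -(lin_sum (@Finv_linear _ _ _)) -comp_suml ab.
by rewrite dg_comp1f.
Qed.

Lemma counit_iso : @is_iso (dgMod A) _ _ counit_hom.
Proof.
apply: (@dgmod_hom_bij_iso k A (restr_ob F (coind M)) M counit_hom
  (fun x n m => to_coind (counit_inv_subproof m))) => x n m.
  apply: fval_inj; rewrite -[RHS](fixmod_eq m); apply: dprodP => j /=.
  rewrite /counit_fun act_suml /cproj /ract; apply: eq_bigr => i _.
  rewrite -(dgm_actA (addr0 n) (addr0 0) (addr0 n) (addr0 n)) -Finv_comp.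
  by rewrite /cmx dg_compf1.
rewrite /= /counit_fun /=.
under eq_bigr do rewrite -(dgm_actA (addr0 n) (addr0 0) (addr0 n) (addr0 n)) -Finv_comp.
by rewrite -act_sumr -(lin_sum (@Finv_linear _ _ _)) ab Finv_id dgm_act1.
Qed.

End Counit.

(** The hypotheses of the section say that [F] is fully faithful and that each object of [B] is a
    retract of a finite sum of objects [F (X i)]. Restriction is then an equivalence before
    localization, and coinduction, cut out of finite products, preserves quasi-isomorphisms, so both
    descend. *)
Theorem fully_faithful_morita : morita_equivalence F.
Proof.
apply: (@localized_equivalence (dgMod B) (dgMod A) _ _ (restriction F)
  coinduction (@restr_quasi_iso k A B F) _ unit_hom counit_hom).
- by move=> M N f; apply: coind_quasi_iso.
- exact: unit_iso.
- exact: counit_iso.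
- move=> N N' f; apply: dgmod_hom_eq; apply: functional_extensionality_dep => y;
  apply: functional_extensionality_dep => n;
  apply: functional_extensionality_dep => m /=.
  by apply: fval_inj; apply: dprodP => i /=; rewrite dgmh_act.
- move=> M M' f; apply: dgmod_hom_eq; apply: functional_extensionality_dep => x;
  apply: functional_extensionality_dep => n;
  apply: functional_extensionality_dep => m /=.
  rewrite /counit_fun (lin_sum (@dgmh_linear k A M M' f x n)).
  by apply: eq_bigr => i _; rewrite dgmh_act.
Qed.

End Morita.

(** * Invariance under natural isomorphism *)

Section PathObject.
Context (k : fieldType) (A : dgcat k).

(** The product of [A] with the category of two uniquely isomorphic objects: a natural isomorphism
    between functors on [A] is a functor on this category. *)
Program Definition path_dg : dgcat k :=
  @DgCat k (bool * A)%type (fun u v => dg_hom u.2 v.2) (fun u => dg_id u.2)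
    (fun u v w p q r e f g => dg_comp e f g) _ _ _ _ _ _ _.
Next Obligation. by move=> *; apply: dg_comp_linearl. Qed.
Next Obligation. by move=> *; apply: dg_comp_linearr. Qed.
Next Obligation. by move=> *; apply: dg_comp1f. Qed.
Next Obligation. by move=> *; apply: dg_compf1. Qed.
Next Obligation. by move=> *; apply: dg_compA. Qed.
Next Obligation. by move=> *; apply: dg_diff_id. Qed.
Next Obligation. by move=> *; apply: dg_leibniz. Qed.

Definition path_incl (i : bool) : dgfunctor A path_dg :=
  @DgFunctor k A path_dg (fun x => (i, x)) (fun x y n f => f)
    (fun _ _ _ _ _ _ => erefl) (fun _ _ _ _ => erefl) (fun _ => erefl)
    (fun _ _ _ _ _ _ _ _ _ => erefl).

Definition path_proj : dgfunctor path_dg A :=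
  @DgFunctor k path_dg A (fun u => u.2) (fun x y n f => f)
    (fun _ _ _ _ _ _ => erefl) (fun _ _ _ _ => erefl) (fun _ => erefl)
    (fun _ _ _ _ _ _ _ _ _ => erefl).

Lemma path_incl_morita i : morita_equivalence (path_incl i).
Proof.
apply: (@fully_faithful_morita k A path_dg (path_incl i) (fun x y n f => f) _ _
  (fun=> unit) (fun y _ => y.2) (fun y _ => dg_id y.2) (fun y _ => dg_id y.2)) => //.
- by move=> y _; apply: (@dg_diff_id k A).
- by move=> y _; apply: (@dg_diff_id k A).
- by move=> y; rewrite big_const card_unit /= addr0; apply: (@dg_comp1f k A).
Qed.

End PathObject.

Record dg_nat_iso (k : fieldType) (A B : dgcat k) (F G : dgfunctor A B) := DgNatIso {
  dgn_to : forall x, dg_hom (F x) (G x) 0;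
  dgn_inv : forall x, dg_hom (G x) (F x) 0;
  dgn_to_diff : forall x, diff (dgn_to x) = 0;
  dgn_inv_diff : forall x, diff (dgn_inv x) = 0;
  dgn_toK : forall x, dg_comp (addr0 0) (dgn_inv x) (dgn_to x) = dg_id (F x);
  dgn_invK : forall x, dg_comp (addr0 0) (dgn_to x) (dgn_inv x) = dg_id (G x);
  dgn_nat : forall x y n (f : @dg_hom k A x y n),
    dg_comp (addr0 n) (dgf_hom G f) (dgn_to x)
      = dg_comp (add0r n) (dgn_to y) (dgf_hom F f) }.

Section PathFunctor.
Context (k : fieldType) (A B : dgcat k) (F G : dgfunctor A B).
Context (eta : dg_nat_iso F G).

Definition ptot (u : path_dg A) : B := if u.1 then G u.2 else F u.2.

Definition pto (u : path_dg A) : dg_hom (F u.2) (ptot u) 0 :=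
  if u.1 as b return dg_hom (F u.2) (if b then G u.2 else F u.2) 0
  then dgn_to eta u.2 else dg_id (F u.2).

Definition pinv (u : path_dg A) : dg_hom (ptot u) (F u.2) 0 :=
  if u.1 as b return dg_hom (if b then G u.2 else F u.2) (F u.2) 0
  then dgn_inv eta u.2 else dg_id (F u.2).

Lemma ptoK u : dg_comp (addr0 0) (pinv u) (pto u) = dg_id (F u.2).
Proof. by case: u => [[]] x; [apply: dgn_toK | apply: dg_comp1f]. Qed.

Lemma pinvK u : dg_comp (addr0 0) (pto u) (pinv u) = dg_id (ptot u).
Proof. by case: u => [[]] x; [apply: dgn_invK | apply: dg_comp1f]. Qed.

Lemma pto_diff u : diff (pto u) = 0.
Proof. by case: u => [[]] x; [apply: dgn_to_diff | apply: dg_diff_id]. Qed.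

Lemma pinv_diff u : diff (pinv u) = 0.
Proof. by case: u => [[]] x; [apply: dgn_inv_diff | apply: dg_diff_id]. Qed.

Definition phom (u v : path_dg A) n (f : dg_hom u v n) : dg_hom (ptot u) (ptot v) n :=
  dg_comp (addr0 n) (dg_comp (add0r n) (pto v) (dgf_hom F f)) (pinv u).

Program Definition path_functor : dgfunctor (path_dg A) B :=
  @DgFunctor k (path_dg A) B ptot phom _ _ _ _.
Next Obligation.
move=> u v n c f g; rewrite /phom.
by rewrite dgf_linear dg_comp_linearr dg_comp_linearl.
Qed.
Next Obligation.
move=> u v q f; rewrite /phom.
have e1 : q + 1 + 0 = q + 1 by rewrite addr0.
have e2 : q + (0 + 1) = q + 1 by rewrite add0r.
have e3 : 0 + 1 + q = q + 1 by rewrite add0r addrC.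
rewrite (dg_leibniz (addr0 q) e1 e2) (dg_leibniz (add0r q) e3 (add0r (q + 1))).
rewrite pinv_diff (lin0 (dg_comp_linearr e2 _)) scaler0 addr0.
rewrite pto_diff (lin0 (dg_comp_linearl e3 _)) add0r expr0z scale1r.
by rewrite (eq_irrelevance e1 (addr0 (q + 1))) dgf_diff.
Qed.
Next Obligation.
by move=> u; rewrite /phom dgf_id dg_compf1 pinvK.
Qed.
Next Obligation.
move=> u v w p q r e f g; rewrite /phom dgf_comp.
rewrite -(dg_compA (addr0 p) (add0r q) e e).
rewrite (dg_compA (add0r q) (addr0 q) (add0r q) (addr0 q)).
rewrite (dg_compA (addr0 0) (add0r q) (add0r q) (add0r q)) ptoK dg_comp1f.
rewrite (dg_compA e (addr0 q) e (addr0 r)).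
by rewrite (dg_compA (add0r p) e (add0r r) e).
Qed.

End PathFunctor.

Section AdditiveInvariant.
Context (k : fieldType) (D : additive_category) (E : functor (dgCat k) D).
Hypothesis addE : is_additive_invariant E.

Let EM (A B : dgcat k) (F : dgfunctor A B) : @cat_hom D (E A) (E B) :=
  @fun_hom (dgCat k) D E A B F.

Lemma inv_morita (A B : dgcat k) (F : dgfunctor A B) :
  morita_equivalence F -> @is_iso D _ _ (EM F).
Proof. by case: addE => h _; apply: (h A B F). Qed.

Lemma inv_mul (A B C : dgcat k) (F : dgfunctor B C) (G : dgfunctor A B) :
  EM (dgf_mul F G) = cat_comp (EM F) (EM G).
Proof. exact: (@fun_comp _ _ E A B C F G). Qed.

(** The two inclusions into the path object are sections of one projection, and the invariant makes
    this projection invertible; so it does not distinguish the inclusions. *)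
Lemma inv_nat_iso (A B : dgcat k) (F G : dgfunctor A B) :
  dg_nat_iso F G -> EM F = EM G.
Proof.
move=> eta.
have eF : F = dgf_mul (path_functor eta) (path_incl A false).
  apply: (@dgfunctor_eq k A B F (dgf_mul (path_functor eta) (path_incl A false)) erefl).
  by move=> x y n /=; apply: functional_extensionality_dep => f;
    rewrite /phom /= dg_comp1f dg_compf1.
have eG : G = dgf_mul (path_functor eta) (path_incl A true).
  apply: (@dgfunctor_eq k A B G (dgf_mul (path_functor eta) (path_incl A true)) erefl).
  move=> x y n /=; apply: functional_extensionality_dep => f.
  rewrite /phom /pto /pinv /= -dgn_nat -(dg_compA (addr0 n) (addr0 0) (addr0 n) (addr0 n)).
  by rewrite dgn_invK dg_compf1.
rewrite [LHS](congr1 (@EM A B) eF) [RHS](congr1 (@EM A B) eG) !inv_mul.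
congr cat_comp.
have pi i : cat_comp (EM (path_proj A)) (EM (path_incl A i)) = cat_id _.
  rewrite -inv_mul -(@fun_id _ _ E); congr (fun_hom E _).
  exact: (@dgfunctor_eq k A A (dgf_mul (path_proj A) (path_incl A i)) (dgf_one A) erefl).
apply: (@is_iso_cancel D _ _ _ (EM (path_proj A))); last by rewrite !pi.
exact: is_iso_retraction (inv_morita (path_incl_morita A false)) (pi false).
Qed.

End AdditiveInvariant.

(** * Matrices over a dg category *)

Section Delta.
Context (k : fieldType) (A : dgcat k) (I : finType) (x : I -> A).

(** The entries of an identity matrix. The type of an entry mentions both indices, so their equality
    is decided with a proof along which the identity is transported. *)
Definition delta (i j : I) : dg_hom (x i) (x j) 0 :=
  match @eqP _ i j with
  | ReflectT e => ecast z (dg_hom (x i) (x z) 0) e (dg_id (x i))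
  | ReflectF _ => 0
  end.

Lemma deltaii i : delta i i = dg_id (x i).
Proof. by rewrite /delta; case: eqP => // e; rewrite (eq_axiomK e). Qed.

Lemma delta_neq i j : i != j -> delta i j = 0.
Proof. by rewrite /delta; case: eqP => // ->. Qed.

Lemma delta_diff i j : diff (delta i j) = 0.
Proof.
have [<-|ij] := eqVneq i j; first by rewrite deltaii dg_diff_id.
by rewrite delta_neq // (lin0 (@diff_linear k _ _)).
Qed.

Lemma sum_delta_comp (j : I) z n (e : 0 + n = n) (f : forall i, dg_hom z (x i) n) :
  \sum_i dg_comp e (delta i j) (f i) = f j.
Proof.
rewrite (bigD1 j) //= deltaii dg_comp1f big1 ?addr0 // => i ij.
by rewrite delta_neq // (lin0 (dg_comp_linearl e _)).
Qed.

Lemma sum_comp_delta (i : I) z n (e : n + 0 = n) (f : forall j, dg_hom (x j) z n) :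
  \sum_j dg_comp e (f j) (delta i j) = f i.
Proof.
rewrite (bigD1 i) //= deltaii dg_compf1 big1 ?addr0 // => j ij.
by rewrite delta_neq 1?eq_sym // (lin0 (dg_comp_linearr e _)).
Qed.

End Delta.

(** Formal finite direct sums, the empty one included; the latter supplies the zero functor. *)
Record dgsum (k : fieldType) (A : dgcat k) :=
  DgSum { sum_idx : finType; sum_obj : sum_idx -> A }.

Section MatrixCategory.
Context (k : fieldType) (A : dgcat k).

Program Definition mat_hom (u v : dgsum A) : complex k :=
  @Complex k (fun n => @dprod k (sum_idx v * sum_idx u)
      (fun p => dg_hom (sum_obj p.2) (sum_obj p.1) n))
    (fun n f p => diff (f p)) _ _.
Next Obligation.
by move=> u v n c f g; apply: dprodP => p; apply: diff_linear.
Qed.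
Next Obligation. by move=> u v n f; apply: dprodP => p; apply: diffK. Qed.

Program Definition dgmat : dgcat k :=
  @DgCat k (dgsum A) mat_hom (fun u p => delta (@sum_obj k A u) p.2 p.1)
    (fun u v w p q r e f g s => \sum_(j : sum_idx v)
      (dg_comp e (f (s.1, j) : dg_hom (sum_obj j) (sum_obj s.1) p)
        (g (j, s.2) : dg_hom (sum_obj s.2) (sum_obj j) q)
       : dg_hom (sum_obj s.2) (sum_obj s.1) r))
    _ _ _ _ _ _ _.
Next Obligation.
move=> u v w p q r e g c f f'; apply: dprodP => s /=.
rewrite dprod_addE dprod_scaleE scaler_sumr -big_split; apply: eq_bigr => j _.
exact: dg_comp_linearl.
Qed.
Next Obligation.
move=> u v w p q r e f c g g'; apply: dprodP => s /=.
rewrite dprod_addE dprod_scaleE scaler_sumr -big_split; apply: eq_bigr => j _.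
exact: dg_comp_linearr.
Qed.
Next Obligation.
move=> u v p e f; apply: dprodP => -[i j] /=.
exact: (@sum_delta_comp k A _ (@sum_obj k A v) i (sum_obj j) p e (fun l => f (l, j))).
Qed.
Next Obligation.
move=> u v p e f; apply: dprodP => -[i j] /=.
exact: (@sum_comp_delta k A _ (@sum_obj k A u) j (sum_obj i) p e (fun l => f (i, l))).
Qed.
Next Obligation.
move=> u v w x p q r pq qr pqr e1 e2 e3 e4 f g h; apply: dprodP => -[i j] /=.
under eq_bigr do rewrite comp_sumr.
under [RHS]eq_bigr do rewrite comp_suml.
rewrite exchange_big /=; apply: eq_bigr => l _; apply: eq_bigr => m _.
exact: dg_compA.
Qed.
Next Obligation. by move=> u; apply: dprodP => p /=; apply: delta_diff. Qed.
Next Obligation.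
move=> u v w p q r e e1 e2 f g; apply: dprodP => s /=.
rewrite dprod_addE dprod_scaleE diff_sum scaler_sumr -big_split.
by apply: eq_bigr => j _; apply: dg_leibniz.
Qed.

Program Definition mat_incl : dgfunctor A dgmat :=
  @DgFunctor k A dgmat (fun x => @DgSum k A unit (fun=> x))
    (fun x y n f _ => f) _ _ _ _.
Next Obligation. by []. Qed.
Next Obligation. by []. Qed.
Next Obligation. by move=> x; apply: dprodP => -[[] []]; rewrite /= deltaii. Qed.
Next Obligation.
by move=> x y z p q r e f g; apply: dprodP => -[[] []] /=; rewrite big_const card_unit /= addr0.
Qed.

(** A formal sum is a retract of its one-term sums: the columns and rows of its identity matrix are
    the maps [a] and [b] of [fully_faithful_morita]. *)
Lemma mat_incl_morita : morita_equivalence mat_incl.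
Proof.
apply: (@fully_faithful_morita k A dgmat mat_incl (fun x y n f => f (tt, tt)) _ _
  (fun u => sum_idx u) (fun u i => sum_obj i)
  (fun u i p => delta (@sum_obj k A u) i p.1)
  (fun u i p => delta (@sum_obj k A u) p.2 i)).
- by [].
- by move=> x y n f; apply: dprodP => -[[] []].
- by move=> u i; apply: dprodP => p; apply: (@delta_diff k A _ (@sum_obj k A u)).
- by move=> u i; apply: dprodP => p; apply: (@delta_diff k A _ (@sum_obj k A u)).
- move=> u; apply: dprodP => -[i j]; rewrite dprod_sumE /=.
  under eq_bigr do rewrite big_const card_unit /= addr0.
  exact: (@sum_delta_comp k A _ (@sum_obj k A u) i (sum_obj j) 0 (addr0 0) (fun l => delta _ j l)).
Qed.

End MatrixCategory.

Section Extension.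
Context (k : fieldType) (A B : dgcat k) (G : dgfunctor A (dgmat B)).

Definition ext_ob (u : dgsum A) : dgsum B :=
  @DgSum k B {i : sum_idx u & sum_idx (G (sum_obj i))}
    (fun p => sum_obj (tagged p)).

(** Through this extension, which replaces entries by blocks, functors with values in matrices can
    be composed. *)
Program Definition mat_ext : dgfunctor (dgmat A) (dgmat B) :=
  @DgFunctor k (dgmat A) (dgmat B) ext_ob
    (fun u v n f p => dgf_hom G (f (tag p.1, tag p.2)) (tagged p.1, tagged p.2))
    _ _ _ _.
Next Obligation.
by move=> u v n c f g; apply: dprodP => p /=; rewrite dgf_linear.
Qed.
Next Obligation.
by move=> u v n f; apply: dprodP => p /=; rewrite dgf_diff.
Qed.
Next Obligation.
move=> u; apply: dprodP => -[[i a] [j b]] /=.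
have [ji|ji] := eqVneq j i.
  case: i / ji a => a; rewrite deltaii dgf_id /=.
  have [ba|ba] := eqVneq b a.
    by rewrite ba !deltaii.
  rewrite delta_neq // delta_neq // -tag_eqE /tag_eq /= eqxx /=.
  by rewrite tagged_asE.
rewrite (delta_neq _ ji) (lin0 (@dgf_linear k _ _ G _ _ _)) delta_neq //.
by rewrite -tag_eqE /tag_eq /= (negbTE ji).
Qed.
Next Obligation.
move=> u v w p q r e f g; apply: dprodP => -[[i a] [j b]] /=.
pose fl (l : sum_idx v) : @dg_hom k A (sum_obj l) (sum_obj i) p := f (i, l).
pose gl (l : sum_idx v) : @dg_hom k A (sum_obj j) (sum_obj l) q := g (l, j).
pose S (l : sum_idx v) (c : sum_idx (G (sum_obj l))) :
    @dg_hom k B (sum_obj b) (sum_obj a) r :=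
  dg_comp e (dgf_hom G (fl l) (a, c) : @dg_hom k B (sum_obj c) (sum_obj a) p)
    (dgf_hom G (gl l) (c, b)).
rewrite (lin_sum (@dgf_linear k _ _ G _ _ _)) dprod_sumE.
transitivity (\sum_l \sum_c S l c); last first.
  exact: (@sig_big_dep _ 0 +%R _ _ xpredT (fun=> xpredT) S).
by apply: eq_bigr => l _; rewrite (dgf_comp G e (fl l) (gl l)).
Qed.

End Extension.

(** * Zero functor, diagonal functor and additivity *)

Section ZeroFunctor.
Context (k : fieldType) (A B : dgcat k).

Lemma mat_void_eq (u v : dgsum B) n (f g : @dg_hom k (dgmat B) u v n) :
  (sum_idx u -> False) -> f = g.
Proof. by move=> uv; apply: dprodP => -[j i]; case: (uv i). Qed.

Definition dgsum0 : dgsum B := @DgSum k B void (of_void B).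

Program Definition zero_functor : dgfunctor A (dgmat B) :=
  @DgFunctor k A (dgmat B) (fun=> dgsum0) (fun x y n f => 0) _ _ _ _.
Next Obligation. by move=> x y n c f g; apply: (@mat_void_eq dgsum0 dgsum0); case. Qed.
Next Obligation. by move=> *; apply: (@mat_void_eq dgsum0 dgsum0); case. Qed.
Next Obligation. by move=> *; apply: (@mat_void_eq dgsum0 dgsum0); case. Qed.
Next Obligation. by move=> *; apply: (@mat_void_eq dgsum0 dgsum0); case. Qed.

Lemma T_void_eq (i j : bool) n
    (f g : @dg_hom k (T_dg (dgmat B)) (i, dgsum0) (j, dgsum0) n) : f = g.
Proof.
rewrite -(of_whenK f) -(of_whenK g); congr to_when.
by apply: (@mat_void_eq dgsum0 dgsum0); case.
Qed.

Lemma zero_functor_nat_iso :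
  dg_nat_iso (dgf_mul (T_incl (dgmat B) false) zero_functor)
             (dgf_mul (T_incl (dgmat B) true) zero_functor).
Proof.
by exists (fun=> 0) (fun=> 0) => *; apply: T_void_eq.
Qed.

End ZeroFunctor.

Section SplitFunctor.
Context (k : fieldType) (A C : dgcat k) (F G : dgfunctor A C).

Definition split_ob (u : T_dg A) : C := if u.1 then G u.2 else F u.2.

Definition split_hom (u v : T_dg A) n (f : dg_hom u v n) :
    dg_hom (split_ob u) (split_ob v) n :=
  match u.1 as a, v.1 as b return when (a ==> b) (dg_hom u.2 v.2 n) ->
    dg_hom (if a then G u.2 else F u.2) (if b then G v.2 else F v.2) n with
  | false, false => fun f => dgf_hom F f
  | true, true => fun f => dgf_hom G f
  | _, _ => fun=> 0
  end f.

(* The functor on T(A) given by the zero transformation from F to G. *)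
Program Definition split_functor : dgfunctor (T_dg A) C :=
  @DgFunctor k (T_dg A) C split_ob split_hom _ _ _ _.
Next Obligation.
by move=> [[] x] [[] y] n c f g; [apply: dgf_linear | rewrite /= scaler0 addr0
  | rewrite /= scaler0 addr0 | apply: dgf_linear].
Qed.
Next Obligation.
by move=> [[] x] [[] y] n f; [apply: dgf_diff | rewrite /= (lin0 (@diff_linear k _ _))
  | rewrite /= (lin0 (@diff_linear k _ _)) | apply: dgf_diff].
Qed.
Next Obligation. by move=> [[] x] /=; apply: dgf_id. Qed.
Next Obligation.
move=> [[] x] [[] y] [[] z] p q r e f g;
  (try exact: (dgf_comp G e f g)); (try exact: (dgf_comp F e f g));
  rewrite /split_hom /= ?(lin0 (dg_comp_linearr _ _)) ?(lin0 (dg_comp_linearl _ _))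
    ?(lin0 (@dgf_linear k _ _ _ _ _ _)) //.
Qed.

End SplitFunctor.

Section Diagonal.
Context (k : fieldType) (A : dgcat k).

Definition diag_ob (x : A) : dgsum (T_dg A) := @DgSum k (T_dg A) bool (fun b => (b, x)).

Definition diag_hom x y n (f : @dg_hom k A x y n) :
    @dg_hom k (dgmat (T_dg A)) (diag_ob x) (diag_ob y) n :=
  fun p => to_when (p.2 ==> p.1) (if p.2 == p.1 then f else 0).

Program Definition diag_functor : dgfunctor A (dgmat (T_dg A)) :=
  @DgFunctor k A (dgmat (T_dg A)) diag_ob diag_hom _ _ _ _.
Next Obligation.
move=> x y n c f g; apply: dprodP => -[i j].
rewrite dprod_addE dprod_scaleE /diag_hom -to_when_linear /=; congr to_when.
by case: ifP => // _; rewrite scaler0 addr0.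
Qed.
Next Obligation.
move=> x y n f; apply: dprodP => -[i j] /=; rewrite /diag_hom /=; congr to_when.
by case: i j => [] [] //=; rewrite (lin0 (@diff_linear k _ _)).
Qed.
Next Obligation.
move=> x; apply: dprodP => -[[] []]; rewrite /diag_hom /= ?deltaii //.
  by rewrite delta_neq.
by rewrite delta_neq.
Qed.
Next Obligation.
move=> x y z p q r e f g; apply: dprodP => -[i j]; rewrite /diag_hom /=.
rewrite big_bool; case: i j => [] [] /=;
by rewrite ?(lin0 (dg_comp_linearr _ _)) ?(lin0 (dg_comp_linearl _ _)) ?addr0 ?add0r.
Qed.

End Diagonal.

Section AdditiveCategoryFacts.
Context (D : additive_category).
Implicit Types X Y Z : add_ob D.

Lemma add_comp0f X Y Z (g : add_hom X Y) : add_comp (0 : add_hom Y Z) g = 0.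
Proof.
by apply: (addrI (add_comp (0 : add_hom Y Z) g)); rewrite -add_compDl !addr0.
Qed.

Lemma add_compf0 X Y Z (f : add_hom Y Z) : add_comp f (0 : add_hom X Y) = 0.
Proof.
by apply: (addrI (add_comp f (0 : add_hom X Y))); rewrite -add_compDr !addr0.
Qed.

Lemma add_compNf X Y Z (f : add_hom Y Z) (g : add_hom X Y) :
  add_comp (- f) g = - add_comp f g.
Proof.
by apply: (addrI (add_comp f g)); rewrite -add_compDl !subrr add_comp0f.
Qed.

Lemma add_compfN X Y Z (f : add_hom Y Z) (g : add_hom X Y) :
  add_comp f (- g) = - add_comp f g.
Proof.
by apply: (addrI (add_comp f g)); rewrite -add_compDr !subrr add_compf0.
Qed.

Lemma copair_inj1 X Y Z (f : add_hom X Z) (g : add_hom Y Z) :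
  add_comp (copair f g) (inj1 X Y) = f.
Proof.
by rewrite /copair add_compDl -!add_compA pr1_inj1 pr2_inj1 add_compf0 addr0 add_compf1.
Qed.

Lemma copair_inj2 X Y Z (f : add_hom X Z) (g : add_hom Y Z) :
  add_comp (copair f g) (inj2 X Y) = g.
Proof.
by rewrite /copair add_compDl -!add_compA pr1_inj2 pr2_inj2 add_compf0 add0r add_compf1.
Qed.

End AdditiveCategoryFacts.

Section InvariantAdditivity.
Context (k : fieldType) (D : additive_category) (E : functor (dgCat k) D).
Hypothesis addE : is_additive_invariant E.

Definition inv_hom (A B : dgcat k) (F : dgfunctor A B) : add_hom (E A) (E B) :=
  @fun_hom (dgCat k) D E A B F.

Lemma inv_homM (A B C : dgcat k) (F : dgfunctor B C) (G : dgfunctor A B) :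
  inv_hom (dgf_mul F G) = add_comp (inv_hom F) (inv_hom G).
Proof. exact: (@fun_comp _ _ E A B C F G). Qed.

Lemma inv_hom_nat_iso (A B : dgcat k) (F G : dgfunctor A B) :
  dg_nat_iso F G -> inv_hom F = inv_hom G.
Proof. exact: inv_nat_iso. Qed.

Lemma inv_hom_morita (A B : dgcat k) (F : dgfunctor A B) :
  morita_equivalence F -> @is_iso D _ _ (inv_hom F).
Proof. exact: inv_morita. Qed.

(** On the zero object the two inclusions into [T_dg] are isomorphic, so additivity gives
    [inj1 z = inj2 z], and [pr1] sends the two sides to [z] and 0. *)
Lemma inv_zero (A B : dgcat k) : inv_hom (zero_functor A B) = 0.
Proof.
set z := inv_hom _; have := addE.2 (dgmat B).
set c := copair _ _ => ci.
have e : add_comp (inj1 _ _) z = add_comp (inj2 (E (dgmat B)) (E (dgmat B))) z.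
  apply: (@is_iso_cancel D _ _ _ c _ _ ci) => /=.
  rewrite !add_compA copair_inj1 copair_inj2.
  have := inv_hom_nat_iso (zero_functor_nat_iso A B).
  by rewrite !inv_homM.
have := congr1 (add_comp (pr1 _ _)) e.
by rewrite !add_compA pr1_inj1 pr1_inj2 add_comp1f add_comp0f.
Qed.

(** The components exist because the invariant of [T_dg A] is a sum of two copies of that of [A].
    They are identified only in [rank_hom_add], by testing on known functors. *)
Lemma inv_diag (A : dgcat k) : exists x y : add_hom (E A) (E A),
  inv_hom (diag_functor A) =
    add_comp (inv_hom (mat_incl (T_dg A)))
      (add_comp (inv_hom (T_incl A false)) x + add_comp (inv_hom (T_incl A true)) y).
Proof.
have [f [cf fc]] := addE.2 A.
have [g [ig gi]] := inv_hom_morita (mat_incl_morita (T_dg A)).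
set d := inv_hom (diag_functor A).
pose w := add_comp f (add_comp g d).
exists (add_comp (pr1 _ _) w), (add_comp (pr2 _ _) w).
set i1 := inv_hom (T_incl A false); set i2 := inv_hom (T_incl A true).
have -> : add_comp i1 (add_comp (pr1 _ _) w) + add_comp i2 (add_comp (pr2 _ _) w)
    = add_comp g d.
  rewrite !add_compA -!add_compDl -[RHS](@add_comp1f D).
  rewrite (_ : add_id _ = add_comp (copair i1 i2) f) ?cf //.
  by rewrite /w !add_compA.
by rewrite add_compA [X in add_comp X _]ig add_comp1f.
Qed.

End InvariantAdditivity.

(** * Modules over simple algebras *)

Section LinHom.
Context (k : fieldType) (U V : vectType k) (f : U -> V) (fl : linear f).

Definition lin_pack : {linear U -> V} :=
  HB.pack f (GRing.isLinear.Build k U V *:%R f fl).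

Definition lin_hom : 'Hom(U, V) := linfun lin_pack.

Lemma lin_homE x : lin_hom x = f x.
Proof. by rewrite lfunE. Qed.

End LinHom.

Record action (k : fieldType) (R : falgType k) (V : vectType k) := Action {
  act :> R -> V -> V;
  act_linearl : forall v, linear (fun r => act r v);
  act_linearr : forall r, linear (act r);
  act_1 : forall v, act 1 v = v;
  act_M : forall r s v, act (r * s) v = act r (act s v) }.

Definition simple_alg (k : fieldType) (R : falgType k) : Prop :=
  forall I : {vspace R}, ({:R} * I <= I)%VS -> (I * {:R} <= I)%VS ->
    (I = 0 \/ I = fullv)%VS.

Definition left_ideal (k : fieldType) (R : falgType k) (I : {vspace R}) : Prop :=
  forall r x : R, x \in I -> r * x \in I.

Definition minimal_left_ideal (k : fieldType) (R : falgType k) (I : {vspace R}) :=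
  [/\ left_ideal I, I != 0%VS & forall J : {vspace R}, left_ideal J ->
      (J <= I)%VS -> J = 0%VS \/ J = I].

Section Minimal.
Context (k : fieldType) (R : falgType k).

Lemma minimal_left_ideal_exists : exists I : {vspace R}, minimal_left_ideal I.
Proof.
pose P d := `[< exists2 I : {vspace R}, left_ideal I & I != 0%VS /\ \dim I = d >].
have exP : exists d, P d.
  exists (\dim {:R}); apply/asboolP; exists fullv => [r x _|]; first exact: memvf.
  split=> //; apply/eqP => h; have := memvf (1 : R).
  by rewrite h memv0 oner_eq0.
have [d /asboolP[I lI [nI dI]] dmin] := ex_minnP exP.
exists I; split=> // J lJ sJI; have [->|nJ] := eqVneq J 0%VS; first by left.
right; apply/eqP; rewrite eqEdim sJI dI dmin //.
by apply/asboolP; exists J.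
Qed.

End Minimal.

Section SimpleModules.
Context (k : fieldType) (R : falgType k) (simR : simple_alg R).
Context (L : {vspace R}) (minL : minimal_left_ideal L).
Context (V : vectType k) (a : action R V).

Definition orb (v : V) : 'Hom(R, V) := lin_hom (act_linearl a v).

Lemma orbE v r : orb v r = a r v. Proof. exact: lin_homE. Qed.

Definition stable (U : {vspace V}) : Prop := forall r v, v \in U -> a r v \in U.

Lemma stable_img v : stable (orb v @: L)%VS.
Proof.
move=> r _ /memv_imgP[x Lx ->]; rewrite orbE -act_M -orbE memv_img //.
by case: minL => lL _ _; apply: lL.
Qed.

(** The two-sided ideal generated by [L] is the whole algebra by simplicity, so the images of [L]
    span the module. *)
Lemma orb_not_sub (U : {vspace V}) : U != fullv -> exists w, ~~ (orb w @: L <= U)%VS.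
Proof.
move=> nU; apply: contrapT => /forallNP hw.
have {}hw w : (orb w @: L <= U)%VS by apply: contrapT => /negP; apply: hw.
case: minL => lL nL _; case/eqP: nU; apply/vspaceP => v; rewrite memvf.
have LR : (L * {:R} = fullv)%VS.
  case: (simR (I := (L * {:R})%VS)) => [||h|//].
  - rewrite prodvA prodvS //; apply/prodvP => x y _; exact: lL.
  - by rewrite -prodvA prodvS // subvf.
  - case/negP: nL; rewrite -subv0 -h; apply/subvP => x Lx.
    by rewrite -[x]mulr1 memv_mul ?memvf.
suff /subvP/(_ 1) : (L * {:R} <= orb v @^-1: U)%VS.
  by rewrite LR memvf -memv_preim orbE act_1 => ->.
apply/prodvP => x y Lx _; rewrite -memv_preim orbE act_M -orbE.
by apply: (subvP (hw _)); apply: memv_img.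
Qed.

Lemma orb_direct (U : {vspace V}) w : stable U -> ~~ (orb w @: L <= U)%VS ->
  \dim (U + orb w @: L) = (\dim U + \dim L)%N.
Proof.
move=> sU nw; case: minL => lL nL mL.
have K0 : (L :&: orb w @^-1: U = 0)%VS.
  case: (mL (L :&: orb w @^-1: U)%VS) => [r x|||h].
  - rewrite !memv_cap -!memv_preim => /andP[Lx]; rewrite !orbE act_M => /sU ->.
    by rewrite lL.
  - exact: capvSl.
  - by [].
  - case/negP: nw; apply/subvP => _ /memv_imgP[x Lx ->].
    by move: Lx; rewrite -h memv_cap -memv_preim => /andP[].
have K1 : (L :&: lker (orb w) = 0)%VS.
  apply/eqP; rewrite -subv0 -K0; apply/subvP => x.
  by rewrite !memv_cap -memv_preim memv_ker => /andP[-> /eqP ->]; rewrite mem0v.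
rewrite dimv_disjoint_sum ?limg_dim_eq //.
apply/eqP; rewrite -subv0; apply/subvP => v; rewrite memv_cap => /andP[Uv].
case/memv_imgP => x Lx ev; suff x0 : x = 0 by rewrite ev x0 linear0 mem0v.
by apply/eqP; rewrite -memv0 -K0 memv_cap Lx -memv_preim -ev.
Qed.

(** A complement of [U] is built from copies of [L]. The equation of dimensions records that the sum
    is direct and that each [orb v] is injective on [L]. *)
Lemma module_decomposition (U : {vspace V}) : stable U ->
  exists w : seq V, (U + \sum_(v <- w) orb v @: L = fullv)%VS /\
    (\dim U + size w * \dim L = \dim {:V})%N.
Proof.
have [d] := ubnP (\dim {:V} - \dim U); elim: d U => // d IH U dU sU.
have [->|nU] := eqVneq U fullv.
  by exists [::]; rewrite big_nil addv0 mul0n addn0.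
have [w nw] := orb_not_sub nU.
have dw := orb_direct sU nw.
have [|r v|w' [e1 e2]] := IH (U + orb w @: L)%VS.
- have L0 : (0 < \dim L)%N by rewrite lt0n dimv_eq0; case: minL.
  have := dimvS (subvf (U + orb w @: L)%VS); rewrite dw; move: dU L0.
  move: (\dim U) (\dim L) (\dim {:V}) => u l v; lia.
- case/memv_addP => u Uu [x Lx ->].
  by rewrite (linD (act_linearr a r)) memv_add ?sU ?stable_img.
exists (w :: w'); rewrite big_cons addvA; split=> //=.
by rewrite -e2 dw mulSn addnA.
Qed.

End SimpleModules.

Section ModuleIso.
Context (k : fieldType) (R : falgType k) (simR : simple_alg R).

Definition module_iso (V W : vectType k) (a : action R V) (b : action R W)
    (h : V -> W) : Prop :=
  [/\ linear h, bijective h & forall r v, h (a r v) = b r (h v)].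

Section Param.
Context (L : {vspace R}) (V : vectType k) (a : action R V) (m : nat) (w : m.-tuple V).

Definition span_fun (x : {ffun 'I_m -> subvs_of L}) : V :=
  \sum_i a (vsval (x i)) (tnth w i).

Fact span_linear : linear span_fun.
Proof.
move=> c x y; rewrite /span_fun scaler_sumr -big_split /=; apply: eq_bigr => i _.
by rewrite !ffunE linearP act_linearl.
Qed.

Lemma span_bij : (\sum_(v <- w) orb a v @: L = fullv)%VS ->
  (m * \dim L = \dim {:V})%N -> lker (lin_hom span_linear) == 0%VS /\
   limg (lin_hom span_linear) = fullv.
Proof.
move=> sw dw; have lf : limg (lin_hom span_linear) = fullv.
  apply/eqP; rewrite eqEsubv subvf -sw /= big_tuple; apply/subv_sumP => i _.
  apply/subvP => _ /memv_imgP[x Lx ->].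
  have -> : orb a (tnth w i) x = lin_hom span_linear
      [ffun j => if j == i then Subvs Lx else 0].
    rewrite lin_homE orbE /span_fun (bigD1 i) //= ffunE eqxx big1 ?addr0 // => j ji.
    by rewrite ffunE (negbTE ji) linear0 (lin0 (act_linearl a _)).
  by rewrite memv_img ?memvf.
split=> //; rewrite -dimv_eq0; have := limg_ker_dim (lin_hom span_linear) fullv.
rewrite capfv lf -dw dimvf /= /dim /=.
rewrite card_ord => /eqP; rewrite -[X in _ == X]add0n eqn_add2r.
by [].
Qed.

End Param.

Theorem simple_module_iso (V W : vectType k) (a : action R V) (b : action R W) :
  dim V = dim W -> exists h, module_iso a b h.
Proof.
move=> dVW; have [L minL] := minimal_left_ideal_exists R.
have [|w [sw dw]] := module_decomposition simR minL (a := a) (U := 0%VS).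
  by move=> r v; rewrite !memv0 => /eqP ->; rewrite (lin0 (act_linearr a r)).
have [|w' [sw' dw']] := module_decomposition simR minL (a := b) (U := 0%VS).
  by move=> r v; rewrite !memv0 => /eqP ->; rewrite (lin0 (act_linearr b r)).
rewrite add0v in sw; rewrite add0v in sw'.
rewrite dimv0 add0n in dw; rewrite dimv0 add0n in dw'.
have ew : size w' == size w.
  have L0 : (0 < \dim L)%N by rewrite lt0n dimv_eq0; case: minL.
  by rewrite -(eqn_pmul2r L0) dw dw' !dimvf dVW.
pose f := lin_hom (@span_linear L V a _ (in_tuple w)).
pose g := lin_hom (@span_linear L W b _ (Tuple ew)).
have [kf lf] : lker f == 0%VS /\ limg f = fullv by apply: span_bij.
have [kg lg] : lker g == 0%VS /\ limg g = fullv.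
  by apply: span_bij => //; rewrite -dw'; rewrite (eqP ew).
have fK : cancel f^-1%VF f by move=> v; rewrite limg_lfunVK // lf memvf.
have gK : cancel g^-1%VF g by move=> v; rewrite limg_lfunVK // lg memvf.
have Kf := lker0_lfunK kf; have Kg := lker0_lfunK kg.
exists (fun v => g (f^-1%VF v)); split.
- by move=> c u v; rewrite !linearP.
- by exists (fun v => f (g^-1%VF v)) => v; rewrite ?Kg ?fK ?Kf ?gK.
- move=> r v; rewrite -{1}(fK v).
  set x := f^-1%VF v.
  pose rx : {ffun 'I_(size w) -> subvs_of L} := [ffun i => vsproj L (r * vsval (x i))].
  have erx i : vsval (rx i) = r * vsval (x i).
    rewrite ffunE vsprojK //; case: minL => lL _ _; exact/lL/subvsP.
  have -> : a r (f x) = f rx.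
    rewrite !lin_homE /span_fun (lin_sum (act_linearr a r)).
    by apply: eq_bigr => i _; rewrite erx act_M.
  rewrite Kf !lin_homE /span_fun (lin_sum (act_linearr b r)).
  by apply: eq_bigr => i _; rewrite erx act_M.
Qed.

End ModuleIso.

Section VspaceOfPred.
Context (k : fieldType) (V : vectType k) (P : V -> Prop).
Hypothesis P0 : P 0.
Hypothesis PD : forall c u v, P u -> P v -> P (c *: u + v).

(** A subspace of largest dimension inside [P] contains every vector of [P], since another one could
    be adjoined. Thus ideals may be given by predicates, as in [simple_algP]. *)
Lemma vspace_of_pred : exists U : {vspace V}, forall v, v \in U <-> P v.
Proof.
pose Q d := `[< exists2 U : {vspace V}, forall v, v \in U -> P v & \dim U = d >].
have exQ : exists d, Q d.
  exists 0%N; apply/asboolP; exists 0%VS; last by rewrite dimv0.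
  by move=> v; rewrite memv0 => /eqP ->.
have bQ d : Q d -> (d <= \dim {:V})%N.
  by move=> /asboolP[U _ <-]; apply/dimvS/subvf.
have [d /asboolP[U UP dU] dmax] := ex_maxnP exQ bQ.
exists U => v; split=> [|Pv]; first exact: UP.
apply: contrapT => /negP nUv.
have /dmax : Q (\dim (U + <[v]>)).
  apply/asboolP; exists (U + <[v]>)%VS => // _ /memv_addP[u Uu [_ /vlineP[c ->] ->]].
  by rewrite addrC; apply: PD => //; apply: UP.
rewrite -dU leqNgt; case/negP; rewrite dimv_disjoint_sum.
  rewrite -addn1 leq_add2l dim_vline lt0b.
  by apply: contraNneq nUv => ->; rewrite mem0v.
apply/eqP; rewrite -subv0; apply/subvP => x; rewrite memv_cap.
case/andP => Ux /vlineP[c ex]; have [c0|c0] := eqVneq c 0.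
  by rewrite ex c0 scale0r mem0v.
case/negP: nUv; have -> : v = c^-1 *: x by rewrite ex scalerA mulVf ?scale1r.
exact: memvZ.
Qed.

End VspaceOfPred.

Lemma simple_algP (k : fieldType) (R : falgType k) : simple_alg R <->
  forall P : R -> Prop, P 0 -> (forall c u v, P u -> P v -> P (c *: u + v)) ->
   (forall r x, P x -> P (r * x)) -> (forall r x, P x -> P (x * r)) ->
   (exists2 x, x != 0 & P x) -> P 1.
Proof.
split=> [simR P P0 PD Pl Pr [x nx Px]|h I lI rI].
  have [I IP] := vspace_of_pred P0 PD.
  case: (simR I) => [|||I1]; last by apply/IP; rewrite I1 memvf.
  - by apply/prodvP => r y _ /IP Py; apply/IP/Pl.
  - by apply/prodvP => y r /IP Py _; apply/IP/Pr.
  - move=> I0; have := (IP x).2 Px; rewrite I0 memv0 => /eqP x0.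
    by rewrite x0 eqxx in nx.
have [->|nI] := eqVneq I 0%VS; first by left.
right; suff I1 : 1 \in I.
  apply/vspaceP => x; rewrite memvf -[x]mulr1.
  by apply: (subvP lI); rewrite memv_mul ?memvf.
apply: (h (fun x => x \in I)).
- exact: mem0v.
- by move=> c u v Iu Iv; rewrite memvD ?memvZ.
- by move=> r x Ix; apply: (subvP lI); rewrite memv_mul ?memvf.
- by move=> r x Ix; apply: (subvP rI); rewrite memv_mul ?memvf.
- exists (vpick I); last exact: memv_pick.
  by rewrite vpick0.
Qed.

(** * Central simple algebras and their tensor products *)

Lemma central_scalar (k : fieldType) (A : falgType k) (x : A) :
  ('Z({:A}) = 1)%VS -> (forall y, x * y = y * x) -> exists c, x = c%:A.
Proof.
move=> ZA cx; have : x \in 'Z({:A})%VS.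
  by rewrite memv_cap memvf; apply/centvP => y _.
by rewrite ZA => /vlineP.
Qed.

Section Coordinates.
Context (k : fieldType) (V : falgType k).

Lemma refb_coord i j : v2r (refb i : V) 0 j = (i == j)%:R.
Proof. by rewrite r2vK mxE eqxx eq_sym. Qed.

Lemma refb_free (c : 'I_(dim V) -> k) : \sum_i c i *: (refb i : V) = 0 -> forall i, c i = 0.
Proof.
move=> /(congr1 (fun x => v2r x)); rewrite linear0 linear_sum => h i.
move: (congr1 (fun M : 'rV_(dim V) => M 0 i) h); rewrite summxE mxE.
rewrite (bigD1 i) //= linearZ /= mxE refb_coord eqxx mulr1 big1 ?addr0 // => j ji.
by rewrite linearZ /= mxE refb_coord (negbTE ji) mulr0.
Qed.

End Coordinates.

Section Azumaya.
Context (k : fieldType) (A : falgType k) (csA : is_central_simple A).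

Let kills (u : 'I_(dim A) -> A) := forall x, \sum_i u i * x * refb i = 0.

(* Shortest-relation argument: normalising one coefficient to 1 and taking
   commutators shortens the relation, so all coefficients are central. *)
Lemma sandwich_inj (u : 'I_(dim A) -> A) : kills u -> forall i, u i = 0.
Proof.
have [d] := ubnP #|[pred i | u i != 0]|; elim: d u => // d IH u.
rewrite ltnS => su ku j; apply/eqP; apply: contrapT => /negP nuj.
have [ZA /simple_algP simA] := csA.
pose P a := exists u' : 'I_(dim A) -> A,
  [/\ kills u', (forall i, u i = 0 -> u' i = 0) & u' j = a].
have : P 1.
  apply: (simA P).
  - exists (fun=> 0); split=> // x; rewrite big1 // => i _; by rewrite !mul0r.
  - move=> c _ _ [u1 [k1 z1 <-]] [u2 [k2 z2 <-]].
    exists (fun i => c *: u1 i + u2 i); split=> // [x|i ui0].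
      under eq_bigr do rewrite !mulrDl -!scalerAl.
      by rewrite big_split -scaler_sumr /= k1 k2 scaler0 addr0.
    by rewrite z1 // z2 // scaler0 addr0.
  - move=> r _ [u1 [k1 z1 <-]]; exists (fun i => r * u1 i); split=> // [x|i ui0].
      by under eq_bigr do rewrite -!mulrA; rewrite -mulr_sumr;
        under eq_bigr do rewrite mulrA; rewrite k1 mulr0.
    by rewrite z1 // mulr0.
  - move=> r _ [u1 [k1 z1 <-]]; exists (fun i => u1 i * r); split=> // [x|i ui0].
      by under eq_bigr do rewrite -(mulrA (u1 _)); rewrite k1.
    by rewrite z1 // mul0r.
  - by exists (u j) => //; exists u; split.
case=> u' [k' z' u'j].
have cu' i c : u' i * c = c * u' i.
  apply/eqP; rewrite eq_sym -subr_eq0; apply/eqP.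
  apply: (IH (fun i => c * u' i - u' i * c)).
    apply: leq_trans su; rewrite [X in (_ < X)%N](cardD1 j) inE nuj add1n ltnS.
    apply: subset_leq_card; apply/subsetP => l; rewrite !inE => nl.
    apply/andP; split; first by apply: contraNneq nl => ->; rewrite u'j mulr1 mul1r subrr.
    by apply: contraNneq nl => /z' ->; rewrite mulr0 mul0r subrr.
  move=> x; under eq_bigr do rewrite !mulrBl.
  rewrite sumrB; under eq_bigr do rewrite -!mulrA.
  rewrite -mulr_sumr; under eq_bigr do rewrite mulrA.
  by rewrite k' mulr0 sub0r; under eq_bigr do rewrite -(mulrA (u' _)); rewrite k' oppr0.
have sc i : exists c, u' i = c%:A by apply: central_scalar.
pose c i := sval (cid (sc i)).
have uc i : u' i = (c i)%:A by rewrite /c; case: (cid (sc i)).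
have /refb_free/(_ j) cj : \sum_i c i *: (refb i : A) = 0.
  by rewrite -[RHS](k' 1); apply: eq_bigr => i _; rewrite mulr1 uc mulr_algl.
by have := u'j; rewrite uc cj scale0r => /esym/eqP; rewrite oner_eq0.
Qed.

(** The map A (x) A^op -> End(A) is injective by [sandwich_inj], and both sides have dimension (dim
    A)^2. *)
Lemma sandwich_surj (f : A -> A) : linear f ->
  exists u : 'I_(dim A) -> A, forall x, f x = \sum_i u i * x * refb i.
Proof.
move=> fl.
pose F (u : {ffun 'I_(dim A) -> A}) x : A := \sum_i u i * x * refb i.
have Fl u : linear (F u).
  move=> c x y; rewrite /F scaler_sumr -big_split /=; apply: eq_bigr => i _.
  by rewrite mulrDr mulrDl -scalerAr -scalerAl.
have Gl : linear (fun u => lin_hom (Fl u)).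
  move=> c u v; apply/lfunP => x; rewrite add_lfunE scale_lfunE !lin_homE /F.
  rewrite scaler_sumr -big_split /=; apply: eq_bigr => i _.
  by rewrite !ffunE !mulrDl -!scalerAl.
pose G := lin_hom Gl.
have kG : lker G == 0%VS.
  rewrite -subv0; apply/subvP => u; rewrite memv_ker memv0 => /eqP Gu0.
  apply/eqP/ffunP => i; rewrite ffunE; apply: (sandwich_inj (u := u)) => x.
  have h : G u x = 0 by rewrite Gu0 zero_lfunE.
  by move: h; rewrite /G !lin_homE.
have lG : limg G = fullv.
  apply/eqP; rewrite eqEdim subvf /= limg_dim_eq ?(eqP kG) ?capv0 //.
  by rewrite !dimvf /dim /= card_ord.
have : lin_hom fl \in limg G by rewrite lG memvf.
case/memv_imgP => u _ e; exists u => x.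
by rewrite -(lin_homE fl) e !lin_homE.
Qed.

End Azumaya.

Section PureSums.
Context (k : fieldType) (A B : falgType k).

Lemma pure_suml (I : Type) (r : seq I) (P : pred I) (F : I -> A) (b : B) :
  pure (\sum_(i <- r | P i) F i) b = \sum_(i <- r | P i) pure (F i) b.
Proof. exact: (big_morph (fun a => pure a b) (@pureDl k A B b) (@pure0l k A B b)). Qed.

Lemma pure_sumr (I : Type) (r : seq I) (P : pred I) (a : A) (F : I -> B) :
  pure a (\sum_(i <- r | P i) F i) = \sum_(i <- r | P i) pure a (F i).
Proof. exact: (big_morph (pure a) (@pureDr k A B a) (@pure0r k A B a)). Qed.

End PureSums.

Section TensorSimple.
Context (k : fieldType) (A B : falgType k) (csA : is_central_simple A).

Lemma pure_mul (a a' : A) (b b' : B) :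
  (pure a b : tens A B) * pure a' b' = pure (a * a') (b * b').
Proof. exact: tens_mul_pure. Qed.

Lemma pure11 : pure 1 1 = 1 :> tens A B. Proof. by []. Qed.

Lemma pure1_eq0 (b : B) : pure (1 : A) b = 0 -> b = 0.
Proof.
move=> h; have [i hi] : exists i, v2r (1 : A) 0 i != 0.
  apply/existsP; apply: contraT => /existsPn z; case/eqP: (oner_neq0 A).
  by apply: (can_inj v2rK); rewrite linear0; apply/rowP=> i;
    rewrite [RHS]mxE; apply/eqP; rewrite -[_ == _]negbK z.
apply: (can_inj v2rK); rewrite linear0; apply/rowP => j; rewrite [RHS]mxE.
move: (congr1 (fun M : tens A B => M i j) h); rewrite pureE mxE => /eqP.
by rewrite mulf_eq0 (negbTE hi) => /eqP.
Qed.

Definition slice (i : 'I_(dim A)) (u : tens A B) : B := \sum_j u i j *: refb j.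

(** The sandwich that realises a multiple of the i-th coordinate form on [A] extracts from a tensor
    its coefficient in [B]. The second clause is for evaluation at 1 in [tens_central_simple]. *)
Lemma slice_mul (i : 'I_(dim A)) (u : tens A B) (c : k) :
  exists w : 'I_(dim A) -> A,
    \sum_l (pure (w l) 1 * u * pure (refb l) 1) = pure 1 (c *: slice i u) /\
    forall x : A, \sum_l w l * x * refb l = (c * v2r x 0 i)%:A.
Proof.
have fl : linear (fun x : A => (c * v2r x 0 i)%:A : A).
  by move=> a x y; rewrite linearP !mxE mulrDr scalerDl mulrCA scalerA.
have [w hw] := sandwich_surj csA fl; exists w; split=> [|x]; last by rewrite hw.
transitivity (\sum_l \sum_p \sum_q u p q *: pure (w l * refb p * refb l) (refb q : B)).
  apply: eq_bigr => l _; rewrite {1}(tens_decomp u) mulr_sumr mulr_suml.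
  apply: eq_bigr => p _; rewrite mulr_sumr mulr_suml; apply: eq_bigr => q _.
  by rewrite -scalerAr -scalerAl !pure_mul mul1r mulr1.
rewrite exchange_big /= (bigD1 i) //= addrC big1 ?add0r => [|p pi].
  rewrite exchange_big /slice scaler_sumr pure_sumr /=.
  apply: eq_bigr => q _; rewrite -scaler_sumr.
  rewrite -pure_suml -hw.
  by rewrite refb_coord eqxx mulr1 pureZl !pureZr !scalerA mulrC.
rewrite exchange_big big1 // => q _; rewrite -scaler_sumr.
rewrite -pure_suml -hw.
by rewrite refb_coord (negbTE pi) mulr0 scale0r pure0l scaler0.
Qed.

Lemma tens_simple : simple_alg B -> simple_alg (tens A B).
Proof.
move=> simB; apply/simple_algP => P P0 PD Pl Pr [u nu Pu].
have Psum (I : Type) (r : seq I) (F : I -> tens A B) :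
    (forall i, P (F i)) -> P (\sum_(i <- r) F i).
  by move=> h; elim/big_ind: _ => // x y Px Py; rewrite -[x]scale1r; apply: PD.
have [i [j uij]] : exists i j, u i j != 0.
  apply: contrapT => h; case/eqP: nu; apply/matrixP => i j; rewrite mxE.
  by apply/eqP; apply: contrapT => /negP hij; apply: h; exists i, j.
have [w [hw _]] := slice_mul i u 1.
pose Q b := P (pure 1 b).
suff : Q 1 by [].
move/simple_algP: simB; apply.
- by rewrite /Q pure0r.
- by move=> c x y Qx Qy; rewrite /Q pureDr pureZr; apply: PD.
- by move=> r x Qx; rewrite /Q -[1]mul1r -pure_mul; apply: Pl.
- by move=> r x Qx; rewrite /Q -[1]mul1r -pure_mul; apply: Pr.
exists (slice i u).
  by apply: contraNneq uij => /refb_free/(_ j) ->.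
rewrite /Q -[slice i u]scale1r -hw; apply: Psum => l.
by apply: Pr; apply: Pl.
Qed.

End TensorSimple.

Lemma tens_central_simple (k : fieldType) (A B : falgType k) :
  is_central_simple A -> is_central_simple B -> is_central_simple (tens A B).
Proof.
move=> csA [ZB simB]; split; last exact: (tens_simple csA simB).
apply/eqP; rewrite eqEsubv; apply/andP; split; last first.
  by apply/subvP => _ /vlineP[c ->]; rewrite memvZ // memv_cap memvf centv1.
apply/subvP => z /memv_capP[_ /centvP cz].
have [i hi] : exists i, v2r (1 : A) 0 i != 0.
  apply/existsP; apply: contraT => /existsPn z0; case/eqP: (oner_neq0 A).
  by apply: (can_inj v2rK); rewrite linear0; apply/rowP=> i;
    rewrite [RHS]mxE; apply/eqP; rewrite -[_ == _]negbK z0.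
have [w [hw w1]] := slice_mul csA i z (v2r (1 : A) 0 i)^-1.
set b := _ *: slice i z in hw.
(* A central [z] passes out of the sandwich, which then contributes the value of its form at 1; the
   scalar was chosen to make this value 1. *)
have ez : z = pure 1 b.
  rewrite -hw; transitivity (\sum_l (pure (w l * 1 * refb l) (1 : B) : tens A B) * z).
    rewrite -mulr_suml -pure_suml w1.
    by rewrite mulVf // scale1r pure11 mul1r.
  apply: eq_bigr => l _; rewrite -[RHS]mulrA cz ?memvf // mulrA pure_mul.
  by rewrite !mulr1.
have [c bc] : exists c, b = c%:A.
  apply: central_scalar => // y; apply/eqP; rewrite -subr_eq0; apply/eqP.
  apply: (@pure1_eq0 k A B).
  rewrite pureDr -scaleN1r pureZr scaleN1r -[in X in X - _](mulr1 (1 : A)).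
  rewrite -[in X in _ - X](mulr1 (1 : A)) -!pure_mul -ez cz ?memvf //.
  exact: subrr.
by rewrite ez bc pureZr; apply/vlineP; exists c.
Qed.

Definition alg_hom (k : fieldType) (A B : algType k) (f : A -> B) : Prop :=
  [/\ linear f, f 1 = 1 & {morph f : x y / x * y}].

Lemma alg_hom_inj (k : fieldType) (A B : falgType k) (f : A -> B) :
  simple_alg A -> alg_hom f -> injective f.
Proof.
move=> /simple_algP simA [fl f1 fM].
have f0 x : f x = 0 -> x = 0.
  move=> fx; apply/eqP; apply: contrapT => /negP nx.
  suff : f 1 = 0 by rewrite f1 => /eqP; rewrite oner_eq0.
  apply: (simA (fun x => f x = 0)).
  - exact: lin0 fl.
  - by move=> c u v fu fv; rewrite fl fu fv scaler0 addr0.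
  - by move=> r y fy; rewrite fM fy mulr0.
  - by move=> r y fy; rewrite fM fy mul0r.
  - by exists x.
move=> x y e; apply/eqP; rewrite -subr_eq0; apply/eqP/f0.
by rewrite (linD fl) -scaleN1r (linZ fl) scaleN1r e subrr.
Qed.

Lemma linear_inj_bij (k : fieldType) (U V : vectType k) (f : U -> V) :
  linear f -> injective f -> dim U = dim V -> bijective f.
Proof.
move=> fl fi dUV; pose g := lin_hom fl.
have kg : lker g == 0%VS by apply/lker0P => x y; rewrite /g !lin_homE => /fi.
have lg : limg g = fullv.
  by apply/eqP; rewrite eqEdim subvf /= limg_dim_eq ?(eqP kg) ?capv0 // !dimvf dUV.
exists (g^-1%VF) => x; first by rewrite -(lin_homE fl) lker0_lfunK.
by rewrite -(lin_homE fl) limg_lfunVK // lg memvf.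
Qed.

Section Opposite.
Context (k : fieldType) (B : falgType k).

Definition opp_alg : Type := B.

HB.instance Definition _ := Vector.on opp_alg.

Let mul (x y : opp_alg) : opp_alg := (y : B) * (x : B).
Let one : opp_alg := (1 : B).

Fact opp_mulA : associative mul.
Proof. by move=> x y z; rewrite /mul mulrA. Qed.
Fact opp_mul1l : left_id one mul. Proof. by move=> x; apply: mulr1. Qed.
Fact opp_mul1r : right_id one mul. Proof. by move=> x; apply: mul1r. Qed.
Fact opp_mulDl : left_distributive mul +%R.
Proof. by move=> x y z; apply: mulrDr. Qed.
Fact opp_mulDr : right_distributive mul +%R.
Proof. by move=> x y z; apply: mulrDl. Qed.
Fact opp_one_neq0 : one != 0. Proof. exact: (oner_neq0 B). Qed.

HB.instance Definition _ := GRing.Zmodule_isNzRing.Build opp_alg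
  opp_mulA opp_mul1l opp_mul1r opp_mulDl opp_mulDr opp_one_neq0.

Fact opp_scaleAl (c : k) (u v : opp_alg) :
  c *: (u * v) = (c *: u : opp_alg) * v :> opp_alg.
Proof. exact: (@scalerAr k B c (v : B) (u : B)). Qed.

HB.instance Definition _ :=
  GRing.Lmodule_isLalgebra.Build k opp_alg opp_scaleAl.

Fact opp_scaleAr (c : k) (u v : opp_alg) :
  c *: (u * v) = u * (c *: v : opp_alg) :> opp_alg.
Proof. exact: (@scalerAl k B c (v : B) (u : B)). Qed.

HB.instance Definition _ :=
  GRing.Lalgebra_isAlgebra.Build k opp_alg opp_scaleAr.

HB.instance Definition _ := Algebra_isFalgebra.Build k opp_alg.

Lemma opp_mulE (x y : opp_alg) : x * y = (y : B) * (x : B). Proof. by []. Qed.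

Lemma opp_simple : simple_alg B -> simple_alg opp_alg.
Proof.
move=> /simple_algP simB; apply/simple_algP => P P0 PD Pl Pr [x nx Px].
exact: (simB P P0 PD (fun r y => Pr r y) (fun r y => Pl r y) (ex_intro2 _ _ x nx Px)).
Qed.

End Opposite.

Lemma dim1_central_simple (k : fieldType) : is_central_simple (k^o : falgType k).
Proof.
have f1 : (1 = fullv :> {vspace (k^o : falgType k)})%VS.
  by apply/vspaceP => x; rewrite memvf; apply/vlineP; exists x; rewrite /GRing.scale /= mulr1.
split.
  apply/eqP; rewrite eqEsubv -{1}f1 f1 subvf /=.
  apply/subvP => x _; rewrite memv_cap memvf; apply/centvP => y _.
  exact: (@mulrC k).
move=> I _ _; have [->|nI] := eqVneq I 0%VS; first by left.
right; apply/eqP; rewrite eqEdim subvf -f1 dimv1 lt0n dimv_eq0 nI.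
by [].
Qed.

Section MatrixAlgebra.
Context (k : fieldType) (m n p : nat).

Lemma mul_mx_delta (z : 'M[k]_(m, n)) i (j : 'I_p) a b :
  (z *m delta_mx i j) a b = z a i * (b == j)%:R.
Proof.
rewrite mxE (bigD1 i) //= mxE eqxx /= big1 ?addr0 // => l li.
by rewrite mxE (negbTE li) mulr0.
Qed.

Lemma mul_delta_mx_l (z : 'M[k]_(m, n)) (i : 'I_p) j a b :
  (delta_mx i j *m z) a b = (a == i)%:R * z j b.
Proof.
rewrite mxE (bigD1 j) //= mxE eqxx andbT /= big1 ?addr0 // => l li.
by rewrite mxE (negbTE li) andbF mul0r.
Qed.

End MatrixAlgebra.

Lemma matrix_central_simple (k : fieldType) n : is_central_simple ('M[k]_n.+1 : falgType k).
Proof.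
split.
  apply/eqP; rewrite eqEsubv; apply/andP; split; last first.
    by apply/subvP => _ /vlineP[c ->]; rewrite memvZ // memv_cap memvf centv1.
  apply/subvP => z /memv_capP[_ /centvP cz].
  have cd i j a b : z a i * (b == j)%:R = (a == i)%:R * z j b.
    rewrite -mul_mx_delta -mul_delta_mx_l.
    by congr fun_of_matrix; apply: (cz (delta_mx i j) (memvf _)).
  apply/vlineP; exists (z 0 0); apply/matrixP => a b.
  have -> : (z 0 0 *: 1 : 'M[k]_n.+1) a b = z 0 0 * (a == b)%:R by rewrite !mxE.
  have [<-|nab] := eqVneq a b; last first.
    by have := cd b b a b; rewrite eqxx mulr1 (negbTE nab) mul0r mulr0.
  by have := cd a 0 a 0; rewrite !eqxx mulr1 mul1r => ->; rewrite mulr1.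
apply/simple_algP => P P0 PD Pl Pr [x nx Px].
have [i [j xij]] : exists i j, x i j != 0.
  apply: contrapT => h; case/eqP: nx; apply/matrixP => i j; rewrite mxE.
  by apply/eqP; apply: contrapT => /negP hij; apply: h; exists i, j.
have e l : (delta_mx l i : 'M[k]_n.+1) * x * delta_mx j l = x i j *: delta_mx l l.
  apply/matrixP => a b; rewrite mul_mx_delta mul_delta_mx_l !mxE.
  by rewrite mulrAC -natrM mulnb mulrC.
have Pd l : P (delta_mx l l).
  rewrite -[delta_mx l l]addr0 -[delta_mx l l]scale1r -(mulVf xij) -scalerA -e.
  by apply: PD => //; apply: Pr; apply: Pl.
have -> : (1 : 'M[k]_n.+1) = \sum_l delta_mx l l.
  apply/matrixP => a b; rewrite summxE !mxE (bigD1 a) //= mxE eqxx eq_sym /=.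
  by rewrite big1 ?addr0 // => l la; rewrite mxE eq_sym (negbTE la).
elim/big_ind: _ => // u v Pu Pv; rewrite -[u]scale1r; exact: PD.
Qed.

(** * Commuting actions *)

Section TensorAction.
Context (k : fieldType) (A B : falgType k) (V : vectType k).

Definition tens_lin (f : A -> B -> V) (u : tens A B) : V :=
  \sum_i \sum_j u i j *: f (refb i) (refb j).

Lemma tens_lin_linear f : linear (tens_lin f).
Proof.
move=> c u v; rewrite /tens_lin scaler_sumr -big_split /=; apply: eq_bigr => i _.
rewrite scaler_sumr -big_split /=; apply: eq_bigr => j _.
by rewrite !mxE scalerDl scalerA.
Qed.

Lemma tens_lin_pure f a b : (forall y, linear (f^~ y)) -> (forall x, linear (f x)) ->
  tens_lin f (pure a b) = f a b.
Proof.
move=> fl fr; rewrite {2}(refb_decomp a) (lin_sum (fl b)); apply: eq_bigr => i _.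
rewrite (linZ (fl b)) {2}(refb_decomp b) (lin_sum (fr (refb i))) scaler_sumr.
by apply: eq_bigr => j _; rewrite pureE (linZ (fr (refb i))) scalerA.
Qed.

End TensorAction.

Section CommutingActions.
Context (k : fieldType) (A B : falgType k) (V : vectType k).

Section Left.
Context (a : action A V) (b : action B V).
Hypothesis ab : forall x y v, a x (b y v) = b y (a x v).

Let f v (x : A) (y : B) := a x (b y v).
Let fl v y : linear ((f v)^~ y). Proof. exact: act_linearl. Qed.
Let fr v x : linear (f v x).
Proof. by move=> c y z; rewrite /f (act_linearl b) (act_linearr a). Qed.

Definition tact (u : tens A B) (v : V) : V := tens_lin (f v) u.

Lemma tact_pure x y v : tact (pure x y) v = a x (b y v).
Proof. exact: tens_lin_pure (fl v) (fr v). Qed.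

Let tact_linear v : linear (tact^~ v). Proof. exact: tens_lin_linear. Qed.

Program Definition act_tens : action (tens A B) V := @Action k (tens A B) V tact tact_linear _ _ _.
Next Obligation.
elim/tens_ind => [|u u' IHu IHu'|x y] c v w.
- by rewrite !(lin0 (tact_linear _)) scaler0 addr0.
- by rewrite !(linD (tact_linear _)) IHu IHu' scalerDr addrACA.
- by rewrite !tact_pure (act_linearr b) (act_linearr a).
Qed.
Next Obligation. by move=> v; rewrite -(pure11 A B) tact_pure !act_1. Qed.
Next Obligation.
move=> u w v; elim/tens_ind: u => [|u u' IHu IHu'|x y].
- by rewrite mul0r !(lin0 (tact_linear _)).
- by rewrite mulrDl !(linD (tact_linear _)) IHu IHu'.
elim/tens_ind: w => [|w w' IHw IHw'|x' y'].
- by rewrite mulr0 !(lin0 (tact_linear _)) tact_pure (lin0 (act_linearr b _)) (lin0 (act_linearr a _)).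
- rewrite mulrDr !(linD (tact_linear _)) IHw IHw' !tact_pure.
  by rewrite (linD (act_linearr b _)) (linD (act_linearr a _)).
by rewrite pure_mul !tact_pure !act_M ab.
Qed.

Lemma act_tensE x y v : act_tens (pure x y) v = a x (b y v).
Proof. exact: tact_pure. Qed.

End Left.

Section Right.
Context (a : action (opp_alg A) V) (b : action (opp_alg B) V).
Hypothesis ab : forall x y v, a x (b y v) = b y (a x v).

Let f v (x : A) (y : B) := a x (b y v).
Let fl v y : linear ((f v)^~ y). Proof. by move=> c x x'; apply: (act_linearl a (b y v) c x x'). Qed.
Let fr v x : linear (f v x).
Proof.
move=> c y z; rewrite /f [X in a x X](act_linearl b v c y z).
exact: (act_linearr a).
Qed.

Definition tract (u : tens A B) (v : V) : V := tens_lin (f v) u.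

Lemma tract_pure x y v : tract (pure x y) v = a x (b y v).
Proof. exact: tens_lin_pure (fl v) (fr v). Qed.

Let tract_linear v : linear (tract^~ v). Proof. exact: tens_lin_linear. Qed.

Program Definition act_tens_opp : action (opp_alg (tens A B)) V :=
  @Action k (opp_alg (tens A B)) V tract tract_linear _ _ _.
Next Obligation.
elim/tens_ind => [|u u' IHu IHu'|x y] c v w.
- by rewrite !(lin0 (tract_linear _)) scaler0 addr0.
- by rewrite !(linD (tract_linear _)) IHu IHu' scalerDr addrACA.
- by rewrite !tract_pure (act_linearr b) (act_linearr a).
Qed.
Next Obligation.
move=> v; rewrite -[RHS](act_1 a) -[in RHS](act_1 b v); exact: tract_pure.
Qed.
Next Obligation.
move=> w u v; rewrite opp_mulE; elim/tens_ind: u => [|u u' IHu IHu'|x y].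
- rewrite mul0r !(lin0 (tract_linear _)).
  elim/tens_ind: w => [|w w' IHw IHw'|x' y']; first by rewrite (lin0 (tract_linear _)).
    by rewrite (linD (tract_linear _)) -IHw -IHw' addr0.
  by rewrite tract_pure (lin0 (act_linearr b _)) (lin0 (act_linearr a _)).
- rewrite mulrDl !(linD (tract_linear _)) IHu IHu'.
  elim/tens_ind: w {IHu IHu'} => [|w w' IHw IHw'|x' y'].
  + by rewrite !(lin0 (tract_linear _)) addr0.
  + by rewrite !(linD (tract_linear _)) -IHw -IHw' addrACA.
  by rewrite !tract_pure (linD (act_linearr b _)) (linD (act_linearr a _)).
elim/tens_ind: w => [|w w' IHw IHw'|x' y'].
- by rewrite mulr0 !(lin0 (tract_linear _)).
- by rewrite mulrDr !(linD (tract_linear _)) IHw IHw'.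
rewrite pure_mul !tract_pure (act_M a x' x) (act_M b y' y) ab.
by [].
Qed.

Lemma act_tens_oppE x y v : act_tens_opp (pure x y) v = a x (b y v).
Proof. exact: tract_pure. Qed.

End Right.
End CommutingActions.

(** Two commuting actions are one action of the tensor product, which is simple, so the dimension
    decides. The Skolem-Noether theorem is used in this form. *)
Lemma commuting_actions_iso (k : fieldType) (A B : falgType k) (V W : vectType k)
    (a : action A V) (b : action B V) (a' : action A W) (b' : action B W) :
  is_central_simple A -> simple_alg B ->
  (forall x y v, a x (b y v) = b y (a x v)) ->
  (forall x y v, a' x (b' y v) = b' y (a' x v)) ->
  dim V = dim W -> exists h, module_iso a a' h /\ module_iso b b' h.
Proof.
move=> csA simB ab ab' dVW.
have [h [hl hb hM]] := simple_module_iso (tens_simple csA simB)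
  (act_tens ab) (act_tens ab') dVW.
exists h; split; split=> // x v.
  by have := hM (pure x 1) v; rewrite /= !tact_pure !act_1.
by have := hM (pure 1 x) v; rewrite /= !tact_pure !act_1.
Qed.

Section HomActions.
Context (k : fieldType) (R : falgType k) (X V : vectType k).

(** ['Hom(X, V)] plays the tensor product of the dual of [X] with [V]. Acting on the source
    exchanges sides: [act_pre] makes a right action into a left one, and [act_preo] a left one into
    a right one. *)
Program Definition act_post (a : action R V) : action R 'Hom(X, V) :=
  @Action k R _ (fun r h => (lin_hom (act_linearr a r) \o h)%VF) _ _ _ _.
Next Obligation.
move=> a h c r s; apply/lfunP => x.
rewrite /= add_lfunE scale_lfunE !comp_lfunE !lin_homE; exact: (act_linearl a).
Qed.
Next Obligation.
move=> a r c h h'; apply/lfunP => x.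
rewrite comp_lfunE lin_homE !lfunE /= !lfunE /= comp_lfunE lin_homE (act_linearr a).
by rewrite lin_homE.
Qed.
Next Obligation. by move=> a h; apply/lfunP => x; rewrite comp_lfunE lin_homE act_1. Qed.
Next Obligation.
by move=> a r s h; apply/lfunP => x; rewrite !comp_lfunE !lin_homE act_M.
Qed.

Program Definition act_pre (a : action (opp_alg R) X) : action R 'Hom(X, V) :=
  @Action k R _ (fun r h => (h \o lin_hom (act_linearr a r))%VF) _ _ _ _.
Next Obligation.
move=> a h c r s; apply/lfunP => x.
rewrite /= add_lfunE scale_lfunE !comp_lfunE !lin_homE -linearP; congr (h _).
exact: (act_linearl a x c r s).
Qed.
Next Obligation.
move=> a r c h h'; apply/lfunP => x.
by rewrite comp_lfunE !lfunE /= !lfunE /= ?comp_lfunE ?lfunE ?lin_homE /=.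
Qed.
Next Obligation.
move=> a h; apply/lfunP => x; rewrite comp_lfunE lin_homE; congr (h _); exact: (act_1 a).
Qed.
Next Obligation.
move=> a r s h; apply/lfunP => x; rewrite !comp_lfunE !lin_homE; congr (h _).
exact: (act_M a s r).
Qed.

Program Definition act_preo (a : action R X) : action (opp_alg R) 'Hom(X, V) :=
  @Action k (opp_alg R) _ (fun r h => (h \o lin_hom (act_linearr a r))%VF) _ _ _ _.
Next Obligation.
move=> a h c r s; apply/lfunP => x.
rewrite /= add_lfunE scale_lfunE !comp_lfunE !lin_homE -linearP; congr (h _).
exact: (act_linearl a x c r s).
Qed.
Next Obligation.
move=> a r c h h'; apply/lfunP => x.
by rewrite comp_lfunE !lfunE /= !lfunE /= ?comp_lfunE ?lfunE ?lin_homE /=.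
Qed.
Next Obligation.
move=> a h; apply/lfunP => x; rewrite comp_lfunE lin_homE; congr (h _); exact: (act_1 a).
Qed.
Next Obligation.
move=> a r s h; apply/lfunP => x; rewrite !comp_lfunE !lin_homE; congr (h _).
exact: (act_M a s r).
Qed.

End HomActions.

Section BasicActions.
Context (k : fieldType).

Program Definition act_regl (A : falgType k) : action A A :=
  @Action k A A (fun r v => r * v) _ _ (@mul1r A) _.
Next Obligation. by move=> A v c r s; rewrite mulrDl scalerAl. Qed.
Next Obligation. by move=> A v c r s; rewrite mulrDr scalerAr. Qed.
Next Obligation. by move=> A r s v; rewrite /= mulrA. Qed.

Program Definition act_regr (A : falgType k) : action (opp_alg A) A :=
  @Action k (opp_alg A) A (fun (r : A) v => v * r) _ _ (@mulr1 A) _.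
Next Obligation.
move=> A v c r s.
have h : v * (c *: (r : A) + (s : A)) = c *: (v * (r : A)) + v * (s : A).
  by rewrite mulrDr scalerAr.
exact: h.
Qed.
Next Obligation. by move=> A v c r s; rewrite mulrDl scalerAl. Qed.
Next Obligation. by move=> A r s v; apply: mulrA. Qed.

Program Definition act_scalar (V : vectType k) : action (opp_alg (k^o : falgType k)) V :=
  @Action k (opp_alg (k^o : falgType k)) V (fun (r : k) v => r *: v) _ _ (@scale1r k V) _.
Next Obligation. by move=> V v c r s; rewrite scalerDl scalerA. Qed.
Next Obligation. by move=> V r c u v; rewrite scalerDr !scalerA mulrC. Qed.
Next Obligation. by move=> V r s v; rewrite /= scalerA; congr (_ *: _); apply: mulrC. Qed.

Program Definition act_col n : action ('M[k]_n.+1 : falgType k) 'cV[k]_n.+1 :=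
  @Action k ('M[k]_n.+1 : falgType k) 'cV[k]_n.+1 (fun r v => r *m v) _ _ _ _.
Next Obligation. by move=> n v c r s; rewrite mulmxDl scalemxAl. Qed.
Next Obligation. by move=> n r c u v; rewrite mulmxDr scalemxAr. Qed.
Next Obligation. by move=> n v; apply: mul1mx. Qed.
Next Obligation. by move=> n r s v; rewrite /= mulmxA. Qed.

Program Definition act_row n : action (opp_alg ('M[k]_n.+1 : falgType k)) 'rV[k]_n.+1 :=
  @Action k (opp_alg ('M[k]_n.+1 : falgType k)) 'rV[k]_n.+1
    (fun (r : 'M[k]_n.+1) v => v *m r) _ _ _ _.
Next Obligation.
move=> n v c r s.
have h : v *m (c *: (r : 'M_n.+1) + (s : 'M_n.+1)) = c *: (v *m r) + v *m s.
  by rewrite mulmxDr scalemxAr.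
exact: h.
Qed.
Next Obligation. by move=> n r c u v; rewrite mulmxDl scalemxAl. Qed.
Next Obligation. by move=> n v; apply: mulmx1. Qed.
Next Obligation. by move=> n r s v; apply: mulmxA. Qed.

End BasicActions.

(** * Bimodules and additive invariants *)

(* When T is simple, V is isomorphic to T^m as a right module. *)
Definition bimodule_of_rank (k : fieldType) (S T : falgType k) (m : nat) : Prop :=
  exists (V : vectType k) (a : action S V) (b : action (opp_alg T) V),
    (forall x y v, a x (b y v) = b y (a x v)) /\ dim V = (m * dim T)%N.

Section Bimodules.
Context (k : fieldType).
Implicit Types A S T : falgType k.

Lemma dim_hom (X V : vectType k) : dim 'Hom(X, V) = (dim X * dim V)%N.
Proof. by []. Qed.

Lemma pre_postC R R' (X V : vectType k) (a : action (opp_alg R) X) (b : action R' V)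
    x y (h : 'Hom(X, V)) :
  act_pre V a x (act_post X b y h) = act_post X b y (act_pre V a x h).
Proof. by apply/lfunP => v /=; rewrite !comp_lfunE. Qed.

Lemma post_postC R R' (X V : vectType k) (a : action R V) (b : action R' V)
    x y (h : 'Hom(X, V)) : (forall x y v, a x (b y v) = b y (a x v)) ->
  act_post X a x (act_post X b y h) = act_post X b y (act_post X a x h).
Proof. by move=> ab; apply/lfunP => v /=; rewrite !comp_lfunE !lin_homE ab. Qed.

Lemma preo_postC R R' (X V : vectType k) (a : action R X) (b : action R' V)
    x y (h : 'Hom(X, V)) :
  act_preo V a x (act_post X b y h) = act_post X b y (act_preo V a x h).
Proof. by apply/lfunP => v /=; rewrite !comp_lfunE. Qed.

Lemma pre_preoC R R' (X V : vectType k) (a : action (opp_alg R) X) (b : action R' X)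
    x y (h : 'Hom(X, V)) : (forall x y v, a x (b y v) = b y (a x v)) ->
  act_pre V a x (act_preo V b y h) = act_preo V b y (act_pre V a x h).
Proof. by move=> ab; apply/lfunP => v /=; rewrite !comp_lfunE !lin_homE ab. Qed.

(** The bimodule is the dual of [A] tensored with [V]: like [A], its dual is a bimodule over [A] on
    both sides, of dimension dim A. *)
Lemma bimodule_tens A S T m :
  bimodule_of_rank S T m -> bimodule_of_rank (tens A S) (tens A T) m.
Proof.
move=> [V [a [b [ab dV]]]].
have c1 x y v : act_pre V (act_regr A) x (act_post A a y v)
    = act_post A a y (act_pre V (act_regr A) x v) by apply: pre_postC.
have c2 x y v : act_preo V (act_regl A) x (act_post A b y v)
    = act_post A b y (act_preo V (act_regl A) x v) by apply: preo_postC.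
exists 'Hom(A, V), (act_tens c1), (act_tens_opp c2); split; last first.
  by rewrite dim_hom dV mulnCA.
move=> x y v; elim/tens_ind: x => [|x x' IH IH'|x1 x2].
- by rewrite !(lin0 (act_linearl (act_tens c1) _)) (lin0 (act_linearr (act_tens_opp c2) _)).
- rewrite !(linD (act_linearl (act_tens c1) _)) IH IH'.
  by rewrite (linD (act_linearr (act_tens_opp c2) _)).
elim/tens_ind: y => [|y y' IH IH'|y1 y2].
- rewrite !(lin0 (act_linearl (act_tens_opp c2) _)).
  by rewrite (lin0 (act_linearr (act_tens c1) _)).
- rewrite !(linD (act_linearl (act_tens_opp c2) _)) -IH -IH'.
  by rewrite (linD (act_linearr (act_tens c1) _)).
rewrite !act_tensE !act_tens_oppE.
rewrite -(preo_postC (act_regl A) a) (post_postC _ _ _ ab).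
rewrite pre_preoC ?pre_postC // => p q w.
by rewrite /= mulrA.
Qed.

(** Tensoring [V] with a column space of size f+1 and a row space of size g+1 gives dimension (f+1)
    (g+1) n dim T; rank m over the matrices over T means m (g+1)^2 dim T. *)
Lemma bimodule_matrix S T m n f g : (n * f.+1 = m * g.+1)%N ->
  bimodule_of_rank S T n ->
  bimodule_of_rank (tens S 'M[k]_f.+1) (tens T 'M[k]_g.+1) m.
Proof.
move=> e [V [a [b [ab dV]]]].
pose Y := 'cV[k]_g.+1; pose X := 'rV[k]_f.+1; pose U := 'Hom(Y, V).
pose a' := act_post X (act_post Y a); pose b' := act_post X (act_post Y b).
pose p := act_pre U (act_row k f); pose q := act_post X (act_preo V (act_col k g)).
have c1 x y v : a' x (p y v) = p y (a' x v) by rewrite /p pre_postC.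
have c2 x y v : b' x (q y v) = q y (b' x v).
  by apply: post_postC => {}x {}y {}v; rewrite preo_postC.
exists 'Hom(X, U), (act_tens c1), (act_tens_opp c2); split; last first.
  rewrite dim_hom dim_hom dV [dim X]mul1n [dim Y]muln1.
  have -> : dim (tens T 'M[k]_g.+1) = (dim T * (g.+1 * g.+1))%N by [].
  transitivity ((n * f.+1) * (g.+1 * dim T))%N; last rewrite e.
    by move: (dim T) => t; lia.
  by move: (dim T) => t; lia.
move=> x y v; elim/tens_ind: x => [|x x' IH IH'|x1 x2].
- by rewrite !(lin0 (act_linearl (act_tens c1) _)) (lin0 (act_linearr (act_tens_opp c2) _)).
- rewrite !(linD (act_linearl (act_tens c1) _)) IH IH'.
  by rewrite (linD (act_linearr (act_tens_opp c2) _)).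
elim/tens_ind: y => [|y y' IH IH'|y1 y2].
- rewrite !(lin0 (act_linearl (act_tens_opp c2) _)).
  by rewrite (lin0 (act_linearr (act_tens c1) _)).
- rewrite !(linD (act_linearl (act_tens_opp c2) _)) -IH -IH'.
  by rewrite (linD (act_linearr (act_tens c1) _)).
rewrite !act_tensE !act_tens_oppE.
rewrite /p pre_postC [act_pre _ _ _ (q _ _)]pre_postC.
rewrite [RHS](_ : _ = b' y1 (a' x1 (q y2 (act_pre U (act_row k f) x2 v)))); last first.
  by congr (b' _ _); apply: post_postC => {}x {}y {}w; rewrite preo_postC.
by apply: post_postC => {}x {}y {}w; rewrite post_postC.
Qed.

Lemma bimodule_of_module S A (X : vectType k) :
  action (opp_alg S) X -> bimodule_of_rank (tens A S) A (dim X).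
Proof.
move=> a; pose V := 'Hom(X, A).
have c1 x y v : act_post X (act_regl A) x (act_pre A a y v)
   = act_pre A a y (act_post X (act_regl A) x v) by rewrite pre_postC.
exists V, (act_tens c1), (act_post X (act_regr A)); split; last by rewrite dim_hom.
move=> x y v; elim/tens_ind: x => [|x x' IH IH'|x1 x2].
- rewrite !(lin0 (act_linearl (act_tens c1) _)).
  by rewrite (lin0 (act_linearr (act_post X (act_regr A)) _)).
- rewrite !(linD (act_linearl (act_tens c1) _)) IH IH'.
  by rewrite (linD (act_linearr (act_post X (act_regr A)) _)).
rewrite !act_tensE pre_postC; apply: post_postC => {}x {}y {}w.
by rewrite /= mulrA.
Qed.

Lemma bimodule_of_module_base S (X : vectType k) :
  action (opp_alg S) X -> bimodule_of_rank S (k^o : falgType k) (dim X).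
Proof.
move=> a; pose V := 'Hom(X, k^o : falgType k).
exists V, (act_pre _ a), (act_scalar V); split; last by rewrite dim_hom.
by move=> x y v; rewrite (linZ (act_linearr (act_pre _ a) x)).
Qed.

Lemma tens_powS A n : tens_pow A n.+2 = tens A (tens_pow A n.+1).
Proof. by []. Qed.

(** The module absorbs i+1 factors, and the remaining ones are tensored on. Positive powers contain
    no factor k, so v = 0 and v = 1 are separate base cases. *)
Lemma bimodule_pow A i (X : vectType k) v : action (opp_alg (tens_pow A i.+1)) X ->
  bimodule_of_rank (tens_pow A (v + i.+1)) (tens_pow A v) (dim X).
Proof.
move=> a; case: v => [|v]; first exact: bimodule_of_module_base.
elim: v => [|v IH].
  exact: bimodule_of_module.
by rewrite addSn -addSnnS addSn 2!tens_powS addSnnS; apply: bimodule_tens.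
Qed.

End Bimodules.

(** * Matrix representations as dg functors *)

Section FreeModules.
Context (k : fieldType) (T : falgType k) (I : finType).

Definition basis_vec (i : I) : {ffun I -> T} := [ffun l => (l == i)%:R].

Program Definition act_free : action (opp_alg T) {ffun I -> T} :=
  @Action k (opp_alg T) {ffun I -> T} (fun (t : T) v => [ffun i => v i * t]) _ _ _ _.
Next Obligation.
by move=> v c r s; apply/ffunP => i; rewrite !ffunE; apply: (act_linearl (act_regr T)).
Qed.
Next Obligation.
by move=> r c u v; apply/ffunP => i; rewrite !ffunE mulrDl scalerAl.
Qed.
Next Obligation. by move=> v; apply/ffunP => i; rewrite ffunE; apply: mulr1. Qed.
Next Obligation. by move=> r s v; apply/ffunP => i; rewrite !ffunE; apply: mulrA. Qed.

Lemma ffun_basis (v : {ffun I -> T}) : v = \sum_i act_free (v i) (basis_vec i).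
Proof.
apply/ffunP => j; rewrite sum_ffunE (bigD1 j) //= !ffunE eqxx mul1r.
rewrite big1 ?addr0 // => i ij.
by rewrite !ffunE eq_sym (negbTE ij) mul0r.
Qed.

Lemma dim_ffun : dim {ffun I -> T} = (#|I| * dim T)%N. Proof. by []. Qed.

End FreeModules.

Section MatrixRepresentations.
Context (k : fieldType) (S T : falgType k).

Definition matrix_rep (I : finType) (phi : S -> I -> I -> T) : Prop :=
  [/\ forall j i, linear (fun s => phi s j i), forall j i, phi 1 j i = (j == i)%:R &
      forall s t j i, phi (s * t) j i = \sum_l phi s j l * phi t l i].

Section RepAction.
Context (I : finType) (phi : S -> I -> I -> T) (rphi : matrix_rep phi).

Program Definition act_rep : action S {ffun I -> T} :=
  @Action k S {ffun I -> T} (fun s v => [ffun j => \sum_i phi s j i * v i]) _ _ _ _.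
Next Obligation.
move=> v c r s; apply/ffunP => j; rewrite !ffunE scaler_sumr -big_split /=.
by apply: eq_bigr => i _; case: rphi => l _ _; rewrite l mulrDl scalerAl.
Qed.
Next Obligation.
move=> r c u v; apply/ffunP => j; rewrite !ffunE scaler_sumr -big_split /=.
by apply: eq_bigr => i _; rewrite !ffunE mulrDr scalerAr.
Qed.
Next Obligation.
move=> v; apply/ffunP => j; rewrite !ffunE (bigD1 j) //=.
case: rphi => _ p1 _; rewrite p1 eqxx mul1r big1 ?addr0 // => i ij.
by rewrite p1 eq_sym (negbTE ij) mul0r.
Qed.
Next Obligation.
move=> r s v; apply/ffunP => j; rewrite !ffunE.
under [RHS]eq_bigr do rewrite ffunE mulr_sumr.
rewrite exchange_big /=; apply: eq_bigr => i _.
case: rphi => _ _ ->; rewrite mulr_suml; apply: eq_bigr => l _.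
by rewrite mulrA.
Qed.

Lemma act_rep_free x y v : act_rep x (act_free T I y v) = act_free T I y (act_rep x v).
Proof.
apply/ffunP => j; rewrite !ffunE mulr_suml; apply: eq_bigr => i _.
by rewrite !ffunE mulrA.
Qed.

Lemma act_rep_basis s i j : act_rep s (basis_vec T i) j = phi s j i.
Proof.
rewrite ffunE (bigD1 i) //= ffunE eqxx mulr1 big1 ?addr0 // => l li.
by rewrite ffunE (negbTE li) mulr0.
Qed.

Program Definition rep_functor : dgfunctor (alg_dgcat S) (dgmat (alg_dgcat T)) :=
  @DgFunctor k (alg_dgcat S) (dgmat (alg_dgcat T))
    (fun=> @DgSum k (alg_dgcat T) I (fun=> tt))
    (fun x y n f p => to_when (n == 0) (phi (of_when f) p.1 p.2)) _ _ _ _.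
Next Obligation.
move=> x y n c f g; apply: dprodP => p; rewrite dprod_addE dprod_scaleE.
by case: rphi => l _ _; rewrite of_when_linear l to_when_linear.
Qed.
Next Obligation.
move=> x y n f; apply: dprodP => p /=; rewrite of_when0.
by case: rphi => l _ _; rewrite (lin0 (l p.1 p.2)) to_when0.
Qed.
Next Obligation.
move=> x; apply: dprodP => -[j i] /=.
case: rphi => _ p1 _; rewrite p1; have [->|ji] := eqVneq j i; first by rewrite deltaii.
by rewrite delta_neq 1?eq_sym // to_when0.
Qed.
Next Obligation.
move=> x y z p q r e f g; apply: dprodP => -[j i] /=.
rewrite !to_whenK; have [r0|r0] := boolP (r == 0); last first.
  by rewrite -[LHS]of_whenK -[RHS]of_whenK !of_when_false.
rewrite -(lin_sum (@to_when_linear k true T)); congr to_when.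
have [p0|p0] : p = 0 \/ p != 0 by case: (eqVneq p 0); [left | right].
  have q0 : q == 0 by move: e; rewrite p0 add0r => ->.
  case: rphi => _ _ ->; apply: eq_bigr => l _.
  by rewrite !to_whenK !ifT // p0.
rewrite (of_when_false f p0) mul0r big1.
  by case: rphi => l _ _; rewrite (lin0 (l j i)).
by move=> l _; rewrite to_whenK ifN // mul0r.
Qed.

End RepAction.

Section FunctorRep.
Context (F : dgfunctor (alg_dgcat S) (dgmat (alg_dgcat T))).

(* In degree 0 the complexes [when (0 == 0) S] reduce to S itself. *)
Definition rep_of_functor (s : S) (j i : sum_idx (F tt)) : T :=
  @dgf_hom k (alg_dgcat S) (dgmat (alg_dgcat T)) F tt tt 0 s (j, i).

Lemma rep_of_functorP : matrix_rep rep_of_functor.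
Proof.
split=> [j i c s t|j i|s t j i].
- rewrite /rep_of_functor.
  have := @dgf_linear k _ _ F tt tt 0 c s t.
  by move/(congr1 (fun h : @dg_hom k (dgmat (alg_dgcat T)) (F tt) (F tt) 0 => h (j, i))).
- have := congr1 (fun h : @dg_hom k (dgmat (alg_dgcat T)) (F tt) (F tt) 0 => h (j, i))
    (@dgf_id k _ _ F tt).
  rewrite /rep_of_functor => /= ->.
  have [->|ji] := eqVneq j i; first by rewrite deltaii.
  by rewrite delta_neq 1?eq_sym.
have := @dgf_comp k _ _ F tt tt tt 0 0 0 (addr0 0) s t.
move/(congr1 (fun h : @dg_hom k (dgmat (alg_dgcat T)) (F tt) (F tt) 0 => h (j, i))).
by move=> h; exact: h.
Qed.

End FunctorRep.

End MatrixRepresentations.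

Arguments rep_of_functor {k S T} F s j i.

Section RepIso.
Context (k : fieldType) (S T : falgType k).
Context (F G : dgfunctor (alg_dgcat S) (dgmat (alg_dgcat T))).
Let I := sum_idx (F tt).
Let J := sum_idx (G tt).
Let phi := rep_of_functor F.
Let psi := rep_of_functor G.
Context (h : {ffun I -> T} -> {ffun J -> T}) (g : {ffun J -> T} -> {ffun I -> T}).
Hypothesis hl : linear h.
Hypothesis hg : cancel h g.
Hypothesis gh : cancel g h.
Hypothesis hS : forall s v,
  h (act_rep (rep_of_functorP F) s v) = act_rep (rep_of_functorP G) s (h v).
Hypothesis hT : forall t v, h (act_free T I t v) = act_free T J t (h v).

Lemma alg_hom_degree (A : falgType k) n (f f' : alg_complex A n) : n != 0 -> f = f'.
Proof. by move=> n0; rewrite -(of_whenK f) -(of_whenK f') !of_when_false. Qed.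

Lemma h_entries v j : h v j = \sum_i h (basis_vec T i) j * v i.
Proof.
rewrite [in LHS](ffun_basis v) (lin_sum hl) sum_ffunE.
by apply: eq_bigr => i _; rewrite hT ffunE.
Qed.

Lemma g_entries v i : g v i = \sum_j g (basis_vec T j) i * v j.
Proof.
have gT t w : g (act_free T J t w) = act_free T I t (g w).
  by apply: (can_inj hg); rewrite gh hT gh.
have gl : linear g.
  by move=> c u w; apply: (can_inj hg); rewrite hl !gh.
rewrite [in LHS](ffun_basis v) (lin_sum gl) sum_ffunE.
by apply: eq_bigr => j _; rewrite gT ffunE.
Qed.

Definition rep_to (x : alg_dgcat S) : dg_hom (F x) (G x) 0 :=
  match x with tt => fun p => h (basis_vec T p.2) p.1 end.

Definition rep_inv (x : alg_dgcat S) : dg_hom (G x) (F x) 0 :=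
  match x with tt => fun p => g (basis_vec T p.2) p.1 end.

Program Definition rep_nat_iso : dg_nat_iso F G :=
  @DgNatIso k (alg_dgcat S) (dgmat (alg_dgcat T)) F G rep_to rep_inv
    _ _ _ _ _.
Next Obligation. by move=> [] /=; apply: dprodP => p. Qed.
Next Obligation. by move=> [] /=; apply: dprodP => p. Qed.
Next Obligation.
move=> [] /=; apply: dprodP => -[i i'].
transitivity (basis_vec T i' i).
  by rewrite -[in RHS](hg (basis_vec T i')) g_entries.
rewrite ffunE /=; have [->|ii] := eqVneq i i'; first by rewrite deltaii.
by rewrite delta_neq 1?eq_sym.
Qed.
Next Obligation.
move=> [] /=; apply: dprodP => -[j j'].
transitivity (basis_vec T j' j).
  by rewrite -[in RHS](gh (basis_vec T j')) h_entries.
rewrite ffunE /=; have [->|jj] := eqVneq j j'; first by rewrite deltaii.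
by rewrite delta_neq 1?eq_sym.
Qed.
Next Obligation.
move=> [] [] n f; apply: dprodP => -[j i].
have [n0|n0] : n = 0 \/ n != 0 by case: (eqVneq n 0); [left | right].
  subst n; have := congr1 (fun w : {ffun J -> T} => w j) (hS f (basis_vec T i)).
  rewrite h_entries ffunE => e.
  have [e1 e2] : (\sum_l psi f j l * h (basis_vec T i) l : T) =
     \sum_l h (basis_vec T l) j * phi f l i /\ True.
    by split=> //; rewrite -e; apply: eq_bigr => l _; rewrite act_rep_basis.
  exact: e1.
exact: (@alg_hom_degree T n).
Qed.

End RepIso.

(** A functor of size m is an action of [S] on T^m commuting with the right action of [T]. Sizes fix
    dimensions, and an isomorphism of bimodules is a natural isomorphism by [rep_nat_iso]. *)
Lemma functor_nat_iso (k : fieldType) (S T : falgType k)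
    (F G : dgfunctor (alg_dgcat S) (dgmat (alg_dgcat T))) :
  is_central_simple S -> is_central_simple T ->
  #|sum_idx (F tt)| = #|sum_idx (G tt)| -> inhabited (dg_nat_iso F G).
Proof.
move=> csS [_ simT] e.
have [|h [[hl hb hS] [_ _ hT]]] := commuting_actions_iso csS (opp_simple simT)
  (act_rep_free (rep_of_functorP F)) (act_rep_free (rep_of_functorP G)).
  by rewrite !dim_ffun e.
case: hb => g hg gh; constructor; exact: rep_nat_iso hl hg gh hS hT.
Qed.

(** By its dimension the bimodule is free as a right module, and a basis turns the action of [S]
    into matrices over [T]. *)
Lemma functor_of_bimodule (k : fieldType) (S T : falgType k) m :
  simple_alg T -> bimodule_of_rank S T m ->
  exists F : dgfunctor (alg_dgcat S) (dgmat (alg_dgcat T)), #|sum_idx (F tt)| = m.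
Proof.
move=> simT [V [a [b [ab dV]]]].
have [|h [hl [g hg gh] hT]] := simple_module_iso (opp_simple simT) b (act_free T 'I_m).
  by rewrite dV dim_ffun card_ord.
have gT t w : g (act_free T _ t w) = b t (g w).
  by apply: (can_inj hg); rewrite gh hT gh.
have gl : linear g by move=> c u w; apply: (can_inj hg); rewrite hl !gh.
pose phi s j i := h (a s (g (basis_vec T i))) j.
have hE s v j : h (a s (g v)) j = \sum_i phi s j i * v i.
  rewrite [in LHS](ffun_basis v) (lin_sum gl) (lin_sum (act_linearr a s)) (lin_sum hl).
  by rewrite sum_ffunE; apply: eq_bigr => i _; rewrite gT ab hT ffunE.
have rphi : matrix_rep phi.
  split=> [j i c s t|j i|s t j i]; rewrite /phi.
  - by rewrite act_linearl hl !ffunE.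
  - by rewrite act_1 gh ffunE.
  - by rewrite act_M -[in LHS](hg (a t _)) hE.
by exists (rep_functor rphi); rewrite /= card_ord.
Qed.

(** [S] embeds into M_m(T) by simplicity, and the dimensions agree, so the functor is fully
    faithful. As m > 0, a coordinate [p0] of its value exists and exhibits a one-term sum as a
    retract. *)
Lemma functor_morita (k : fieldType) (S T : falgType k) m
    (F : dgfunctor (alg_dgcat S) (dgmat (alg_dgcat T))) :
  simple_alg S -> #|sum_idx (F tt)| = m -> (0 < m)%N -> dim S = (m ^ 2 * dim T)%N ->
  morita_equivalence F.
Proof.
move=> simS cF m0 dS; pose I := sum_idx (F tt).
have [p0 _] : exists p0 : I, true.
  by move: m0; rewrite -cF => /card_gt0P[p0 _]; exists p0.
have [l1 p1 pM] := rep_of_functorP F; set phi := rep_of_functor F in l1 p1 pM.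
have B x y n : exists g, cancel (@dgf_hom k (alg_dgcat S) _ F x y n) g /\ cancel g (@dgf_hom k (alg_dgcat S) _ F x y n).
  case: x y => [] [].
  have [n0|n0] : n = 0 \/ n != 0 by case: (eqVneq n 0); [left | right].
    subst n.
    pose f s : {ffun I * I -> T} := [ffun p => phi s p.1 p.2].
    have fl : linear f by move=> c s t; apply/ffunP => p; rewrite !ffunE l1.
    have [||g fg gf] := linear_inj_bij fl.
    - have f0 s : f s = 0 -> s = 0.
        move=> /ffunP fs; apply/eqP; apply: contrapT => /negP ns.
        suff : phi 1 p0 p0 = 0 by rewrite p1 eqxx => /eqP; rewrite oner_eq0.
        have [h _] := simple_algP S.
        suff : forall j i, phi 1 j i = 0 by apply.
        apply: (h simS (fun s => forall j i, phi s j i = 0)).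
        + by move=> j i; rewrite (lin0 (l1 j i)).
        + by move=> c u v hu hv j i; rewrite l1 hu hv scaler0 addr0.
        + by move=> r t ht j i; rewrite pM big1 // => q _; rewrite ht mulr0.
        + by move=> r t ht j i; rewrite pM big1 // => q _; rewrite ht mul0r.
        + by exists s => // j i; have := fs (j, i); rewrite !ffunE.
      move=> s t est; apply/eqP; rewrite -subr_eq0; apply/eqP/f0.
      by rewrite (linD fl) -scaleN1r (linZ fl) scaleN1r est subrr.
    - by rewrite dim_ffun card_prod cF dS.
    - exists (fun d => g [ffun p => d p]); split=> d; first by rewrite -[RHS]fg; congr g; apply/ffunP => p; rewrite !ffunE; case: p.
      apply: dprodP => -[j i].
      by have := congr1 (fun w : {ffun I * I -> T} => w (j, i)) (gf [ffun p => d p]); rewrite !ffunE.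
  exists (fun=> 0); split=> d; first exact: (@alg_hom_degree k S n).
  by apply: dprodP => p; apply: (@alg_hom_degree k T n).
apply: (@fully_faithful_morita k (alg_dgcat S) (dgmat (alg_dgcat T)) F
  (fun x y n => sval (cid (B x y n))) _ _ (fun u => sum_idx u) (fun u i => tt)
  (fun u i p => if p.2 == p0 then delta (@sum_obj k (alg_dgcat T) u) i p.1 else 0)
  (fun u i p => if p.1 == p0 then delta (@sum_obj k (alg_dgcat T) u) p.2 i else 0)).
- by move=> x y n; case: (cid (B x y n)) => g [].
- by move=> x y n; case: (cid (B x y n)) => g [].
- by move=> u i; apply: dprodP => p.
- by move=> u i; apply: dprodP => p.
- move=> u; apply: dprodP => -[l l']; rewrite dprod_sumE /=.
  transitivity (\sum_i dg_comp (addr0 0) (delta (@sum_obj k (alg_dgcat T) u) i l)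
     (delta (@sum_obj k (alg_dgcat T) u) l' i)).
    apply: eq_bigr => i _; rewrite (bigD1 p0) //= eqxx big1; first exact: addr0.
    by move=> p /negbTE pp; rewrite pp mul0r.
  exact: (@sum_delta_comp k (alg_dgcat T) _ (@sum_obj k (alg_dgcat T) u) l
    (sum_obj l') 0 (addr0 0) (fun i => delta _ l' i)).
Qed.

Lemma card_sigT (I : finType) (J : I -> finType) :
  #|{: {i : I & J i}}| = (\sum_(i : I) #|J i|)%N.
Proof. by rewrite card_tagged sumnE big_map big_enum. Qed.

(** * Morphisms of a given rank *)

Section RankMorphisms.
Context (k : fieldType) (D : additive_category) (E : functor (dgCat k) D).
Hypothesis addE : is_additive_invariant E.
Implicit Types S T U : falgType k.

Let EA S : add_ob D := E (alg_dgcat S).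
Let iota S := inv_hom E (mat_incl (alg_dgcat S)).

Let iota_iso S : @is_iso D _ _ (iota S).
Proof. exact/(inv_hom_morita addE)/mat_incl_morita. Qed.

(* Since iota T is invertible, a functor from S to the matrices over T induces a
   morphism E(S) -> E(T). *)
Definition rank_hom S T (m : nat) (f : add_hom (EA S) (EA T)) : Prop :=
  exists2 F : dgfunctor (alg_dgcat S) (dgmat (alg_dgcat T)),
    #|sum_idx (F tt)| = m & add_comp (iota T) f = inv_hom E F.

Lemma functor_rank_hom S T (F : dgfunctor (alg_dgcat S) (dgmat (alg_dgcat T))) :
  exists f, rank_hom #|sum_idx (F tt)| f /\ add_comp (iota T) f = inv_hom E F.
Proof.
have [g [ig gi]] := iota_iso T.
have e : add_comp (iota T) (add_comp g (inv_hom E F)) = inv_hom E F.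
  by rewrite add_compA [X in add_comp X _]ig add_comp1f.
by exists (add_comp g (inv_hom E F)); split=> //; exists F.
Qed.

Lemma rank_hom_exists S T m : simple_alg T -> bimodule_of_rank S T m ->
  exists f, @rank_hom S T m f.
Proof.
move=> simT /(functor_of_bimodule simT)[F <-].
by have [f [hf _]] := functor_rank_hom F; exists f.
Qed.

Lemma inv_hom_size S T (F G : dgfunctor (alg_dgcat S) (dgmat (alg_dgcat T))) :
  is_central_simple S -> is_central_simple T ->
  #|sum_idx (F tt)| = #|sum_idx (G tt)| -> inv_hom E F = inv_hom E G.
Proof.
by move=> csS csT e; have [eta] := functor_nat_iso csS csT e; apply: inv_hom_nat_iso.
Qed.

Lemma rank_hom_uniq S T m (f g : add_hom (EA S) (EA T)) :
  is_central_simple S -> is_central_simple T ->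
  rank_hom m f -> rank_hom m g -> f = g.
Proof.
move=> csS csT [F cF eF] [G cG eG]; apply: (is_iso_cancel (iota_iso T)).
by rewrite [LHS]eF [RHS]eG; apply: inv_hom_size => //; rewrite cF cG.
Qed.

Lemma rank_hom_id S : rank_hom 1 (add_id (EA S)).
Proof.
by exists (mat_incl (alg_dgcat S)); rewrite ?card_unit ?add_compf1.
Qed.

Lemma rank_hom_zero S T : rank_hom 0 (0 : add_hom (EA S) (EA T)).
Proof.
exists (zero_functor (alg_dgcat S) (alg_dgcat T)); first by rewrite /= card_void.
by rewrite add_compf0 inv_zero.
Qed.

Lemma rank_hom_comp S T U m n (f : add_hom (EA S) (EA T)) (g : add_hom (EA T) (EA U)) :
  is_central_simple T -> is_central_simple U ->
  rank_hom m f -> rank_hom n g -> rank_hom (m * n) (add_comp g f).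
Proof.
move=> csT csU [F cF eF] [G cG eG].
have eT (x : alg_dgcat T) : #|sum_idx (G x)| = n by case: x.
exists (dgf_mul (mat_ext G) F).
  rewrite /= card_sigT; under eq_bigr do rewrite eT.
  by rewrite sum_nat_const cF.
rewrite inv_homM -eF !add_compA; congr add_comp.
rewrite eG /iota -inv_homM; apply: inv_hom_size => //=.
by rewrite card_sigT big_const card_unit /= addn0.
Qed.

Lemma rank_hom_iso S T m (f : add_hom (EA S) (EA T)) :
  simple_alg S -> (0 < m)%N -> dim S = (m ^ 2 * dim T)%N -> rank_hom m f ->
  @is_iso D _ _ f.
Proof.
move=> simS m0 dS [F cF eF]; have := functor_morita simS cF m0 dS.
move/(inv_hom_morita addE); rewrite -eF; have [g [ig gi]] := iota_iso T.
move=> [h [h1 h2]]; exists (add_comp h (iota T)); split.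
  apply: (is_iso_cancel (iota_iso T)); rewrite /= add_compf1.
  rewrite !add_compA -[RHS](@add_comp1f D) -[add_id _]h1.
  by [].
by rewrite /= -add_compA [LHS]h2.
Qed.

(** The sum of [F] and [G] is the diagonal into [T_dg] followed by [split_functor F G]. The
    endomorphisms [x] and [y] come from the diagonal alone, hence do not depend on [T], [f] and
    [g]. *)
Lemma split_sum_hom S : exists x y : add_hom (EA S) (EA S),
  forall T m n (f g : add_hom (EA S) (EA T)), is_central_simple S ->
    is_central_simple T -> rank_hom m f -> rank_hom n g ->
    rank_hom (m + n) (add_comp f x + add_comp g y).
Proof.
have [x [y exy]] := inv_diag addE (alg_dgcat S); exists x, y.
move=> T m n f g csS csT [F cF eF] [G cG eG].
pose H := split_functor F G.
exists (dgf_mul (mat_ext H) (diag_functor (alg_dgcat S))).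
  by rewrite /= card_sigT big_bool /= cF cG addnC.
have eH i : add_comp (inv_hom E (mat_ext H)) (add_comp
    (inv_hom E (mat_incl (T_dg (alg_dgcat S)))) (inv_hom E (T_incl (alg_dgcat S) i)))
    = inv_hom E (if i then G else F).
  rewrite -!inv_homM; apply: inv_hom_size => //=.
  by rewrite card_sigT big_const card_unit /= addn0; case: i.
rewrite inv_homM exy add_compDr; rewrite add_compDr (add_compDr _ _).
by rewrite !add_compA -(add_compA (inv_hom E (mat_ext H))) eH
  -(add_compA (inv_hom E (mat_ext H))) eH /= eF eG.
Qed.

Lemma rank_hom_add S T m n (f g : add_hom (EA S) (EA T)) :
  is_central_simple S -> is_central_simple T ->
  rank_hom m f -> rank_hom n g -> rank_hom (m + n) (f + g).
Proof.
move=> csS csT; have [x [y xy]] := split_sum_hom S.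
(* For the identity and the zero functor, [x] itself becomes a morphism of rank 1, so it is the
   identity by uniqueness; likewise for [y]. *)
have x1 : x = add_id _.
  apply: (@rank_hom_uniq S S 1) => //; last exact: rank_hom_id.
  have := xy S 1%N 0%N _ _ csS csS (rank_hom_id S) (rank_hom_zero S S).
  by rewrite add_comp1f add_comp0f addr0 addn0.
have y1 : y = add_id _.
  apply: (@rank_hom_uniq S S 1) => //; last exact: rank_hom_id.
  have := xy S 0%N 1%N _ _ csS csS (rank_hom_zero S S) (rank_hom_id S).
  by rewrite add_comp1f add_comp0f add0r add0n.
move=> hf hg; have := xy T m n f g csS csT hf hg.
by rewrite x1 y1 !add_compf1.
Qed.

End RankMorphisms.

(** * Splitting fields *)

Section MatrixOf.
Context (k : fieldType) (n : nat).

Definition lin_cmx (f : 'cV[k]_n -> 'cV[k]_n) : 'M[k]_n :=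
  \matrix_(i, j) f (delta_mx j 0) i 0.

Lemma lin_cmxE f : linear f -> forall v, lin_cmx f *m v = f v.
Proof.
move=> fl v; apply/colP => i; rewrite mxE {2}[v]matrix_sum_delta (lin_sum fl) summxE.
apply: eq_bigr => j _; rewrite big_ord1 (linZ fl) !mxE mulrC.
by [].
Qed.

Lemma mulmx_inj (M M' : 'M[k]_n) : (forall v : 'cV_n, M *m v = M' *m v) -> M = M'.
Proof.
move=> e; apply/matrixP => i j.
have := congr1 (fun w : 'cV_n => w i 0) (e (delta_mx j 0)).
by rewrite -!colE !mxE.
Qed.

End MatrixOf.

Lemma vect_col_iso (k : fieldType) (V : vectType k) n : dim V = n ->
  exists (f : V -> 'cV[k]_n) (g : 'cV[k]_n -> V), [/\ linear f, linear g, cancel f g & cancel g f].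
Proof.
move=> <-; exists (fun v => (v2r v)^T), (fun w => r2v w^T); split=> [c u v|c u v|v|w].
- by rewrite !linearP.
- by rewrite !linearP.
- by rewrite trmxK v2rK.
- by rewrite r2vK trmxK.
Qed.

Definition irreducible_rep (k : fieldType) (A : falgType k) n (rho : A -> 'M[k]_n.+1) :=
  alg_hom rho /\ forall U : {vspace 'cV[k]_n.+1},
    (forall a v, v \in U -> rho a *m v \in U) -> U = 0%VS \/ U = fullv.

Lemma irreducible_rep_exists (k : fieldType) (A : falgType k) :
  exists n (rho : A -> 'M[k]_n.+1), irreducible_rep rho.
Proof.
have [I [lI nI mI]] := minimal_left_ideal_exists A.
have [n dI] : exists n, \dim I = n.+1.
  by exists (\dim I).-1; rewrite prednK // lt0n dimv_eq0.
have [f [g [fl gl fg gf]]] := @vect_col_iso k (subvs_of I) n.+1 dI.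
pose F a (w : 'cV[k]_n.+1) := f (vsproj I (a * vsval (g w))).
have Fl a : linear (F a).
  by move=> c u v; rewrite /F gl linearP mulrDr -scalerAr linearP fl.
have vF a w : vsval (g (F a w)) = a * vsval (g w).
  by rewrite /F fg vsprojK // lI // subvsP.
have ginj u v : vsval (g u) = vsval (g v) -> u = v.
  by move=> /val_inj/(can_inj gf).
pose rho a := lin_cmx (F a).
have rE a v : rho a *m v = F a v by apply: lin_cmxE.
exists n, rho; split.
  split=> [c a b||a b]; apply: mulmx_inj => v; apply: ginj.
  - rewrite mulmxDl -scalemxAl !rE gl linearP /= !vF.
    by rewrite mulrDl scalerAl.
  - by rewrite rE vF mul1r mul1mx.
  - by rewrite -mulmxA !rE !vF mulrA.
move=> U sU; pose h v := vsval (g v).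
have hl : linear h by move=> c u v; rewrite /h gl linearP.
case: (mI (lin_hom hl @: U)%VS) => [r _ /memv_imgP[v Uv ->]|||].
- rewrite lin_homE /h -vF -rE -[vsval _]/(h _) -(lin_homE hl) memv_img //.
  exact: sU.
- by apply/subvP => _ /memv_imgP[v Uv ->]; rewrite lin_homE; apply: subvsP.
- move=> h0; left; apply/eqP; rewrite -subv0; apply/subvP => v Uv.
  have : lin_hom hl v \in 0%VS by rewrite -h0 memv_img.
  rewrite !memv0 lin_homE => /eqP hv; apply/eqP/ginj.
  by rewrite [LHS]hv (lin0 gl) linear0.
- move=> hI; right; apply/vspaceP => v; rewrite memvf.
  have : h v \in I by apply: subvsP.
  by rewrite -hI => /memv_imgP[u Uu]; rewrite lin_homE => /ginj ->.
Qed.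

(* A largest commuting family in the commutant of a simple module: it is its own
   commutant, and by Schur's lemma a field. *)
Section CommutingField.
Context (k : fieldType) (A : falgType k) (n : nat) (rho : A -> 'M[k]_n.+1).
Hypothesis irr : irreducible_rep rho.

Definition commuting_sub (U : {vspace 'M[k]_n.+1}) : Prop :=
  (forall x y, x \in U -> y \in U -> x * y = y * x) /\
  (forall x a, x \in U -> x * rho a = rho a * x).

Lemma maximal_commuting : exists U : {vspace 'M[k]_n.+1}, commuting_sub U /\
  forall x, (forall y, y \in U -> x * y = y * x) ->
    (forall a, x * rho a = rho a * x) -> x \in U.
Proof.
pose Q d := `[< exists2 U : {vspace 'M[k]_n.+1}, commuting_sub U & \dim U = d >].
have exQ : exists d, Q d.
  exists 0%N; apply/asboolP; exists 0%VS; last by rewrite dimv0.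
  split=> [x y|x a]; first by rewrite !memv0 => /eqP -> /eqP ->.
  by rewrite !memv0 => /eqP ->; rewrite mul0r mulr0.
have bQ d : Q d -> (d <= \dim {:'M[k]_n.+1})%N.
  by move=> /asboolP[U _ <-]; apply/dimvS/subvf.
have [d /asboolP[U [cU cA] dU] dmax] := ex_maxnP exQ bQ.
exists U; split=> // x xU xA.
have /dmax : Q (\dim (U + <[x]>)).
  apply/asboolP; exists (U + <[x]>)%VS => //; split.
    move=> _ _ /memv_addP[u Uu [_ /vlineP[c ->] ->]] /memv_addP[v Uv [_ /vlineP[c' ->] ->]].
    rewrite !mulrDl !mulrDr -!scalerAl -!scalerAr (cU u v) // -(xU u) // (xU v) //.
    by rewrite !scalerA mulrC -!addrA; congr (_ + _); rewrite addrCA.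
  move=> _ a /memv_addP[u Uu [_ /vlineP[c ->] ->]].
  by rewrite mulrDl mulrDr -scalerAl -scalerAr cA // xA.
rewrite -dU => h; have /eqP -> : U == (U + <[x]>)%VS by rewrite eqEdim addvSl h.
by apply: (subvP (addvSr _ _)); rewrite memv_line.
Qed.

End CommutingField.

(** An [{aspace}] may have an idempotent other than 1 as its unit; [mf_one] excludes this. *)
Record matrix_field (k : fieldType) (n : nat) := MatrixField {
  mf_space : {aspace 'M[k]_n.+1};
  mf_one : 1 \in mf_space;
  mf_comm : forall x y, x \in mf_space -> y \in mf_space -> x * y = y * x;
  mf_unit : forall x, x \in mf_space -> x != 0 -> x \is a GRing.unit }.

Section MatrixFieldInstances.
Context (k : fieldType) (n : nat) (d : matrix_field k n).

Definition mf_sort : Type := subvs_of (mf_space d).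
HB.instance Definition _ := Falgebra.on mf_sort.

Definition mf_val (x : mf_sort) : 'M[k]_n.+1 := vsval x.

Fact mf_mulC : commutative (@GRing.mul mf_sort).
Proof. by move=> x y; apply/val_inj/mf_comm; apply: subvsP. Qed.
HB.instance Definition _ := GRing.PzRing_hasCommutativeMul.Build mf_sort mf_mulC.

Fact mf_field : GRing.field_axiom mf_sort.
Proof.
move=> x nx; apply/vsval_unitr/mf_unit; first exact: subvsP.
by apply: contraNneq nx => x0; apply/eqP/val_inj.
Qed.
HB.instance Definition _ := GRing.ComUnitRing_isField.Build mf_sort mf_field.

Lemma mf_val1 : mf_val 1 = 1.
Proof. by apply/eqP; rewrite [_ == _]algid_eq1 mf_one. Qed.

Lemma mf_val_linear : linear mf_val.
Proof. by move=> c x y; apply: linearP. Qed.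

Lemma mf_val_inj : injective mf_val. Proof. exact: val_inj. Qed.

Definition mf_scalar (c : k) : mf_sort := c *: 1.

Lemma mf_scalarM : {morph mf_scalar : x y / x * y}.
Proof. by move=> x y; rewrite /mf_scalar -scalerAl mul1r scalerA. Qed.
Lemma mf_scalar1 : mf_scalar 1 = 1. Proof. exact: scale1r. Qed.

Fact mf_scalar_zmod : zmod_morphism mf_scalar.
Proof. by move=> x y; apply: scalerBl. Qed.
Fact mf_scalar_monoid : monoid_morphism mf_scalar.
Proof. by split; [exact: mf_scalar1 | exact: mf_scalarM]. Qed.
HB.instance Definition _ := GRing.isZmodMorphism.Build k mf_sort mf_scalar mf_scalar_zmod.
HB.instance Definition _ := GRing.isMonoidMorphism.Build k mf_sort mf_scalar mf_scalar_monoid.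

Program Definition act_mf : action mf_sort 'cV[k]_n.+1 :=
  @Action k mf_sort 'cV[k]_n.+1 (fun x v => mf_val x *m v) _ _ _ _.
Next Obligation. by move=> v c x y; rewrite mf_val_linear mulmxDl scalemxAl. Qed.
Next Obligation. by move=> x c u v; rewrite mulmxDr scalemxAr. Qed.
Next Obligation. by move=> v; apply: etrans (congr1 (mulmx^~ v) mf_val1) (mul1mx v). Qed.
Next Obligation. by move=> x y v; apply: esym (mulmxA (mf_val x) (mf_val y) v). Qed.

Lemma mf_simple : simple_alg mf_sort.
Proof.
apply/simple_algP => P P0 PD Pl Pr [x nx Px].
by rewrite -(mulVf nx); apply: Pl.
Qed.

End MatrixFieldInstances.

Section CommutantField.
Context (k : fieldType) (A : falgType k) (n : nat) (rho : A -> 'M[k]_n.+1).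
Hypothesis irr : irreducible_rep rho.

Lemma commutant_unit (x : 'M[k]_n.+1) : (forall a, x * rho a = rho a * x) -> x != 0 ->
  x \is a GRing.unit.
Proof.
move=> xA nx; have xl : linear (fun v : 'cV[k]_n.+1 => x *m v).
  by move=> c u v; rewrite mulmxDr scalemxAr.
case: irr => _ /(_ (lker (lin_hom xl))) [a v|k0|kf].
- rewrite !memv_ker !lin_homE => /eqP xv.
  by rewrite mulmxA [x *m _]xA -mulmxA xv mulmx0.
- have [||g fg gf] := @linear_inj_bij k _ _ _ xl; last 1 first.
  + have gl : linear g by move=> c u v; apply: (can_inj fg); rewrite xl !gf.
    apply/unitrP; exists (lin_cmx g); split; apply: mulmx_inj => v.
      by rewrite -mulmxA lin_cmxE // fg mul1mx.
    by rewrite -mulmxA lin_cmxE // gf mul1mx.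
  + move=> u v e; apply/eqP; rewrite -subr_eq0 -memv0 -k0 memv_ker lin_homE.
    by rewrite mulmxBr e subrr.
  + by [].
- case/eqP: nx; apply: mulmx_inj => v; rewrite mul0mx.
  by have := memvf v; rewrite -kf memv_ker lin_homE => /eqP.
Qed.

Lemma matrix_field_exists : exists d : matrix_field k n,
  (forall (x : mf_sort d) a, mf_val x * rho a = rho a * mf_val x) /\
  forall x, (forall y : mf_sort d, x * mf_val y = mf_val y * x) ->
    (forall a, x * rho a = rho a * x) -> exists y : mf_sort d, x = mf_val y.
Proof.
have [U [[cU cA] mU]] := maximal_commuting rho.
have U1 : 1 \in U by apply: mU => [y _|a]; rewrite mul1r mulr1.
have UM : is_aspace U.
  rewrite /is_aspace has_algid1 //=; apply/prodvP => x y Ux Uy; apply: mU => [z Uz|a].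
    by rewrite -mulrA (cU y) // mulrA (cU x) // mulrA.
  by rewrite -mulrA cA // mulrA cA // mulrA.
pose d := @MatrixField k n (ASpace UM) U1 cU
  (fun x Ux nx => commutant_unit (fun a => cA x a Ux) nx).
exists d; split=> [x a|x xU xA]; first exact: (cA _ a (subvsP x)).
have Ux : x \in ASpace UM.
  by apply: mU => // y Uy; exact: (xU (Subvs Uy)).
by exists (Subvs Ux).
Qed.

End CommutantField.

(** * Representations over an extension field *)

Section SemiHom.
Context (k L : fieldType) (iota : {rmorphism k -> L}) (S : falgType k) (N : nat).

(** This stands for a representation of the L-algebra S (x) L, without extending scalars. *)
Record semi_hom (Psi : S -> 'M[L]_N) : Prop := SemiHom {
  semi_linear : forall c x y, Psi (c *: x + y) = iota c *: Psi x + Psi y;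
  semi_1 : Psi 1 = 1%:M;
  semi_M : forall x y, Psi (x * y) = Psi x *m Psi y }.

Context (Psi : S -> 'M[L]_N) (hP : semi_hom Psi).

Lemma semi_0 : Psi 0 = 0.
Proof.
have := semi_linear hP (-1) 0 0; rewrite scaleN1r addNr rmorphN1 scaleN1r addNr.
by [].
Qed.

Lemma semi_D x y : Psi (x + y) = Psi x + Psi y.
Proof. by have := semi_linear hP 1 x y; rewrite rmorph1 !scale1r. Qed.

Lemma semi_Z c x : Psi (c *: x) = iota c *: Psi x.
Proof. by have := semi_linear hP c x 0; rewrite semi_0 !addr0. Qed.

Lemma semi_sum (I : Type) (r : seq I) (P : pred I) (F : I -> S) :
  Psi (\sum_(i <- r | P i) F i) = \sum_(i <- r | P i) Psi (F i).
Proof. exact: (big_morph Psi semi_D semi_0). Qed.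

(* The two-sided multiplications of S give every linear map, in particular
   the coordinate forms, which extracts each coefficient of an L-linear relation. *)
Lemma semi_indep (lam : 'I_(dim S) -> L) : is_central_simple S -> (0 < N)%N ->
  \sum_i lam i *: Psi (refb i) = 0 -> forall i, lam i = 0.
Proof.
move=> csS N0 h j.
have fl : linear (fun x : S => (v2r x 0 j)%:A : S).
  by move=> c x y; rewrite linearP !mxE scalerDl scalerA.
have [u hu] := sandwich_surj csS fl.
have : \sum_l Psi (u l) *m (\sum_i lam i *: Psi (refb i)) *m Psi (refb l) = lam j *: 1%:M.
  transitivity (\sum_i lam i *: Psi (\sum_l u l * refb i * refb l)).
    under eq_bigr => l _ do rewrite mulmx_sumr mulmx_suml.
    rewrite exchange_big /=; apply: eq_bigr => i _; rewrite semi_sum scaler_sumr.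
    by apply: eq_bigr => l _; rewrite -scalemxAr -scalemxAl !(semi_M hP).
  rewrite (bigD1 j) //= -hu refb_coord eqxx scale1r (semi_1 hP) big1 ?addr0 // => i ij.
  by rewrite -hu refb_coord (negbTE ij) scale0r semi_0 scaler0.
rewrite h; under eq_bigr do rewrite mulmx0 mul0mx.
rewrite big1 // => /matrixP/(_ (Ordinal N0) (Ordinal N0)).
by rewrite !mxE eqxx mulr1 => <-.
Qed.

Definition semi_mx : 'M[L]_(dim S, N * N) := \matrix_i mxvec (Psi (refb i)).

Lemma semi_mxE (u : 'rV[L]_(dim S)) : u *m semi_mx = mxvec (\sum_i u 0 i *: Psi (refb i)).
Proof.
rewrite mulmx_sum_row linear_sum; apply: eq_bigr => i _.
by rewrite rowK linearZ.
Qed.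

Lemma semi_mx_free : is_central_simple S -> (0 < N)%N -> row_free semi_mx.
Proof.
move=> csS N0; rewrite -kermx_eq0; apply/rowV0P => u /sub_kermxP.
rewrite semi_mxE => /(congr1 vec_mx); rewrite mxvecK linear0 => h.
by apply/rowP => i; rewrite mxE (semi_indep csS N0 h).
Qed.

End SemiHom.

Section Coordinates.
Context (k : fieldType) (n : nat) (d : matrix_field k n).
Let L := mf_sort d.

(** [module_decomposition] provides the basis, because the only nonzero left ideal of a field is the
    field itself. *)
Lemma mf_basis : exists m (w : 'I_m -> 'cV[k]_n.+1) (co : 'cV[k]_n.+1 -> 'I_m -> L),
  [/\ forall v, v = \sum_i mf_val (co v i) *m w i,
      forall x v, v = \sum_i mf_val (x i) *m w i -> forall i, x i = co v i &
      (m * dim L = n.+1)%N].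
Proof.
have minL : minimal_left_ideal (fullv : {vspace L}).
  split=> [r x _||J lJ _]; first exact: memvf.
    by apply/eqP => f0; have := memvf (1 : L); rewrite f0 memv0 oner_eq0.
  have [->|nJ] := eqVneq J 0%VS; first by left.
  right; apply/vspaceP => x; rewrite memvf.
  have nv : vpick J != 0 by rewrite vpick0.
  rewrite -[x]mulr1 -(mulVf nv) mulrA; apply: lJ; exact: memv_pick.
have [|w [sw dw]] := module_decomposition (@mf_simple k n d) minL (a := act_mf d) (U := 0%VS).
  by move=> r v; rewrite !memv0 => /eqP ->; rewrite (lin0 (act_linearr _ r)).
rewrite add0v in sw; rewrite dimv0 add0n in dw.
pose f := lin_hom (@span_linear k L fullv _ (act_mf d) _ (in_tuple w)).
have [kf lf] : lker f == 0%VS /\ limg f = fullv by apply: span_bij.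
have fE x : f x = \sum_i mf_val (vsval (x i)) *m tnth (in_tuple w) i by apply: lin_homE.
exists (size w), (fun i => tnth (in_tuple w) i), (fun v i => vsval (f^-1%VF v i)).
split; last by rewrite !dimvf in dw; rewrite dw /dim /= muln1.
  by move=> v; rewrite -fE limg_lfunVK // lf memvf.
move=> x v ->; pose y : {ffun 'I_(size w) -> subvs_of (fullv : {vspace L})} :=
  [ffun i => vsproj fullv (x i)].
have -> : \sum_i mf_val (x i) *m tnth (in_tuple w) i = f y.
  by rewrite fE; apply: eq_bigr => i _; rewrite ffunE vsprojK // memvf.
by move=> i; rewrite lker0_lfunK // ffunE vsprojK // memvf.
Qed.

End Coordinates.

Section Splitting.
Context (k : fieldType) (A : falgType k) (csA : is_central_simple A).
Context (n : nat) (rho : A -> 'M[k]_n.+1) (irr : irreducible_rep rho).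
Context (d : matrix_field k n).
Let L := mf_sort d.
Hypothesis cL : forall (x : L) a, mf_val x *m rho a = rho a *m mf_val x.
Hypothesis maxL : forall x : 'M[k]_n.+1,
  (forall y : L, x *m mf_val y = mf_val y *m x) ->
  (forall a, x *m rho a = rho a *m x) -> exists y : L, x = mf_val y.

Program Definition act_rho : action A 'cV[k]_n.+1 :=
  @Action k A 'cV[k]_n.+1 (fun a v => rho a *m v) _ _ _ _.
Next Obligation.
by move=> v c r s; case: irr => [[rl _ _] _]; rewrite rl mulmxDl scalemxAl.
Qed.
Next Obligation. by move=> r c u v; rewrite mulmxDr scalemxAr. Qed.
Next Obligation. by move=> v; case: irr => [[_ r1 _] _]; rewrite /= r1; apply: mul1mx. Qed.
Next Obligation. by move=> r s v; case: irr => [[_ _ rM] _]; rewrite /= rM; apply: esym (mulmxA _ _ _). Qed.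

Let ab x y v : act_rho x (act_mf d y v) = act_mf d y (act_rho x v).
Proof. by rewrite /= !mulmxA cL. Qed.

Let Sa := act_tens ab.

(** One half of the density theorem. Over A (x) L the module k^(n+1) is simple, and the regular
    module is a sum of [size w] copies of it, so that [size w * m = dim A]; it remains to bound m by
    [size w]. *)
Lemma splitting_dim m : (m * dim L = n.+1)%N -> (m ^ 2 <= dim A)%N.
Proof.
move=> dm; have simS := tens_simple csA (@mf_simple k n d).
have [I minI] := minimal_left_ideal_exists (tens A L).
have irrS (U : {vspace 'cV[k]_n.+1}) : stable Sa U -> U = 0%VS \/ U = fullv.
  move=> sU; case: irr => _; apply=> a v Uv; have := sU (pure a 1) v Uv.
  by rewrite act_tensE act_1.
have s0 : stable Sa (0%VS : {vspace 'cV[k]_n.+1}).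
  by move=> r v; rewrite !memv0 => /eqP ->; rewrite (lin0 (act_linearr _ r)).
have n0 : (0%VS : {vspace 'cV[k]_n.+1}) != fullv.
  by apply/eqP => /(congr1 (fun U => \dim U)); rewrite dimv0 dimvf /dim /= muln1.
have [v nv] := orb_not_sub simS minI Sa n0.
have := orb_direct minI s0 nv; rewrite add0v dimv0 add0n => dI.
have fI : (orb Sa v @: I = fullv)%VS.
  have sI : stable Sa (orb Sa v @: I)%VS by apply: stable_img.
  case: (irrS _ sI) => // e0.
  by move: nv; rewrite e0 subvv.
have dIn : \dim I = n.+1 by rewrite -dI fI dimvf /dim /= muln1.
have kI : (I :&: lker (orb Sa v) = 0)%VS.
  by apply/eqP; rewrite -dimv_eq0 -(eqn_add2r (\dim (orb Sa v @: I))) limg_ker_dim dI.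
have sr : stable (act_regl (tens A L)) 0%VS.
  by move=> r x; rewrite !memv0 => /eqP ->; rewrite (lin0 (act_linearr _ r)).
have [w [sw dw]] := module_decomposition simS minI sr.
rewrite add0v in sw; rewrite dimv0 add0n dIn dimvf in dw.
have dw' : (size w * m = dim A)%N.
  have lL : (0 < dim L)%N by move: dm; case: (dim L) => //; rewrite muln0.
  apply/eqP; rewrite -(eqn_pmul2r lL) -mulnA dm; apply/eqP; exact: dw.
suff : (m <= size w)%N by rewrite -dw' expnS expn1 leq_mul2r orbC => ->.
(* An endomorphism of the simple module is a scalar of L; applied to the
   decomposition of S this embeds the module into L^r. *)
have ex y : exists2 x, x \in I & orb Sa v x = y.
  by have := memvf y; rewrite -fI => /memv_imgP[x Ix ->]; exists x.
pose xi y := s2val (cid2 (ex y)).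
have xiI y : xi y \in I by apply: (s2valP (cid2 (ex y))).
have xiE y : orb Sa v (xi y) = y by apply: (s2valP' (cid2 (ex y))).
have xiu x y : x \in I -> orb Sa v x = y -> xi y = x.
  move=> Ix e; apply/eqP; rewrite -subr_eq0 -memv0 -kI memv_cap rpredB //=.
  by rewrite memv_ker linearB /= xiE e subrr.
have xil : linear xi.
  by move=> c y z; apply: xiu; rewrite ?rpredD ?rpredZ // linearP /= !xiE.
have xiS s y : xi (Sa s y) = s * xi y.
  case: (minI) => lI _ _; apply: xiu; first exact: lI.
  by rewrite orbE act_M -[Sa (xi y) v]orbE xiE.
pose F u i y := Sa (xi y * tnth (in_tuple w) i) u.
have Fl u i : linear (F u i).
  by move=> c y z; rewrite /F xil mulrDl -scalerAl act_linearl.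
have FS u i s y : F u i (Sa s y) = Sa s (F u i y).
  by rewrite /F xiS -mulrA act_M.
have lamP u i : exists y : L, lin_cmx (F u i) = mf_val y.
  apply: maxL => [y|a]; apply: mulmx_inj => z.
    rewrite -!mulmxA !lin_cmxE //.
    by have := FS u i (pure 1 y) z; rewrite !act_tensE !act_1.
  rewrite -!mulmxA !lin_cmxE //.
  by have := FS u i (pure a 1) z; rewrite !act_tensE !act_1.
pose lam u : {ffun 'I_(size w) -> L} := [ffun i => sval (cid (lamP u i))].
have lamE u i y : mf_val (lam u i) *m y = F u i y.
  by rewrite ffunE; case: (cid _) => x /= <-; rewrite lin_cmxE.
have laml : linear lam.
  move=> c u u'; apply/ffunP => i; apply: mf_val_inj; apply: mulmx_inj => y.
  have -> : mf_val ((c *: lam u + lam u') i) = c *: mf_val (lam u i) + mf_val (lam u' i).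
    by rewrite !ffunE mf_val_linear.
  by rewrite lamE mulmxDl -scalemxAl !lamE /F act_linearr.
have lam_inj u : lam u = 0 -> u = 0.
  move=> /ffunP l0; have F0 i y : F u i y = 0.
    by rewrite -lamE l0 ffunE (lin0 (@mf_val_linear k n d)) mul0mx.
  have : (\sum_(x <- w) orb (act_regl (tens A L)) x @: I <= lker (orb Sa u))%VS.
    rewrite -[w]/(val (in_tuple w)) big_tuple; apply/subv_sumP => i _.
    apply/subvP => _ /memv_imgP[x Ix ->]; rewrite memv_ker !orbE; apply/eqP.
    by have h := F0 i (orb Sa v x); rewrite /F (xiu x) // in h.
  rewrite sw => /subvP/(_ 1 (memvf _)); rewrite memv_ker orbE act_1.
  by move/eqP.
have : lker (lin_hom laml) == 0%VS.
  rewrite -subv0; apply/subvP => u; rewrite memv_ker memv0 lin_homE => /eqP l0.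
  exact/eqP/lam_inj.
move=> /eqP kl; have := limg_dim_eq (f := lin_hom laml) (U := fullv).
rewrite kl capv0 => /(_ erefl) e.
have := dimvS (subvf (limg (lin_hom laml))); rewrite e !dimvf.
rewrite {1}/dim /= muln1 /dim /= card_ord -dm leq_pmul2r //.
by move: dm; case: (dim L) => //; rewrite muln0.
Qed.

End Splitting.

Section SplittingField.
Context (k : fieldType) (A : falgType k) (csA : is_central_simple A).

(** One inequality is [splitting_dim]; the other holds because a k-basis of [A] stays linearly
    independent over L among the matrices ([semi_mx_free]). *)
Lemma splitting : exists (L : fieldType) (iota : {rmorphism k -> L}) (m : nat)
  (phi : A -> 'M[L]_m.+1), semi_hom iota phi /\ dim A = (m.+1 ^ 2)%N.
Proof.
have [n [rho irr]] := irreducible_rep_exists A.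
have [d [cL maxL]] := matrix_field_exists irr.
have [m [w [co [coE coU dm]]]] := mf_basis d.
have le_m := splitting_dim csA irr cL maxL dm.
have cLm (x : mf_sort d) a : mf_val x *m rho a = rho a *m mf_val x by exact: cL.
have mfM (x y : mf_sort d) : mf_val (x * y) = mf_val x *m mf_val y by [].
case: m => [|m] in w co coE coU dm le_m *; first by rewrite mul0n in dm.
case: irr => [[rl r1 rM] _].
pose phi a : 'M[mf_sort d]_m.+1 := \matrix_(i, j) co (rho a *m w j) i.
have phiE a j : rho a *m w j = \sum_i mf_val (phi a i j) *m w i.
  by rewrite {1}(coE (rho a *m w j)); apply: eq_bigr => i _; rewrite mxE.
have phiU a (M : 'M[mf_sort d]_m.+1) :
    (forall j, rho a *m w j = \sum_i mf_val (M i j) *m w i) -> phi a = M.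
  by move=> h; apply/matrixP => i j; rewrite mxE -(coU _ _ (h j)).
have sp : semi_hom (@mf_scalar k n d) phi.
  split=> [c x y||x y]; apply: phiU => j.
  - rewrite rl mulmxDl -scalemxAl !phiE scaler_sumr -big_split /=; apply: eq_bigr => i _.
    by rewrite !mxE -scalerAl mul1r mf_val_linear mulmxDl -scalemxAl.
  - rewrite r1 (bigD1 j) //= big1 ?addr0 => [|i ij]; rewrite mxE ?eqxx ?mf_val1 //.
    by rewrite (negbTE ij) (lin0 (@mf_val_linear k n d)) mul0mx.
  - rewrite rM -mulmxA phiE mulmx_sumr.
    under eq_bigr => i _ do rewrite mulmxA -cLm -mulmxA phiE mulmx_sumr.
    rewrite exchange_big /=; apply: eq_bigr => l _.
    rewrite mxE (lin_sum (@mf_val_linear k n d)) mulmx_suml; apply: eq_bigr => i _.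
    by rewrite mulmxA -mfM mulrC.
exists (mf_sort d), (@mf_scalar k n d), m, phi; split=> //.
apply/eqP; rewrite eqn_leq le_m andbT.
have /eqP <- := semi_mx_free sp csA isT.
by rewrite (leq_trans (rank_leq_col _)) // mulnn.
Qed.

End SplittingField.

(** The algebra k[X]/(X^2 - rho): an action of it is an endomorphism of square rho, so that
    [commuting_actions_iso] compares two square roots of rho. *)
Definition quad (k : fieldType) (rho : k) : Type := 'rV[k]_2.

HB.instance Definition _ (k : fieldType) (rho : k) := Vector.on (quad rho).

Section Quadratic.
Context (k : fieldType) (rho : k).
Implicit Types x y z : quad rho.

Definition re x : k := x 0 0.
Definition im x : k := x 0 1.
Definition mk_quad (a b : k) : quad rho := \row_j (if j == 0 then a else b).

Fact quad_eq x y : re x = re y -> im x = im y -> x = y.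
Proof.
move=> e f; apply/rowP => j; case: (unliftP 0 j) => [i ->|->] //.
by rewrite (ord1 i) (_ : lift 0 0 = 1) //; apply: val_inj.
Qed.
Fact re_mk a b : re (mk_quad a b) = a. Proof. by rewrite /re mxE. Qed.
Fact im_mk a b : im (mk_quad a b) = b. Proof. by rewrite /im mxE. Qed.
Fact reD x y : re (x + y) = re x + re y. Proof. by rewrite /re mxE. Qed.
Fact imD x y : im (x + y) = im x + im y. Proof. by rewrite /im mxE. Qed.
Fact reZ (c : k) x : re (c *: x) = c * re x. Proof. by rewrite /re mxE. Qed.
Fact imZ (c : k) x : im (c *: x) = c * im x. Proof. by rewrite /im mxE. Qed.

Definition quad_mul x y : quad rho :=
  mk_quad (re x * re y + rho * (im x * im y)) (re x * im y + im x * re y).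

Fact re_mul x y : re (quad_mul x y) = re x * re y + rho * (im x * im y).
Proof. exact: re_mk. Qed.
Fact im_mul x y : im (quad_mul x y) = re x * im y + im x * re y.
Proof. exact: im_mk. Qed.

Let quadE := (reD, imD, reZ, imZ, re_mul, im_mul, re_mk, im_mk).

Fact quad_mulA : associative quad_mul.
Proof. by move=> x y z; apply: quad_eq; rewrite !quadE; ring. Qed.
Fact quad_mulC : commutative quad_mul.
Proof. by move=> x y; apply: quad_eq; rewrite !quadE; ring. Qed.
Fact quad_mul1 : left_id (mk_quad 1 0) quad_mul.
Proof. by move=> x; apply: quad_eq; rewrite !quadE; ring. Qed.
Fact quad_mulDl : left_distributive quad_mul +%R.
Proof. by move=> x y z; apply: quad_eq; rewrite !quadE; ring. Qed.
Fact quad_one_neq0 : mk_quad 1 0 != 0.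
Proof.
apply/eqP => /(congr1 re); rewrite re_mk /re mxE => /eqP.
by rewrite oner_eq0.
Qed.

HB.instance Definition _ := GRing.Zmodule_isComNzRing.Build (quad rho)
  quad_mulA quad_mulC quad_mul1 quad_mulDl quad_one_neq0.

Fact quad_scaleAl (c : k) x y : c *: (x * y) = (c *: x) * y.
Proof. by apply: quad_eq; rewrite !quadE; ring. Qed.
HB.instance Definition _ := GRing.Lmodule_isLalgebra.Build k (quad rho) quad_scaleAl.

Fact quad_scaleAr (c : k) x y : c *: (x * y) = x * (c *: y).
Proof. by rewrite mulrC quad_scaleAl mulrC. Qed.
HB.instance Definition _ := GRing.Lalgebra_isAlgebra.Build k (quad rho) quad_scaleAr.
HB.instance Definition _ := Algebra_isFalgebra.Build k (quad rho).

Lemma quad_simple : (forall r : k, r ^+ 2 != rho) -> simple_alg (quad rho).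
Proof.
move=> nsq; apply/simple_algP => P P0 PD Pl Pr [x nx Px].
pose n : k := re x ^+ 2 - rho * im x ^+ 2.
have n0 : n != 0.
  apply/eqP => /eqP; rewrite subr_eq0 => /eqP e; have [b0|nb] := eqVneq (im x) 0.
    case/eqP: nx; apply: quad_eq; last by rewrite b0 /im mxE.
    apply/eqP; rewrite [X in _ == X]mxE -sqrf_eq0 e b0.
    by rewrite expr0n mulr0.
  have /eqP[] := nsq (re x / im x).
  by rewrite expr_div_n e mulfK // sqrf_eq0.
have -> : 1 = (n^-1 *: mk_quad (re x) (- im x) : quad rho) * x.
  apply: quad_eq; rewrite !quadE; last by ring.
  by rewrite -[1](mulVf n0) {2}/n; ring.
exact: Pl.
Qed.

Context (T : falgType k) (G : T) (hG : G * G = rho%:A).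

Program Definition act_quad : action (quad rho) T :=
  @Action k (quad rho) T (fun x v => re x *: v + im x *: (v * G)) _ _ _ _.
Next Obligation.
move=> v c x y /=; rewrite !quadE !scalerDl scalerDr !scalerA addrACA.
by [].
Qed.
Next Obligation.
by move=> x c u v; rewrite mulrDl -scalerAl !scalerDr !scalerA -!(mulrC c) addrACA.
Qed.
Next Obligation. by move=> v /=; rewrite [1]/(mk_quad 1 0) !quadE scale1r scale0r addr0. Qed.
Next Obligation.
move=> x y v /=; rewrite mulrDl -!scalerAl -mulrA hG -scalerAr mulr1 !quadE.
rewrite !scalerDr !scalerA !scalerDl (addrC (im x * re y *: _)) addrACA.
by rewrite (mulrC rho) addrACA.
Qed.

End Quadratic.

(** * The swap and exterior powers *)

Section SemiTensor.
Context (k L : fieldType) (iota : {rmorphism k -> L}) (S T : falgType k) (p q : nat).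
Context (Psi : S -> 'M[L]_p) (hP : semi_hom iota Psi).
Context (Psi' : T -> 'M[L]_q) (hP' : semi_hom iota Psi').

Definition semi_tens (u : tens S T) : 'M[L]_(p * q) :=
  \sum_i \sum_j iota (u i j) *: (Psi (refb i) *t Psi' (refb j)).

Lemma semi_tens_linear c u v :
  semi_tens (c *: u + v) = iota c *: semi_tens u + semi_tens v.
Proof.
rewrite /semi_tens scaler_sumr -big_split /=; apply: eq_bigr => i _.
rewrite scaler_sumr -big_split /=; apply: eq_bigr => j _.
by rewrite !mxE rmorphD rmorphM scalerDl scalerA.
Qed.

Lemma semi_tens_pure a b : semi_tens (pure a b) = Psi a *t Psi' b.
Proof.
apply/matrixP => x y; case: (mxtens_indexP x) => i i'; case: (mxtens_indexP y) => j j'.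
rewrite tensmxE {2}(refb_decomp a) {2}(refb_decomp b) !(semi_sum hP, semi_sum hP') !summxE.
rewrite mulr_suml; apply: eq_bigr => l _; rewrite summxE mulr_sumr; apply: eq_bigr => l' _.
rewrite mxE tensmxE pureE rmorphM (semi_Z hP) (semi_Z hP') !mxE.
exact: mulrACA.
Qed.

Lemma semi_tens_hom : semi_hom iota semi_tens.
Proof.
have l0 : semi_tens 0 = 0.
  have := semi_tens_linear (-1) 0 0; rewrite scaleN1r addNr => ->.
  by rewrite rmorphN1 scaleN1r addNr.
have lD u v : semi_tens (u + v) = semi_tens u + semi_tens v.
  by have := semi_tens_linear 1 u v; rewrite rmorph1 !scale1r.
split=> [||u v]; first exact: semi_tens_linear.
  rewrite -pure11 semi_tens_pure (semi_1 hP) (semi_1 hP'); apply/matrixP => x y.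
  case: (mxtens_indexP x) => i i'; case: (mxtens_indexP y) => j j'.
  by rewrite tensmxE !mxE (can_eq (@mxtens_indexK _ _)) xpair_eqE -natrM mulnb.
elim/tens_ind: u => [|u u' IH IH'|a b]; first by rewrite mul0r l0 mul0mx.
  by rewrite mulrDl !lD IH IH' mulmxDl.
elim/tens_ind: v => [|v v' IH IH'|a' b']; first by rewrite mulr0 l0 mulmx0.
  by rewrite mulrDr !lD IH IH' mulmxDr.
by rewrite pure_mul !semi_tens_pure (semi_M hP) (semi_M hP') tensmx_mul.
Qed.

End SemiTensor.

Section FullSemiHom.
Context (k L : fieldType) (iota : {rmorphism k -> L}) (S : falgType k) (N : nat).
Context (csS : is_central_simple S) (Psi : S -> 'M[L]_N) (hP : semi_hom iota Psi).
Hypotheses (N0 : (0 < N)%N) (dS : dim S = (N * N)%N).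

Lemma semi_span (X : 'M[L]_N) : exists c : 'I_(dim S) -> L, X = \sum_i c i *: Psi (refb i).
Proof.
have f : row_full (semi_mx Psi).
  have /eqP r := semi_mx_free hP csS N0.
  by apply/eqP; apply: etrans r _; exact: dS.
have /submxP[u hu] := submx_full (mxvec X) f.
by exists (u 0); apply: (can_inj mxvecK); rewrite hu semi_mxE.
Qed.

Lemma semi_inj : injective Psi.
Proof.
have Psi0 x : Psi x = 0 -> x = 0.
  rewrite {1}(refb_decomp x) (semi_sum hP) => e.
  suff c0 i : v2r x 0 i = 0 by rewrite (refb_decomp x) big1 // => i _; rewrite c0 scale0r.
  apply: (fmorph_inj iota); rewrite rmorph0.
  apply: (semi_indep hP csS N0 (lam := fun i => iota (v2r x 0 i))).
  by rewrite -[RHS]e; apply: eq_bigr => j _; rewrite (semi_Z hP).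
move=> x y e; apply/eqP; rewrite -subr_eq0; apply/eqP/Psi0.
by rewrite (semi_D hP) -scaleN1r (semi_Z hP) e rmorphN1 scaleN1r subrr.
Qed.

Lemma semi_comm_scalar (X : 'M[L]_N) : (forall x, X *m Psi x = Psi x *m X) ->
  exists c, X = c%:M.
Proof.
move=> cX; have cXY Y : X *m Y = Y *m X.
  have [c ->] := semi_span Y; rewrite mulmx_sumr mulmx_suml; apply: eq_bigr => i _.
  by rewrite -scalemxAr cX scalemxAl.
pose o := Ordinal N0; exists (X o o); apply/matrixP => i j.
have := congr1 (fun M : 'M_N => M i o) (cXY (delta_mx j o)).
rewrite !mxE (bigD1 j) //= big1 => [|l lj]; last by rewrite mxE (negbTE lj) mulr0.
rewrite mxE !eqxx mulr1 addr0 => ->.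
rewrite (bigD1 o) //= big1 => [|l lo]; last by rewrite mxE (negbTE lo) andbF mul0r.
by rewrite mxE eqxx andbT addr0 mulr_natl.
Qed.

End FullSemiHom.

(** A homogeneous linear system over k with a nonzero solution over L has one over k, because the
    rank of its matrix is the same over both fields. *)
Lemma descend (k L : fieldType) (iota : {rmorphism k -> L}) (S : falgType k)
    (V : vectType k) (J : finType) (f : J -> S -> V) (c : 'I_(dim S) -> L) i0 :
  (forall j, linear (f j)) -> c i0 != 0 ->
  (forall j r, \sum_i c i * iota (v2r (f j (refb i)) 0 r) = 0) ->
  exists2 x, x != 0 & forall j, f j x = 0.
Proof.
move=> fl nc h; pose M : 'M[k]_(dim S, #|{: J * 'I_(dim V)}|) :=
  \matrix_(i, r) v2r (f (enum_val r).1 (refb i)) 0 (enum_val r).2.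
have : ~~ row_free (map_mx iota M).
  apply: contra nc => /row_freeP[B MB]; suff /rowP/(_ i0) : (\row_i c i) = 0.
    by rewrite !mxE => ->.
  rewrite -[\row_i c i]mulmx1 -MB mulmxA.
  suff -> : (\row_i c i) *m map_mx iota M = 0 by rewrite mul0mx.
  by apply/rowP => r; rewrite !mxE -[RHS](h (enum_val r).1 (enum_val r).2);
    apply: eq_bigr => i _; rewrite !mxE.
rewrite row_free_map -kermx_eq0 => /rowV0Pn[u /sub_kermxP uM nu].
exists (r2v u).
  by apply: contraNneq nu => /(congr1 v2r); rewrite r2vK linear0 => ->.
move=> j; apply: (can_inj v2rK); rewrite linear0; apply/rowP => r.
have := congr1 (fun Z : 'rV_(_) => Z 0 (enum_rank (j, r))) uM.
rewrite !mxE => <-; rewrite (refb_decomp (r2v u)) (lin_sum (fl j)) linear_sum summxE.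
by apply: eq_bigr => i _; rewrite (linZ (fl j)) linearZ /= !mxE r2vK enum_rankK.
Qed.

Section SwapMatrix.
Context (R : comPzRingType) (n : nat).

Definition swap_mx : 'M[R]_(n * n) :=
  \matrix_(x, y) ((mxtens_unindex x) == ((mxtens_unindex y).2, (mxtens_unindex y).1))%:R.

Lemma swap_mxE i i' j j' : swap_mx (mxtens_index (i, i')) (mxtens_index (j, j')) =
  ((i == j') && (i' == j))%:R.
Proof. by rewrite mxE !mxtens_indexK xpair_eqE. Qed.

Lemma sum_mxtens (F : 'I_(n * n) -> R) : \sum_x F x = \sum_i \sum_j F (mxtens_index (i, j)).
Proof.
rewrite pair_bigA (reindex (@mxtens_index n n)) //=; first by apply: eq_bigr => -[].
by exists (@mxtens_unindex n n) => x _; [exact: mxtens_indexK | exact: mxtens_unindexK].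
Qed.

Lemma swap_mx_mull (X : 'M[R]_(n * n)) i i' y : (swap_mx *m X) (mxtens_index (i, i')) y =
  X (mxtens_index (i', i)) y.
Proof.
rewrite mxE sum_mxtens (bigD1 i') //= (bigD1 i) //= swap_mxE !eqxx mul1r.
rewrite big1 => [|l /negbTE li]; last by rewrite swap_mxE eq_sym li mul0r.
rewrite big1 => [|l /negbTE li]; first by rewrite !addr0.
by rewrite big1 // => l' _; rewrite swap_mxE (eq_sym i' l) li andbF mul0r.
Qed.

Lemma swap_mx_mulr (X : 'M[R]_(n * n)) x j j' : (X *m swap_mx) x (mxtens_index (j, j')) =
  X x (mxtens_index (j', j)).
Proof.
rewrite mxE sum_mxtens (bigD1 j') //= (bigD1 j) //= swap_mxE !eqxx mulr1.
rewrite big1 => [|l /negbTE li]; last by rewrite swap_mxE li andbF mulr0.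
rewrite big1 => [|l /negbTE li]; first by rewrite !addr0.
by rewrite big1 // => l' _; rewrite swap_mxE li mulr0.
Qed.

Lemma swap_mx_tens (X Y : 'M[R]_n) : swap_mx *m (X *t Y) = (Y *t X) *m swap_mx.
Proof.
apply/matrixP => x y; case: (mxtens_indexP x) => i i'; case: (mxtens_indexP y) => j j'.
by rewrite swap_mx_mull swap_mx_mulr !tensmxE mulrC.
Qed.

Lemma swap_mxK : swap_mx *m swap_mx = 1%:M.
Proof.
apply/matrixP => x y; case: (mxtens_indexP x) => i i'; case: (mxtens_indexP y) => j j'.
by rewrite swap_mx_mull swap_mxE mxE (can_eq (@mxtens_indexK _ _)) xpair_eqE andbC.
Qed.

End SwapMatrix.

(** * The Goldman element *)

Section Goldman.
Context (k L : fieldType) (iota : {rmorphism k -> L}) (A : falgType k).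
Context (csA : is_central_simple A) (m : nat) (phi : A -> 'M[L]_m.+1).
Hypotheses (hphi : semi_hom iota phi) (dA : dim A = (m.+1 ^ 2)%N).

Let T : falgType k := tens A A.
Let Phi : T -> 'M[L]_(m.+1 * m.+1) := semi_tens iota phi phi.
Let hPhi : semi_hom iota Phi := semi_tens_hom hphi hphi.
Let csT : is_central_simple T := tens_central_simple csA csA.

Let dT : dim T = ((m.+1 * m.+1) * (m.+1 * m.+1))%N.
Proof. by transitivity (dim A * dim A)%N => //; rewrite dA expnS expn1. Qed.

Let PhiP a b : swap_mx L m.+1 *m Phi (pure a b) = Phi (pure b a) *m swap_mx L m.+1.
Proof. by rewrite /Phi !(semi_tens_pure hphi hphi); exact: swap_mx_tens. Qed.

(** These equations determine the Goldman element of a central simple algebra up to a scalar. *)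
Definition exchange (x : T) : Prop := forall a b, x * pure a b = pure b a * x.

(** The swap matrix is an L-combination of the images of a basis and satisfies the exchange
    equations, which are linear over k; so [descend] applies. The scalar is not yet under
    control. *)
Lemma exchange_exists : exists2 x : T, x != 0 & exchange x.
Proof.
have [c hc] := semi_span csT hPhi isT dT (swap_mx L m.+1).
have [i0 ni0] : exists i0, c i0 != 0.
  apply: contrapT => h; have c0 i : c i = 0.
    by apply/eqP; apply: contrapT => /negP ni; apply: h; exists i.
  have := swap_mxK L m.+1; rewrite hc big1 => [|i _]; last by rewrite c0 scale0r.
  rewrite mul0mx => /matrixP/(_ (Ordinal (isT : 0 < m.+1 * m.+1)) (Ordinal (isT : 0 < m.+1 * m.+1)))%N.
  by rewrite !mxE eqxx => /eqP; rewrite eq_sym oner_eq0.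
pose f (j : 'I_(dim A) * 'I_(dim A)) (x : T) : T :=
  x * pure (refb j.1) (refb j.2) - pure (refb j.2) (refb j.1) * x.
have fl j : linear (f j).
  move=> s x y; rewrite /f mulrDl mulrDr -scalerAl -scalerAr scalerBr opprD.
  by rewrite addrACA.
have [j r|x nx hx] := @descend _ _ iota T T _ f c i0 fl ni0.
  have := @semi_indep _ _ _ _ _ _ hPhi (fun r => \sum_i c i * iota (v2r (f j (refb i)) 0 r)) csT isT.
  apply; transitivity (\sum_i c i *: Phi (f j (refb i))).
    under eq_bigr do rewrite scaler_suml.
    rewrite exchange_big; apply: eq_bigr => i _ /=.
    rewrite {2}(refb_decomp (f j (refb i))) (semi_sum hPhi) scaler_sumr.
    by apply: eq_bigr => l _; rewrite (semi_Z hPhi) scalerA.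
  pose a : 'M_(m.+1 * m.+1) := Phi (pure (refb j.1) (refb j.2)).
  pose b : 'M_(m.+1 * m.+1) := Phi (pure (refb j.2) (refb j.1)).
  transitivity (swap_mx L m.+1 *m a - b *m swap_mx L m.+1).
    rewrite hc mulmx_suml mulmx_sumr -sumrB; apply: eq_bigr => i _.
    rewrite /f (semi_D hPhi) -scaleN1r (semi_Z hPhi) rmorphN1 scaleN1r !(semi_M hPhi).
    by rewrite scalerBr -scalemxAl -scalemxAr.
  by apply/eqP; rewrite subr_eq0 /a /b; apply/eqP; apply: PhiP.
exists x => //.
have ha a q : x * pure a (refb q) = pure (refb q) a * x.
  rewrite (refb_decomp a) pure_suml pure_sumr mulr_sumr mulr_suml; apply: eq_bigr => p _.
  rewrite pureZl pureZr -scalerAr -scalerAl; congr (_ *: _).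
  by apply/eqP; rewrite -subr_eq0; apply/eqP/(hx (p, q)).
move=> a b; rewrite (refb_decomp b) pure_suml pure_sumr mulr_sumr mulr_suml.
by apply: eq_bigr => p _; rewrite pureZl pureZr -scalerAr -scalerAl ha.
Qed.

End Goldman.

Section Exchange.
Context (k : fieldType) (A : falgType k).
Let T : falgType k := tens A A.
Variables (x : T) (hx : exchange x).

(** The flip of the two factors: tensors are coordinate matrices, so it is the transpose. *)
Let trT (z : T) : T := trmx (z : 'M_(dim A, dim A)).

Let trD u v : trT (u + v) = trT u + trT v. Proof. exact: linearD. Qed.
Let tr_pure a b : trT (pure a b) = pure b a.
Proof. by apply/matrixP => i j; rewrite mxE !pureE mulrC. Qed.

Lemma exchange_mul z : x * z = trT z * x.
Proof.
elim/tens_ind: z => [|u v IH IH'|a b]; last by rewrite tr_pure hx.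
  by rewrite mulr0 /trT trmx0 mul0r.
by rewrite mulrDr IH IH' trD mulrDl.
Qed.

Context (rho : k) (hrho : x * x = rho%:A) (rho0 : rho != 0).
Hypothesis two_neq0 : (2 : k) != 0.

Let mulIx u v : u * x = v * x -> u = v.
Proof.
move=> /(congr1 (fun w => w * x)); rewrite -!mulrA hrho -!scalerAr !mulr1.
exact: scalerI.
Qed.

(* Right multiplication by such a y would embed the symmetric tensors into the
   antisymmetric ones. *)
Lemma no_anticommuting (y : T) : injective (fun z : T => z * y) -> x * y <> - (y * x).
Proof.
move=> iy xy.
have anti z : trT z = z -> trT (z * y) = - (z * y).
  move=> sz; apply: mulIx; rewrite -exchange_mul mulrA exchange_mul sz.
  by rewrite -mulrA xy mulrN mulNr mulrA.
(* [g] maps into symmetric tensors with zero diagonal, and is injective on antisymmetric ones as 2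
   is invertible. After right multiplication by [y] it would be an injective, hence bijective,
   endomorphism of [Sym], which contains tensors with nonzero diagonal. *)
pose g (z : T) : T := (\matrix_(i, j) (if (i < j)%N then z i j else if (j < i)%N then z j i else 0)).
have gl : linear (fun z => g (z * y)).
  move=> c u v; rewrite mulrDl -scalerAl; apply/matrixP => i j; rewrite !mxE.
  by case: ltngtP => _ //; rewrite ?mulr0 ?addr0.
have sgl : linear (fun z => trT z - z).
  by move=> c u v; rewrite /trT linearP /= scalerBr opprD addrACA.
pose Sym := lker (lin_hom sgl).
have SymP z : (z \in Sym) = (trT z == z) by rewrite memv_ker lin_homE subr_eq0.
have gS : (lin_hom gl @: Sym <= Sym)%VS.
  apply/subvP => _ /memv_imgP[z _ ->]; rewrite SymP lin_homE; apply/eqP/matrixP => i j.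
  by rewrite !mxE; case: ltngtP.
have gi : (Sym :&: lker (lin_hom gl) = 0)%VS.
  apply/eqP; rewrite -subv0; apply/subvP => z; rewrite memv_cap SymP memv_ker lin_homE memv0.
  move=> /andP[/eqP sz /eqP gz]; have /matrixP az := anti z sz.
  suff zy0 : z * y = 0 by apply/eqP/iy; rewrite zy0 mul0r.
  apply/matrixP => i j; rewrite [RHS]mxE; have /matrixP/(_ i j) := gz; rewrite !mxE.
  have := az i j; rewrite !mxE; case: ltngtP => [_ _ //|_ e f|/ord_inj -> e _].
    by apply/eqP; rewrite -oppr_eq0 -e f.
  apply/eqP; move/eqP: e.
  by rewrite -addr_eq0 -mulr2n -mulr_natl mulf_eq0 (negbTE two_neq0).
have /eqP SE : (lin_hom gl @: Sym == Sym)%VS by rewrite eqEdim gS /= limg_dim_eq ?gi.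
have nA : (0 < dim A)%N.
  rewrite lt0n; apply/eqP => d0; have := oner_neq0 A; rewrite (refb_decomp 1) big1 ?eqxx // => i _.
  by case: i => i li; exfalso; rewrite d0 in li.
pose o := Ordinal nA.
have : (pure (refb o) (refb o) : T) \in Sym by rewrite SymP tr_pure.
rewrite -SE => /memv_imgP[z _]; rewrite lin_homE => /matrixP/(_ o o).
rewrite pureE !refb_coord eqxx mulr1 mxE ltnn => /eqP.
by rewrite oner_eq0.
Qed.

(** If rho is not a square, [quad rho] is simple and acts on [T] on the right through [x] and also
    through [-x]. The two structures are isomorphic by dimension, and the isomorphism is right
    multiplication by an element anticommuting with [x]. *)
Lemma exchange_square : is_central_simple A -> exists r : k, r ^+ 2 = rho.
Proof.
move=> csA; apply: contrapT => nr.
have simK : simple_alg (quad rho).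
  by apply: quad_simple => r; apply/eqP => e; apply: nr; exists r.
have hrho' : - x * - x = rho%:A by rewrite mulrNN.
have ab G (hG : G * G = rho%:A :> T) (t : T) z v :
    act_regl T t (act_quad hG z v) = act_quad hG z (act_regl T t v).
  by rewrite /= mulrDr -!scalerAr mulrA.
have [h [[hl [h' hK _] hM] [_ _ hx']]] := @commuting_actions_iso k T (quad rho) T T
  (act_regl T) (act_quad hrho) (act_regl T) (act_quad hrho')
  (tens_central_simple csA csA) simK (ab _ hrho) (ab _ hrho') erefl.
have hE v : h v = v * h 1 by rewrite -{1}[v]mulr1; apply: hM.
apply: (@no_anticommuting (h 1)).
  by move=> u v /=; rewrite -!hE => /(can_inj hK).
have := hx' (mk_quad rho 0 1) 1; rewrite /= re_mk im_mk !scale0r !add0r !scale1r mul1r hE.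
by move=> ->; rewrite mulrN.
Qed.

End Exchange.

(** Off the diagonal the products [X i j * X j i] cancel in pairs, and squaring is additive when 2 =
    0. *)
Lemma mxtrace_sqr (R : comPzRingType) n (X : 'M[R]_n) : (2 : R) = 0 ->
  \tr (X *m X) = \tr X ^+ 2.
Proof.
move=> two0; have dbl (y : R) : y + y = 0 by rewrite -mulr2n -mulr_natl two0 mul0r.
have sumsq (F : 'I_n -> R) : \sum_i F i ^+ 2 = (\sum_i F i) ^+ 2.
  elim/big_ind2: _ => [|u u' v v' -> ->|//]; first by rewrite expr0n.
  by rewrite sqrrD mulr2n dbl addr0.
rewrite /mxtrace -sumsq; under eq_bigr => i _ do rewrite mxE (bigID (fun j : 'I_n => j == i)) /= big_pred1_eq.
rewrite big_split /= -[RHS]addr0; congr (_ + _).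
under eq_bigr => i _ do rewrite (bigID (fun j : 'I_n => (j < i)%N)) /=.
rewrite big_split /= [X in _ + X](_ : _ = \sum_i \sum_(j < n | (j != i) && (j < i)%N) X i j * X j i).
  exact: dbl.
rewrite (exchange_big_dep xpredT) //=; apply: eq_bigr => i _; apply: eq_big => j.
  by rewrite -leqNgt ltn_neqAle eq_sym andbA andbb.
by move=> _; rewrite mulrC.
Qed.

Section SwapInImage.
Context (k L : fieldType) (iota : {rmorphism k -> L}) (A : falgType k).
Context (csA : is_central_simple A) (m : nat) (phi : A -> 'M[L]_m.+1).
Hypotheses (hphi : semi_hom iota phi) (dA : dim A = (m.+1 ^ 2)%N).

Let Phi : tens A A -> 'M[L]_(m.+1 * m.+1) := semi_tens iota phi phi.
Let hPhi : semi_hom iota Phi := semi_tens_hom hphi hphi.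
Let csT : is_central_simple (tens A A) := tens_central_simple csA csA.
Let dA' : dim A = (m.+1 * m.+1)%N. Proof. by rewrite dA expnS expn1. Qed.
Let dT : dim (tens A A) = ((m.+1 * m.+1) * (m.+1 * m.+1))%N.
Proof. by transitivity (dim A * dim A)%N => //; rewrite dA'. Qed.

Let PhiP a b : swap_mx L m.+1 *m Phi (pure a b) = Phi (pure b a) *m swap_mx L m.+1.
Proof. by rewrite /Phi !(semi_tens_pure hphi hphi); exact: swap_mx_tens. Qed.

(** [x] and the swap exchange the factors in the same way, so their product commutes with the image
    of [Phi] and is a scalar. *)
Lemma exchange_scale (x : tens A A) : exchange x ->
  exists c, Phi x = c *: swap_mx L m.+1.
Proof.
move=> hx; have [z|c hc] := semi_comm_scalar csT hPhi isT dT (X := Phi x *m swap_mx L m.+1).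
  elim/tens_ind: z => [|u v IH IH'|a b]; first by rewrite (semi_0 hPhi) mulmx0 mul0mx.
    by rewrite (semi_D hPhi) mulmxDr IH IH' mulmxDl.
  by rewrite -mulmxA PhiP mulmxA -(semi_M hPhi) hx (semi_M hPhi) mulmxA.
exists c; rewrite -mul_scalar_mx -hc -mulmxA.
have -> : swap_mx L m.+1 *m swap_mx L m.+1 = 1%:M by exact: swap_mxK.
by rewrite mulmx1.
Qed.

(* Sandwiching a between the two legs of the swap yields its trace. *)
Lemma exchange_trace (x : tens A A) c (a : A) : Phi x = c *: swap_mx L m.+1 ->
  exists t : k, iota t = c * \tr (phi a).
Proof.
move=> hx; pose z : A := \sum_p \sum_q x p q *: (refb p * a * refb q).
have hz : phi z = (c * \tr (phi a))%:M.
  apply/matrixP => i j; transitivity (\sum_b \sum_d phi a b d *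
      Phi x (mxtens_index (i, d)) (mxtens_index (b, j))).
    rewrite (semi_sum hphi) summxE; under eq_bigr => p _ do rewrite (semi_sum hphi) summxE.
    have E b d : phi a b d * Phi x (mxtens_index (i, d)) (mxtens_index (b, j)) =
        \sum_p \sum_q iota (x p q) * (phi (refb p) i b * phi a b d * phi (refb q) d j).
      rewrite summxE mulr_sumr; apply: eq_bigr => p _; rewrite summxE mulr_sumr.
      apply: eq_bigr => q _; rewrite mxE tensmxE mulrCA; congr (_ * _).
      by rewrite mulrCA mulrA.
    under [RHS]eq_bigr => b _ do (under eq_bigr => d _ do rewrite E; rewrite exchange_big /=).
    rewrite [RHS]exchange_big /=; apply: eq_bigr => p _.
    under [RHS]eq_bigr => b _ do rewrite exchange_big /=.
    rewrite [RHS]exchange_big /=; apply: eq_bigr => q _.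
    rewrite (semi_Z hphi) !(semi_M hphi) !mxE mulr_sumr exchange_big /=; apply: eq_bigr => d _.
    by rewrite mxE mulr_suml mulr_sumr.
  transitivity (\sum_b phi a b b * (c * (i == j)%:R)).
    apply: eq_bigr => b _; rewrite hx (bigD1 b) //= big1 ?addr0 => [|d db].
      by rewrite mxE swap_mxE eqxx andbT.
    by rewrite mxE swap_mxE (negbTE db) andbF !mulr0.
  rewrite mxE -mulr_suml; case: eqP => _; rewrite ?mulr1 ?mulr0 //.
  by rewrite mulrC.
have [t zt] : exists t, z = t%:A.
  case: csA => cA _; apply: central_scalar => // y.
  apply: (semi_inj csA hphi isT); rewrite !(semi_M hphi) hz.
  by rewrite scalar_mxC.
exists t; have := congr1 (fun M : 'M_m.+1 => M 0 0) hz.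
by rewrite zt (semi_Z hphi) (semi_1 hphi) !mxE eqxx mulr1.
Qed.

(** With [Phi x = c *: swap_mx L m.+1], only [c] has to be shown to come from k; its square rho
    does. If 2 is invertible, rho has a root r in k and c is r or -r. In characteristic 2, c = t^2 /
    s with t = c tr(a) and s = c tr(a^2) = c tr(a)^2, where [a] has nonzero trace. *)
Theorem swap_in_image : exists P : tens A A, Phi P = swap_mx L m.+1.
Proof.
have [x nx hx] := exchange_exists csA hphi dA.
have [c hc] := exchange_scale hx.
have nc : c != 0.
  apply: contraNneq nx => c0; apply/eqP; apply: (semi_inj csT hPhi isT).
  by rewrite (semi_0 hPhi) hc c0 scale0r.
suff [r hr] : exists r, iota r = c.
  exists (r^-1 *: x); rewrite (semi_Z hPhi) hc scalerA fmorphV hr mulVf // scale1r.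
  by [].
have [rho hrho] : exists rho, x * x = rho%:A.
  case: csT => cT _; apply: central_scalar => // y.
  elim/tens_ind: y => [|u v IH IH'|a b]; first by rewrite mulr0 mul0r.
    by rewrite mulrDl mulrDr IH IH'.
  apply: (etrans (esym (mulrA x x (pure a b)))).
  apply: (etrans (congr1 (fun z => x * z) (hx a b))); apply: (etrans (mulrA _ _ _)).
  by apply: (etrans (congr1 (fun z => z * x) (hx b a))); exact: (esym (mulrA _ _ _)).
have rhoc : iota rho = c ^+ 2.
  have := congr1 (fun z => Phi z (mxtens_index (0, 0)) (mxtens_index (0, 0))) hrho.
  rewrite (semi_M hPhi) (semi_Z hPhi) (semi_1 hPhi) hc -scalemxAl -scalemxAr.
  have -> : swap_mx L m.+1 *m swap_mx L m.+1 = 1%:M by exact: swap_mxK.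
  by rewrite !mxE eqxx !mulr1 => <-; rewrite expr2.
have rho0 : rho != 0 by rewrite -(fmorph_eq0 iota) rhoc sqrf_eq0.
have [two0|ntwo] := eqVneq (2 : k) 0; last first.
  have [r hr] := exchange_square hx hrho rho0 ntwo csA.
  have /eqP : iota r ^+ 2 = c ^+ 2 by rewrite -rmorphXn hr.
  rewrite eqf_sqr => /orP[/eqP <-|/eqP e]; first by exists r.
  by exists (- r); rewrite rmorphN e opprK.
have [a na] : exists a, \tr (phi a) != 0.
  apply: contrapT => h; have tr0 a : \tr (phi a) = 0.
    by apply/eqP; apply: contrapT => /negP ni; apply: h; exists a.
  have [s hs] := semi_span csA hphi isT dA' (delta_mx 0 0).
  have := congr1 mxtrace hs; rewrite raddf_sum big1 => [|i _]; last first.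
    by rewrite /= mxtraceZ tr0 mulr0.
  rewrite /mxtrace (bigD1 0) //= big1 ?addr0 => [|i /negbTE ni]; rewrite mxE ?eqxx ?ni //.
  by move/eqP; rewrite oner_eq0.
have [t ht] := exchange_trace a hc.
have [s hs] := exchange_trace (a * a) hc.
exists (t ^+ 2 / s); rewrite fmorph_div rmorphXn ht hs (semi_M hphi).
rewrite mxtrace_sqr; last by rewrite -(rmorph_nat iota) two0 rmorph0.
by rewrite exprMn expr2 -mulrA mulfK // mulf_neq0 // sqrf_eq0.
Qed.

End SwapInImage.

(** * Permutations of tensor factors and exterior powers *)

Lemma tens_pow_central_simple (k : fieldType) (A : falgType k) : is_central_simple A ->
  forall i, is_central_simple (tens_pow A i).
Proof.
move=> csA [|i]; first exact: dim1_central_simple.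
elim: i => [//|i IH]; exact: tens_central_simple csA IH.
Qed.

Section TensorPowerRep.
Context (k L : fieldType) (iota : {rmorphism k -> L}) (A : falgType k).
Context (m : nat) (phi : A -> 'M[L]_m.+1).
Hypotheses (hphi : semi_hom iota phi) (dA : dim A = (m.+1 ^ 2)%N).

(** Indexing by words through [ix] hides the nesting of [tens_pow]. The third clause describes the
    pure tensors with arbitrary factors, and is the only access to the factors used later. *)
Lemma tens_pow_rep i : exists (N : nat) (Psi : tens_pow A i.+1 -> 'M[L]_N)
    (ix : {ffun 'I_i.+1 -> 'I_m.+1} -> 'I_N),
  [/\ semi_hom iota Psi, bijective ix,
      forall a : 'I_i.+1 -> A, exists x, forall f g,
        Psi x (ix f) (ix g) = \prod_j phi (a j) (f j) (g j),
      N = (m.+1 ^ i.+1)%N & dim (tens_pow A i.+1) = (N * N)%N].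
Proof.
elim: i => [|i [N [Psi [ix [hP [ix' ixK ix'K] hpure hN dT]]]]].
  exists m.+1, phi, (fun f => f ord0); split=> //.
  - exists (fun i => [ffun _ => i]) => [f|j]; last by rewrite ffunE.
    by apply/ffunP => j; rewrite ffunE (ord1 j).
  - by move=> a; exists (a ord0) => f g; rewrite big_ord1.
exists (m.+1 * N)%N, (semi_tens iota phi Psi),
  (fun f => mxtens_index (f ord0, ix [ffun j => f (lift ord0 j)])); split.
- exact: (semi_tens_hom hphi hP).
- exists (fun y => let: (a, z) := mxtens_unindex y in
    [ffun j => if unlift ord0 j is Some j' then ix' z j' else a]) => [f|y].
    rewrite mxtens_indexK ixK; apply/ffunP => j; rewrite ffunE.
    by case: unliftP => [j' ->|->] //; rewrite ffunE.
  case: (mxtens_indexP y) => a z; rewrite mxtens_indexK !ffunE unlift_none; congr (mxtens_index (_, _)).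
  rewrite -[RHS]ix'K; congr ix; apply/ffunP => j; rewrite ffunE ffunE liftK.
  by [].
- move=> a; have [x hx] := hpure (fun j => a (lift ord0 j)).
  exists (pure (a ord0) x) => f g; rewrite (semi_tens_pure hphi hP) tensmxE hx [RHS]big_ord_recl.
  by congr (_ * _); apply: eq_bigr => j _; rewrite !ffunE.
- by rewrite hN -expnS.
- have -> : dim (tens_pow A i.+2) = (dim A * dim (tens_pow A i.+1))%N by [].
  by rewrite dT dA; lia.
Qed.

End TensorPowerRep.

Section Permutations.
Context (k L : fieldType) (iota : {rmorphism k -> L}) (A T : falgType k).
Context (m n N : nat) (phi : A -> 'M[L]_m.+1) (Psi : T -> 'M[L]_N).
Hypotheses (hphi : semi_hom iota phi) (hP : semi_hom iota Psi).
Context (ix : {ffun 'I_n -> 'I_m.+1} -> 'I_N) (ix' : 'I_N -> {ffun 'I_n -> 'I_m.+1}).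
Hypotheses (ixK : cancel ix ix') (ix'K : cancel ix' ix).
Hypothesis hpure : forall a : 'I_n -> A, exists x, forall f g,
  Psi x (ix f) (ix g) = \prod_j phi (a j) (f j) (g j).

Definition place_mx (s : {perm 'I_n}) : 'M[L]_N :=
  \matrix_(x, y) \prod_a (ix' x a == ix' y (s a))%:R.

Lemma place_mxE s x y : place_mx s x y = (ix' x == [ffun a => ix' y (s a)])%:R.
Proof.
rewrite mxE; case: eqP => [->|ne].
  by rewrite big1 // => a _; rewrite ffunE eqxx.
have [a na] : exists a, ix' x a != ix' y (s a).
  apply: contrapT => h; apply: ne; apply/ffunP => a; rewrite ffunE.
  by apply/eqP; apply: contrapT => /negP na; apply: h; exists a.
by rewrite (bigD1 a) //= (negbTE na) mul0r.
Qed.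

Lemma place_mx1 : place_mx 1 = 1%:M.
Proof.
apply/matrixP => x y; rewrite place_mxE mxE -(can_eq ix'K); congr (_ == _)%:R.
by apply/ffunP => a; rewrite ffunE perm1.
Qed.

Lemma place_mxM s t : place_mx (s * t) = place_mx s *m place_mx t.
Proof.
apply/matrixP => x y; rewrite place_mxE mxE (bigD1 (ix [ffun a => ix' y (t a)])) //=.
rewrite !place_mxE ixK eqxx mulr1 big1 ?addr0 => [|z nz].
  by congr (_ == _)%:R; apply/ffunP => a; rewrite !ffunE permM.
rewrite [X in _ * X]place_mxE (_ : _ == _ = false) ?mulr0 //.
by apply: contraNF nz => /eqP <-; rewrite ix'K.
Qed.

Context (P : tens A A) (hPhi : semi_tens iota phi phi P = swap_mx L m.+1).

(** The preimage [P] of the swap is put into the factors [a] and [b], with 1 in all the others; the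
    two factors need not be adjacent. *)
Lemma place_tperm_image (a b : 'I_n) : a != b -> exists x, Psi x = place_mx (tperm a b).
Proof.
move=> nab; pose w p q j : A := if j == a then refb p else if j == b then refb q else 1.
have [xx hx] := choice (fun pq => hpure (w pq.1 pq.2)).
exists (\sum_p \sum_q P p q *: xx (p, q)).
apply/matrixP => x y; rewrite -[x]ix'K -[y]ix'K; set f := ix' x; set g := ix' y.
transitivity ((\sum_p \sum_q iota (P p q) * (phi (refb p) (f a) (g a) * phi (refb q) (f b) (g b))) *
    \prod_(j | (j != a) && (j != b)) (f j == g j)%:R).
  rewrite (semi_sum hP) summxE mulr_suml; apply: eq_bigr => p _.
  rewrite (semi_sum hP) summxE mulr_suml; apply: eq_bigr => q _.
  rewrite (semi_Z hP) mxE hx /= -mulrA; congr (_ * _).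
  rewrite (bigD1 a) //= (bigD1 b) /=; last by rewrite eq_sym.
  rewrite /w eqxx eq_sym (negbTE nab) eqxx mulrA; congr (_ * _).
  by apply: eq_bigr => j /andP[/negbTE -> /negbTE ->]; rewrite (semi_1 hphi) mxE.
rewrite [X in X * _](_ : _ = swap_mx L m.+1 (mxtens_index (f a, f b)) (mxtens_index (g a, g b))); last first.
  rewrite -hPhi summxE; apply: eq_bigr => p _; rewrite summxE; apply: eq_bigr => q _.
  by rewrite mxE tensmxE.
transitivity (((f a == g b) && (f b == g a))%:R *
    \prod_(j | (j != a) && (j != b)) (f j == g j)%:R : L).
  by congr (_ * _); exact: swap_mxE.
rewrite [RHS]mxE [RHS](bigD1 a) //= [X in _ = _ * X](bigD1 b) /=; last by rewrite eq_sym.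
rewrite !ixK tpermL tpermR mulrA -natrM mulnb; congr (_ * _).
by apply: eq_bigr => j /andP[ja jb]; rewrite tpermD // eq_sym.
Qed.

Lemma place_image (s : {perm 'I_n}) : exists x, Psi x = place_mx s.
Proof.
have [ts -> /allP ht] := prod_tpermP s.
elim: ts ht => [|[a b] ts IH] ht.
  by exists 1; rewrite big_nil place_mx1 (semi_1 hP).
have [|x hx] := IH; first by move=> t tt; apply: ht; rewrite inE tt orbT.
have [y hy] := place_tperm_image (ht (a, b) (mem_head _ _)).
by exists (y * x); rewrite big_cons place_mxM (semi_M hP) hx hy.
Qed.

(** The antisymmetriser, that is the signed sum of the [place_mx s], by the Leibniz formula. It is
    not divided by n!, so it makes sense and has the same rank in every characteristic. *)
Definition alt_mx : 'M[L]_N :=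
  \matrix_(x, y) \det (\matrix_(a, b) (ix' x a == ix' y b)%:R : 'M[L]_n).

Lemma alt_image : exists x, Psi x = alt_mx.
Proof.
have [w hw] := choice place_image.
exists (\sum_(s : {perm 'I_n}) (-1) ^+ s *: w s).
apply/matrixP => x y; rewrite (semi_sum hP) summxE mxE; apply: eq_bigr => s _.
rewrite (semi_Z hP) hw !mxE rmorphXn rmorphN1; congr (_ * _).
by apply: eq_bigr => a _; rewrite mxE.
Qed.

End Permutations.

Lemma det_row0 (R : comPzRingType) n (M : 'M[R]_n) a : (forall b, M a b = 0) -> \det M = 0.
Proof.
move=> h; rewrite (expand_det_row _ a) big1 // => b _.
by rewrite h mul0r.
Qed.

Section Alternating.
Context (L : fieldType) (d n : nat).

Definition draws : {set {set 'I_d}} := [set U : {set 'I_d} | #|U| == n].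

Lemma draw_card (i : 'I_#|draws|) : #|(enum_val i : {set 'I_d})| = n.
Proof. by have := enum_valP i; rewrite inE => /eqP. Qed.

(** A listing of the i-th subset, which indexes a basis vector of the exterior power; another order
    would only change its sign. *)
Definition draw (i : 'I_#|draws|) : {ffun 'I_n -> 'I_d} :=
  [ffun j => enum_val (cast_ord (esym (draw_card i)) j)].

Lemma draw_inj i : injective (draw i).
Proof. by move=> a b; rewrite !ffunE => /enum_val_inj/cast_ord_inj. Qed.

Lemma draw_mem i x : reflect (exists a, x = draw i a) (x \in (enum_val i : {set 'I_d})).
Proof.
apply: (iffP idP) => [xU|[a ->]]; last by rewrite ffunE enum_valP.
exists (cast_ord (draw_card i) (enum_rank_in xU x)).
by rewrite ffunE cast_ordK enum_rankK_in.
Qed.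

Lemma draw_surj (f : {ffun 'I_n -> 'I_d}) : injective f ->
  exists i, forall a, exists c, f a = draw i c.
Proof.
move=> fi; have fU : f @: setT \in draws by rewrite inE card_imset // cardsT card_ord.
exists (enum_rank_in fU (f @: setT)) => a; apply/draw_mem.
by rewrite enum_rankK_in // imset_f.
Qed.

Definition eq_mx (f g : {ffun 'I_n -> 'I_d}) : 'M[L]_n := \matrix_(a, b) (f a == g b)%:R.

(* By the hypotheses f and draw i have the same range, so some f a is not in that
   of draw j. *)
Lemma det_eq_mx_draw0 (f : {ffun 'I_n -> 'I_d}) i j :
  injective f -> (forall a, exists c, f a = draw i c) ->
  i != j -> \det (eq_mx f (draw j)) = 0.
Proof.
move=> fi fU nij.
have [a na] : exists a, f a \notin (enum_val j : {set 'I_d}).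
  apply: contrapT => h; case/eqP: nij; apply: enum_val_inj.
  have fV : f @: setT \subset (enum_val j : {set 'I_d}).
    apply/subsetP => _ /imsetP[a _ ->]; apply: contrapT => /negP na; apply: h.
    by exists a.
  have fU' : f @: setT \subset (enum_val i : {set 'I_d}).
    by apply/subsetP => _ /imsetP[a _ ->]; apply/draw_mem; apply: fU.
  have cf : #|f @: setT| = n by rewrite card_imset // cardsT card_ord.
  have eqU (l : 'I_#|draws|) : f @: setT \subset (enum_val l : {set 'I_d}) -> f @: setT = enum_val l.
    by move=> s; apply/eqP; rewrite eqEcard s cf draw_card /=.
  by rewrite -(eqU i fU') -(eqU j fV).
apply: (det_row0 (a := a)) => b; rewrite mxE.
case: eqP => // e; case/negP: na; apply/draw_mem; by exists b.
Qed.

Lemma det_eq_mx_draw i j : \det (eq_mx (draw i) (draw j)) = (i == j)%:R.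
Proof.
case: eqVneq => [->|nij]; last first.
  by apply: (@det_eq_mx_draw0 _ i) => //; [exact: draw_inj | move=> a; exists a].
rewrite (_ : eq_mx _ _ = 1%:M) ?det1 //; apply/matrixP => a b.
by rewrite !mxE (inj_eq (@draw_inj j)).
Qed.

(* A Cauchy-Binet formula: at most one summand is nonzero. *)
Lemma det_eq_mx (f g : {ffun 'I_n -> 'I_d}) :
  \det (eq_mx f g) = \sum_i \det (eq_mx f (draw i)) * \det (eq_mx (draw i) g).
Proof.
have [fi|/injectivePn[a [b nab fab]]] := altP (injectiveP f); last first.
  have z h : \det (eq_mx f h) = 0.
    by apply: (determinant_alternate nab) => c; rewrite !mxE fab.
  by rewrite z big1 // => i _; rewrite z mul0r.
have [i hi] := draw_surj fi.
rewrite (bigD1 i) //= big1 ?addr0 => [|j nji]; last first.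
  by rewrite (det_eq_mx_draw0 fi hi) ?mul0r // eq_sym.
rewrite -det_mulmx; congr (\det _); apply/matrixP => a b; rewrite !mxE.
have [c hc] := hi a; rewrite (bigD1 c) //= !mxE hc eqxx mul1r big1 ?addr0 // => c' nc.
by rewrite !mxE hc (inj_eq (@draw_inj i)) eq_sym (negbTE nc) mul0r.
Qed.

Context (N : nat) (ix : {ffun 'I_n -> 'I_d} -> 'I_N) (ix' : 'I_N -> {ffun 'I_n -> 'I_d}).
Hypotheses (ixK : cancel ix ix') (ix'K : cancel ix' ix).

(** The antisymmetriser factors through the exterior power, and its restriction to the words
    [draw i] is the identity matrix. The one-sided inverses express that the factors have full rank,
    in the form that [dim_principal] uses. *)
Lemma alt_factor : exists (C : 'M[L]_(N, 'C(d, n))) (D : 'M[L]_('C(d, n), N)) B B',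
  [/\ \matrix_(x, y) \det (eq_mx (ix' x) (ix' y)) = C *m D, D *m B = 1%:M & B' *m C = 1%:M].
Proof.
have <- : #|draws| = 'C(d, n) by rewrite card_draws card_ord.
pose X : 'M[L]_(N, #|draws|) := \matrix_(x, i) (x == ix (draw i))%:R.
exists (\matrix_(x, i) \det (eq_mx (ix' x) (draw i))).
exists (\matrix_(i, y) \det (eq_mx (draw i) (ix' y))), X, X^T.
split; apply/matrixP => i j; rewrite !mxE.
- by rewrite det_eq_mx; apply: eq_bigr => l _; rewrite !mxE.
- rewrite (bigD1 (ix (draw j))) //= !mxE eqxx mulr1 ixK det_eq_mx_draw big1 ?addr0 // => x nx.
  by rewrite !mxE (negbTE nx) mulr0.
- rewrite (bigD1 (ix (draw i))) //= !mxE eqxx mul1r ixK det_eq_mx_draw big1 ?addr0 // => x nx.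
  by rewrite !mxE (negbTE nx) mul0r.
Qed.

End Alternating.

Section RightIdeal.
Context (k : fieldType) (T : falgType k) (s : T).

Let sl : linear (fun x : T => s * x).
Proof. by move=> c x y; rewrite mulrDr -scalerAr. Qed.

Definition principal_ideal : {vspace T} := limg (lin_hom sl).

Let mulI (x r : T) : x \in principal_ideal -> x * r \in principal_ideal.
Proof.
move=> /memv_imgP[y _ ->]; rewrite lin_homE -mulrA; apply/memv_imgP.
by exists (y * r); rewrite ?memvf ?lin_homE.
Qed.

Program Definition act_principal : action (opp_alg T) (subvs_of principal_ideal) :=
  @Action k (opp_alg T) (subvs_of principal_ideal)
    (fun r x => vsproj principal_ideal (vsval x * (r : T))) _ _ _ _.
Next Obligation.
move=> x c r r'; rewrite -linearP /=; congr (vsproj _ _).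
by rewrite mulrDr -scalerAr.
Qed.
Next Obligation.
move=> r c x y; rewrite -linearP /=; congr (vsproj _ _).
by rewrite mulrDl -scalerAl.
Qed.
Next Obligation. by move=> x; rewrite /= [_ * _]mulr1 vsvalK. Qed.
Next Obligation.
move=> r r' x; apply: val_inj; rewrite /= !vsprojK ?mulI ?subvsP //.
by rewrite opp_mulE mulrA.
Qed.

(* The rank is computed in the basis given by Psi. *)
Lemma dim_principal (L : fieldType) (iota : {rmorphism k -> L}) N (Psi : T -> 'M[L]_N) r
    (C : 'M[L]_(N, r)) (D : 'M[L]_(r, N)) B B' :
  is_central_simple T -> (0 < N)%N -> semi_hom iota Psi -> dim T = (N * N)%N ->
  Psi s = C *m D -> D *m B = 1%:M -> B' *m C = 1%:M ->
  \dim principal_ideal = (r * N)%N.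
Proof.
move=> csT N0 hP dT PCD DB BC.
pose M := f2mx (lin_hom sl).
have rowM i : row i M = v2r (s * refb i).
  by rewrite -(lin_homE sl) /fun_of_lfun locked_withE /fun_of_lfun_def /= !r2vK rowE.
have -> : \dim principal_ideal = \rank M.
  rewrite /principal_ideal unlock /dimv /lfun_img_def mx2vsK.
  by rewrite (eqmxMr M (mx2vsK 1%:M)) mul1mx.
pose Q := semi_mx Psi.
have Qfree : row_free Q := semi_mx_free hP csT N0.
have Qfull : row_full Q by have /eqP r0 := Qfree; apply/eqP; apply: etrans r0 _.
have lM p q t (X : 'M[L]_(p, q)) (Y : 'M_(q, t)) :
    lin_mulmx Y *m lin_mulmx X = lin_mulmx (X *m Y) :> 'M_(t * N, p * N).
  apply/row_matrixP => i; rewrite !rowE mulmxA -[delta_mx 0 i]vec_mxK !mul_vec_lin /=.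
  by rewrite mulmxA.
have l1 p : lin_mulmx 1%:M = 1%:M :> 'M[L]_(p * N).
  apply/row_matrixP => i; rewrite !rowE -[delta_mx 0 i]vec_mxK mul_vec_lin /=.
  by rewrite mul1mx mulmx1.
(* Over L, multiplication by [s] becomes multiplication by [C *m D] on N x N matrices; it factors
   through the r x N matrices by two maps of full rank. *)
have E : map_mx iota M *m Q = Q *m lin_mulmx (Psi s).
  apply/row_matrixP => i; rewrite !row_mul -map_row rowM rowK mul_vec_lin /=.
  rewrite semi_mxE -(semi_M hP); congr mxvec; rewrite [in RHS](refb_decomp (s * refb i)).
  by rewrite (semi_sum hP); apply: eq_bigr => j _; rewrite (semi_Z hP) mxE.
rewrite -(mxrank_map iota) -(mxrankMfree _ Qfree) E (eqmxMfull _ Qfull) PCD -lM.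
have Cfree : row_free (lin_mulmx C : 'M_(r * N, N * N)).
  by apply/row_freeP; exists (lin_mulmx B'); rewrite lM BC l1.
rewrite (mxrankMfree _ Cfree); apply/eqP.
have : row_full (lin_mulmx D : 'M_(N * N, r * N)).
  by apply/row_fullP; exists (lin_mulmx B); rewrite lM DB l1.
by [].
Qed.

End RightIdeal.

(** * Trivial Brauer classes and modules *)

Section AlgIso.
Context (k : fieldType).
Implicit Types A B C : falgType k.

Lemma alg_isoP A B : alg_iso A B <-> exists2 f : A -> B, alg_hom f & bijective f.
Proof.
split=> [[f fb]|[f [fl f1 fM] fb]].
  by exists f => //; split; [exact: linearP | exact: rmorph1 | exact: rmorphM].
pose lin := GRing.isLinear.Build k A B _ f fl.
pose mon := GRing.isMonoidMorphism.Build A B f (conj f1 fM).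
pose F : {lrmorphism A -> B} := HB.pack f lin mon.
by exists F.
Qed.

Lemma alg_iso_trans A B C : alg_iso A B -> alg_iso B C -> alg_iso A C.
Proof.
move=> /alg_isoP[f [fl f1 fM] fb] /alg_isoP[g [gl g1 gM] gb]; apply/alg_isoP.
exists (g \o f); last exact: bij_comp.
by split=> [c x y||x y] /=; rewrite ?fl ?gl ?f1 ?fM.
Qed.

Lemma alg_iso_sym A B : alg_iso A B -> alg_iso B A.
Proof.
move=> /alg_isoP[f [fl f1 fM] [g fg gf]]; apply/alg_isoP; exists g; last by exists f.
have fi := can_inj fg.
by split=> [c x y||x y]; apply: fi; rewrite ?fl ?fM ?f1 !gf.
Qed.

Lemma alg_hom_iso A B (f : A -> B) : simple_alg A -> alg_hom f -> dim A = dim B ->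
  alg_iso A B.
Proof.
move=> simA hf dAB; apply/alg_isoP; exists f => //.
by case: (hf) => fl _ _; apply: linear_inj_bij => //; apply: alg_hom_inj hf.
Qed.

End AlgIso.

Lemma linear_bij_dim (k : fieldType) (U V : vectType k) (f : U -> V) :
  linear f -> bijective f -> dim U = dim V.
Proof.
move=> fl fb; have [g fg gf] := fb.
have [kf lf] : lker (lin_hom fl) == 0%VS /\ limg (lin_hom fl) = fullv.
  split; first by apply/lker0P => x y; rewrite !lin_homE => /(can_inj fg).
  apply/vspaceP => v; rewrite memvf; apply/memv_imgP.
  by exists (g v); rewrite ?memvf // lin_homE gf.
have := limg_dim_eq (f := lin_hom fl) (U := fullv).
by rewrite lf (eqP kf) capv0 => /(_ erefl); rewrite !dimvf => ->.
Qed.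

Section Torsion.
Context (k : fieldType) (T : falgType k).

Lemma tens_mx1_iso : simple_alg T -> alg_iso T (tens T 'M[k]_1).
Proof.
move=> simT; apply: (@alg_hom_iso _ _ _ (fun x => pure x 1)) => //; last first.
  by transitivity (dim T * (1 * 1))%N => //; rewrite !muln1.
split=> [c x y|//|x y]; first by rewrite pureDl pureZl.
by rewrite pure_mul mulr1.
Qed.

Lemma base_mx_iso N : simple_alg ('M[k]_N.+1 : falgType k) ->
  alg_iso ('M[k]_N.+1 : falgType k) (tens (k^o : falgType k) 'M[k]_N.+1).
Proof.
move=> simM; apply: (@alg_hom_iso _ _ _ (fun x => pure 1 x)) => //.
  split=> [c x y|//|x y]; first by rewrite pureDr pureZr.
  by rewrite pure_mul mulr1.
by transitivity (1 * (N.+1 * N.+1))%N => //; rewrite mul1n.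
Qed.

Lemma brauer_equiv_of_module (X : vectType k) N : simple_alg T -> action (opp_alg T) X ->
  dim X = N.+1 -> dim T = (N.+1 * N.+1)%N -> brauer_equiv T (k^o : falgType k).
Proof.
move=> simT a dX dT; exists 0%N, N.
have [f [g [fl gl fg gf]]] := vect_col_iso dX.
(* The transpose makes a homomorphism out of a right action. *)
pose rho (t : T) : 'M[k]_N.+1 := (lin_cmx (fun v => f (a t (g v))))^T.
have rl t : linear (fun v => f (a t (g v))).
  by move=> c u v; rewrite gl (act_linearr a) fl.
have rE t v : (rho t)^T *m v = f (a t (g v)) by rewrite trmxK lin_cmxE.
have hrho : alg_hom rho.
  split=> [c x y||x y]; apply: trmx_inj; apply: mulmx_inj => v.
  - rewrite rE linearP /= mulmxDl -scalemxAl !rE -fl.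
    by congr f; apply: (act_linearl a).
  - by rewrite rE trmx1 mul1mx act_1 gf.
  - by rewrite rE trmx_mul -mulmxA !rE fg -act_M.
have csM := matrix_central_simple k N.
apply: (alg_iso_trans (alg_iso_sym (tens_mx1_iso simT))).
apply: (alg_iso_trans (B := ('M[k]_N.+1 : falgType k))); last by apply: base_mx_iso; case: csM.
exact: (alg_hom_iso simT hrho).
Qed.

Program Definition act_pull (S R : falgType k) (X : vectType k) (f : S -> R) (hf : alg_hom f)
    (a : action (opp_alg R) X) : action (opp_alg S) X :=
  @Action k (opp_alg S) X (fun s => a (f s)) _ _ _ _.
Next Obligation.
move=> S R X f [fl _ _] a v c r s; have -> := fl c r s; exact: (act_linearl a).
Qed.
Next Obligation. by move=> S R X f hf a r; apply: (act_linearr a). Qed.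
Next Obligation. by move=> S R X f [_ f1 _] a v; rewrite /= [f _]f1 act_1. Qed.
Next Obligation.
move=> S R X f [_ _ fM] a r s v; rewrite /= -act_M; congr (a _ v).
exact: fM.
Qed.

(* Morita invariance: V is the direct sum of n.+1 copies of V.e_00. *)
Lemma module_corner (V : vectType k) n (a : action (opp_alg T) V)
    (b : action (opp_alg ('M[k]_n.+1 : falgType k)) V) :
  (forall x y v, a x (b y v) = b y (a x v)) ->
  exists (X : vectType k) (a' : action (opp_alg T) X), dim V = (n.+1 * dim X)%N.
Proof.
move=> ab; pose e i j : 'M[k]_n.+1 := delta_mx i j.
have bM i j l v : b (e j l) (b (e i j) v) = b (e i l) v.
  rewrite -act_M; congr (b _ v).
  have -> : (e j l : opp_alg ('M[k]_n.+1 : falgType k)) * e i j = (e i j *m e j l) by exact: opp_mulE.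
  by rewrite mul_delta_mx.
have b0 i j j' l v : j != j' -> b (e j' l) (b (e i j) v) = 0.
  move=> nj; rewrite -act_M.
  have -> : (e j' l : opp_alg ('M[k]_n.+1 : falgType k)) * e i j = (e i j *m e j' l) by exact: opp_mulE.
  by rewrite mul_delta_mx_0 // (lin0 (act_linearl b v)).
have bl y := act_linearr b y.
pose U := limg (lin_hom (bl (e 0 0))).
have UP v : v \in U -> b (e 0 0) v = v.
  by move=> /memv_imgP[w _ ->]; rewrite lin_homE bM.
have bU i v : b (e i 0) v \in U.
  apply/memv_imgP; exists (b (e i 0) v); rewrite ?memvf // lin_homE bM.
  by [].
have aU x v : v \in U -> a x v \in U.
  by move=> /UP vE; rewrite -vE ab bU.
pose f (x : {ffun 'I_n.+1 -> subvs_of U}) : V := \sum_i b (e 0 i) (vsval (x i)).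
pose g (v : V) : {ffun 'I_n.+1 -> subvs_of U} := [ffun i => vsproj U (b (e i 0) v)].
have fl : linear f.
  move=> c x y; rewrite scaler_sumr -big_split /=; apply: eq_bigr => i _.
  by rewrite !ffunE linearP bl.
have gl : linear g.
  by move=> c x y; apply/ffunP => i; rewrite !ffunE bl linearP.
have fg : cancel f g.
  move=> x; apply/ffunP => i; apply: val_inj; rewrite ffunE /= vsprojK ?bU //.
  rewrite (lin_sum (bl _)) (bigD1 i) //= bM UP ?subvsP // big1 ?addr0 // => j ji.
  by rewrite b0.
have gf : cancel g f.
  move=> v; rewrite -[RHS](act_1 b) /f.
  have -> : (1 : opp_alg ('M[k]_n.+1 : falgType k)) = \sum_i e i i by exact: mx1_sum_delta.
  rewrite (lin_sum (act_linearl b v)); apply: eq_bigr => i _.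
  by rewrite ffunE vsprojK ?bU // bM.
have act : action (opp_alg T) (subvs_of U).
  refine (@Action k (opp_alg T) (subvs_of U) (fun x v => vsproj U (a x (vsval v))) _ _ _ _).
  - by move=> v c r s; rewrite -linearP (act_linearl a).
  - by move=> r c u v; rewrite -linearP; congr (vsproj U _); rewrite linearP; apply: act_linearr.
  - by move=> v; rewrite act_1 vsvalK.
  - move=> r s v; rewrite vsprojK ?aU ?subvsP // act_M.
    by [].
exists (subvs_of U), act.
rewrite -(linear_bij_dim fl); last by exists g.
by rewrite -[LHS]/(#|'I_n.+1| * _)%N card_ord.
Qed.

(** The row space of dimension n+1 is pulled back to T (x) M_(m+1)(k), and a corner [X] of it is
    kept. Comparing dimensions gives (N (m+1))^2 = (dim X (m+1))^2. *)
Lemma module_of_brauer_equiv N : brauer_equiv T (k^o : falgType k) -> dim T = (N * N)%N ->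
  exists (X : vectType k) (a : action (opp_alg T) X), dim X = N.
Proof.
move=> [m [n /alg_isoP[f [fl f1 fM] fb]]] dT.
have c0 (x : opp_alg (k^o : falgType k)) (y : opp_alg ('M[k]_n.+1 : falgType k)) v :
    act_scalar 'rV[k]_n.+1 x (act_row k n y v) = act_row k n y (act_scalar 'rV[k]_n.+1 x v).
  by rewrite /= scalemxAl.
pose c : action (opp_alg (tens (k^o : falgType k) 'M[k]_n.+1)) 'rV[k]_n.+1 :=
  act_tens_opp c0.
have h1 : alg_hom (fun t : T => f (pure t 1)).
  split=> [s x y||x y]; [by rewrite pureDl pureZl fl | by rewrite -f1 |].
  by rewrite -fM; congr f; rewrite -[RHS]/(_ * _) pure_mul mulr1.
have h2 : alg_hom (fun t : 'M[k]_m.+1 => f (pure 1 t)).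
  split=> [s x y||x y]; [by rewrite pureDr pureZr fl | by rewrite -f1 |].
  by rewrite -fM; congr f; rewrite -[RHS]/(_ * _) pure_mul mulr1.
have [|X [a dX]] := @module_corner 'rV[k]_n.+1 m (act_pull h1 c) (act_pull h2 c).
  move=> x y v; rewrite /= -[LHS](act_M c) -[RHS](act_M c); congr (c _ v).
  rewrite !opp_mulE -[LHS]fM -[RHS]fM; congr f.
  by rewrite -[LHS]/(pure _ _ * pure _ _) -[RHS]/(pure _ _ * pure _ _) !pure_mul !mulr1 !mul1r.
exists X, a.
have e : (N * N * (m.+1 * m.+1) = 1 * (n.+1 * n.+1))%N.
  by rewrite -dT; exact: (linear_bij_dim fl fb).
have {}dX : (n.+1 = m.+1 * dim X)%N by rewrite -dX /dim /= mul1n.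
have : ((N * m.+1) ^ 2 == (dim X * m.+1) ^ 2)%N.
  by apply/eqP; move: e; rewrite dX; lia.
by rewrite eqn_exp2r // eqn_pmul2r // => /eqP.
Qed.

End Torsion.

(** The module is the right ideal generated by a preimage of the antisymmetriser. *)
Lemma exterior_modules (k : fieldType) (A : falgType k) : is_central_simple A ->
  exists m : nat, dim A = (m.+1 ^ 2)%N /\ forall i,
    dim (tens_pow A i.+1) = (m.+1 ^ i.+1 * m.+1 ^ i.+1)%N /\
    exists (X : vectType k) (a : action (opp_alg (tens_pow A i.+1)) X),
      dim X = (m.+1 ^ i.+1 * 'C(m.+1, i.+1))%N.
Proof.
move=> csA; have [L [iota [m [phi [hphi dA]]]]] := splitting csA.
exists m; split=> // i.
have [P hSwap] := swap_in_image csA hphi dA.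
have [N [Psi [ix [hP [ix' ixK ix'K] hpure hN dT]]]] := tens_pow_rep hphi dA i.
rewrite -hN; split=> //.
have [s hs] := alt_image hphi hP ixK ix'K hpure hSwap.
have [C [D [B [B' [hCD hDB hBC]]]]] := alt_factor L ixK.
have N0 : (0 < N)%N by rewrite hN expn_gt0.
have hsCD : Psi s = C *m D by rewrite hs -hCD.
exists (subvs_of (principal_ideal s)), (act_principal s).
rewrite mulnC -(dim_principal (tens_pow_central_simple csA i.+1) N0 hP dT hsCD hDB hBC).
by [].
Qed.

Lemma tens_pow_modules (k : fieldType) (A : falgType k) : is_central_simple A ->
  exists d : nat, [/\ (0 < d)%N,
    forall n, dim (tens_pow A n) = (d ^ n * d ^ n)%N,
    forall i, (0 < i)%N -> exists (X : vectType k) (a : action (opp_alg (tens_pow A i)) X),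
      dim X = (d ^ i * 'C(d, i))%N,
    exists n, brauer_torsion A n &
    forall n, brauer_torsion A n -> exists (X : vectType k) (a : action (opp_alg (tens_pow A n)) X),
      dim X = (d ^ n)%N].
Proof.
move=> csA; have [m [dA hm]] := exterior_modules csA; exists m.+1.
have dT n : dim (tens_pow A n) = (m.+1 ^ n * m.+1 ^ n)%N.
  by case: n => [//|n]; case: (hm n).
split=> //.
- by case=> [//|i] _; case: (hm i).
(* The top exterior power, with C(d, d) = 1, has dimension d^d over an algebra of dimension d^(2d),
   which is thus a matrix algebra. *)
- exists m.+1; rewrite /brauer_torsion /=; apply/asboolP.
  have [_ [X [a dX]]] := hm m; rewrite binn muln1 in dX.
  have [N eN] : exists N, (m.+1 ^ m.+1 = N.+1)%N by exists (m.+1 ^ m.+1).-1; rewrite prednK // expn_gt0.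
  apply: (@brauer_equiv_of_module _ _ X N _ a); rewrite -?eN //.
  by case: (tens_pow_central_simple csA m.+1).
- move=> n /andP[_ /asboolP hn]; apply: module_of_brauer_equiv hn _.
  exact: dT.
Qed.

(** * Direct sums in an additive category *)

Section Biproducts.
Context (D : additive_category).
Implicit Types X Y Z : add_ob D.

Local Notation iso X Y := (@isomorphic D X Y).

Lemma oplus_ext X Y Z (f g : add_hom (oplus X Y) Z) :
  add_comp f (inj1 X Y) = add_comp g (inj1 X Y) ->
  add_comp f (inj2 X Y) = add_comp g (inj2 X Y) -> f = g.
Proof.
move=> e1 e2; rewrite -(add_compf1 f) -(add_compf1 g) -inj_pr !add_compDr.
by rewrite !add_compA e1 e2.
Qed.

Lemma copair_iso X Y Z (f : add_hom X Z) (g : add_hom Y Z) (h : add_hom Z (oplus X Y)) :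
  add_comp h f = inj1 X Y -> add_comp h g = inj2 X Y ->
  add_comp (copair f g) h = add_id Z -> iso (oplus X Y) Z.
Proof.
move=> e1 e2 e; exists (copair f g), h; split=> //=.
by apply: oplus_ext; rewrite add_comp1f -add_compA ?copair_inj1 ?copair_inj2.
Qed.

Lemma oplus_congr X X' Y Y' : iso X X' -> iso Y Y' -> iso (oplus X Y) (oplus X' Y').
Proof.
move=> [f [f' [/= ff' f'f]]] [g [g' [/= gg' g'g]]].
apply: (@copair_iso _ _ _ (add_comp (inj1 _ _) f) (add_comp (inj2 _ _) g)
  (copair (add_comp (inj1 _ _) f') (add_comp (inj2 _ _) g'))).
- by rewrite add_compA copair_inj1 -add_compA f'f add_compf1.
- by rewrite add_compA copair_inj2 -add_compA g'g add_compf1.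
apply: oplus_ext; rewrite -add_compA add_comp1f ?copair_inj1 ?copair_inj2 add_compA.
  by rewrite copair_inj1 -add_compA ff' add_compf1.
by rewrite copair_inj2 -add_compA gg' add_compf1.
Qed.

Lemma oplusC X Y : iso (oplus X Y) (oplus Y X).
Proof.
apply: (@copair_iso _ _ _ (inj2 _ _) (inj1 _ _) (copair (inj2 _ _) (inj1 _ _))).
- by rewrite copair_inj2.
- by rewrite copair_inj1.
by apply: oplus_ext; rewrite -add_compA add_comp1f ?copair_inj1 ?copair_inj2 ?copair_inj1.
Qed.

Lemma oplusA X Y Z : iso (oplus X (oplus Y Z)) (oplus (oplus X Y) Z).
Proof.
apply: (@copair_iso _ _ _ (add_comp (inj1 _ _) (inj1 _ _))
   (copair (add_comp (inj1 _ _) (inj2 _ _)) (inj2 _ _))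
   (copair (copair (inj1 _ _) (add_comp (inj2 _ _) (inj1 _ _)))
      (add_comp (inj2 _ _) (inj2 _ _)))).
- by rewrite add_compA !copair_inj1.
- by apply: oplus_ext; rewrite -!add_compA ?copair_inj1 ?copair_inj2 ?add_compA
    ?copair_inj1 ?copair_inj2.
apply: oplus_ext; rewrite -add_compA add_comp1f ?copair_inj1 ?copair_inj2; last first.
  by rewrite add_compA !copair_inj2.
by apply: oplus_ext; rewrite -!add_compA ?copair_inj1 ?copair_inj2 ?add_compA
    ?copair_inj1 ?copair_inj2 ?copair_inj1.
Qed.

Lemma oplus0 X : iso (oplus add_zero X) X.
Proof.
apply: (@copair_iso _ _ _ 0 (add_id X) (inj2 _ _)).
- by rewrite add_compf0 -[RHS]add_compf1 add_zeroP add_compf0.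
- by rewrite add_compf1.
by rewrite copair_inj2.
Qed.

(* The inverse of the matrix [[p, q], [r, s]] is [[s', - q'], [- r', p']]. *)
Lemma oplus_matrix X1 X2 Y1 Y2 (p : add_hom X1 Y1) (q : add_hom X2 Y1) (r : add_hom X1 Y2)
    (s : add_hom X2 Y2) (p' : add_hom Y2 X2) (q' : add_hom Y2 X1) (r' : add_hom Y1 X2)
    (s' : add_hom Y1 X1) :
  add_comp s' p - add_comp q' r = add_id X1 -> add_comp s' q = add_comp q' s ->
  add_comp p' r = add_comp r' p -> add_comp p' s - add_comp r' q = add_id X2 ->
  add_comp p s' - add_comp q r' = add_id Y1 -> add_comp p q' = add_comp q p' ->
  add_comp r s' = add_comp s r' -> add_comp s p' - add_comp r q' = add_id Y2 ->
  iso (oplus X1 X2) (oplus Y1 Y2).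
Proof.
move=> e11 e12 e21 e22 f11 f12 f21 f22.
have colE A B A' Z (u : add_hom A Z) (v : add_hom B Z) (a : add_hom A' A) (b : add_hom A' B) :
    add_comp (copair u v) (add_comp (inj1 _ _) a + add_comp (inj2 _ _) b)
      = add_comp u a + add_comp v b.
  by rewrite add_compDr !add_compA copair_inj1 copair_inj2.
have matE A B A' B' A'' (a : add_hom A A') (b : add_hom B A') (c : add_hom A B') (e : add_hom B B')
    (u : add_hom A'' A) (v : add_hom A'' B) :
    add_comp (add_comp (inj1 _ _) a + add_comp (inj2 _ _) c) u
      + add_comp (add_comp (inj1 _ _) b + add_comp (inj2 _ _) e) v
    = add_comp (inj1 A' B') (add_comp a u + add_comp b v)
      + add_comp (inj2 A' B') (add_comp c u + add_comp e v).
  by rewrite !add_compDl -!add_compA addrACA -!add_compDr.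
apply: (@copair_iso _ _ _ (add_comp (inj1 _ _) p + add_comp (inj2 _ _) r)
   (add_comp (inj1 _ _) q + add_comp (inj2 _ _) s)
   (copair (add_comp (inj1 _ _) s' + add_comp (inj2 _ _) (- r'))
     (add_comp (inj1 _ _) (- q') + add_comp (inj2 _ _) p'))).
- rewrite colE matE !add_compNf e11 e21 addNr add_compf0 addr0 add_compf1.
  by [].
- rewrite colE matE !add_compNf e12 subrr (addrC (- _)) e22 add_compf0 add0r add_compf1.
  by [].
apply: oplus_ext; rewrite -add_compA add_comp1f ?copair_inj1 ?copair_inj2 colE matE !add_compfN.
  by rewrite f11 f21 subrr add_compf0 addr0 add_compf1.
by rewrite f12 addNr add_compf0 add0r (addrC (- _)) f22 add_compf1.
Qed.

Section Sums.
Context (I : eqType) (X : I -> add_ob D).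

Definition oplus_seq (s : seq I) : add_ob D := \big[oplus/add_zero]_(i <- s) X i.

Lemma oplus_seq_cons i s : oplus_seq (i :: s) = oplus (X i) (oplus_seq s).
Proof. by rewrite /oplus_seq big_cons. Qed.

Lemma oplus_seq_cat s t : iso (oplus_seq (s ++ t)) (oplus (oplus_seq s) (oplus_seq t)).
Proof.
elim: s => [|i s IH]; first by rewrite /= /oplus_seq big_nil; apply/isomorphic_sym/oplus0.
rewrite cat_cons !oplus_seq_cons; apply: isomorphic_trans (oplusA _ _ _).
by apply: oplus_congr; [apply: isomorphic_refl | exact: IH].
Qed.

Lemma oplus_seq_perm s t : perm_eq s t -> iso (oplus_seq s) (oplus_seq t).
Proof.
move=> st; apply: (catCA_perm_ind (P := fun u => iso (oplus_seq s) (oplus_seq u))) st _;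
  last exact: isomorphic_refl.
move=> s1 s2 s3 h; apply: isomorphic_trans h _.
apply: isomorphic_trans (oplus_seq_cat _ _) _; apply: isomorphic_trans (isomorphic_sym (oplus_seq_cat _ _)).
apply: isomorphic_trans (oplus_congr (isomorphic_refl _) (oplus_seq_cat _ _)) _.
apply: isomorphic_trans (isomorphic_sym (oplus_congr (isomorphic_refl _) (oplus_seq_cat _ _))).
apply: isomorphic_trans (oplusA _ _ _) _; apply: isomorphic_trans (isomorphic_sym (oplusA _ _ _)).
by apply: oplus_congr; [apply: oplusC | apply: isomorphic_refl].
Qed.

End Sums.

Lemma oplus_seq_congr (I : eqType) (X Y : I -> add_ob D) s :
  (forall i, i \in s -> iso (X i) (Y i)) -> iso (oplus_seq X s) (oplus_seq Y s).
Proof.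
elim: s => [|i s IH] h; first by rewrite /oplus_seq !big_nil; apply: isomorphic_refl.
rewrite !oplus_seq_cons; apply: oplus_congr; first by apply: h; rewrite mem_head.
by apply: IH => j js; apply: h; rewrite inE js orbT.
Qed.

End Biproducts.

(** * Ranks between tensor powers *)

(** Writing d = q m with q the p-part, (1 + X)^d = (1 + X^q)^m over F_p. The coefficients of X^q
    show that C(d, q) is congruent to m, which is prime to p. *)
Lemma prime_ndvd_bin p d : prime p -> (0 < d)%N -> ~~ (p %| 'C(d, p ^ logn p d))%N.
Proof.
move=> pp d0; set q := (p ^ logn p d)%N.
have q0 : (0 < q)%N by rewrite expn_gt0 prime_gt0.
have [m nm dE] := pfactor_coprime pp d0; rewrite mulnC -/q in dE.
have chF : p \in [pchar 'F_p] by rewrite pchar_Fp.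
have e : (1 + 'X) ^+ d = (1 + 'X^q) ^+ m :> {poly 'F_p}.
  rewrite dE exprM exprDn_pchar ?expr1n //.
  by rewrite pnatX; apply/orP; left; rewrite (pnatE _ pp) pchar_poly.
have cL : ((1 + 'X) ^+ d : {poly 'F_p})`_q = ('C(d, q))%:R.
  rewrite exprDn coef_sum (bigD1 (inord q)) //= inordK; last first.
    by rewrite ltnS dE leq_pmulr //; move: d0; rewrite dE muln_gt0 => /andP[].
  rewrite expr1n mul1r coefMn coefXn eqxx big1 ?addr0 // => i ni.
  rewrite expr1n mul1r coefMn coefXn; case: eqP => [qi|_]; last by rewrite mul0rn.
  by case/eqP: ni; apply: val_inj; rewrite /= inordK qi.
have cR : ((1 + 'X^q) ^+ m : {poly 'F_p})`_q = m%:R.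
  case: m {nm dE e} => [|m]; first by rewrite expr0 coef1 eqn0Ngt q0.
  rewrite exprDn coef_sum (bigD1 (inord 1)) //= inordK // expr1n mul1r coefMn expr1.
  rewrite coefXn eqxx bin1 big1 ?addr0 // => i ni.
  rewrite expr1n mul1r coefMn -exprM coefXn; case: eqP => [qi|_]; last by rewrite mul0rn.
  case/eqP: ni; apply: val_inj; rewrite /= inordK //.
  by apply/eqP; rewrite -(eqn_pmul2l q0) muln1 -qi.
have := congr1 (fun P : {poly 'F_p} => P`_q) e; rewrite cL cR => {}e.
rewrite (dvdn_pcharf chF) e -(dvdn_pcharf chF).
by rewrite -prime_coprime.
Qed.

(** The dual space carries the actions on opposite sides. Equal dimensions of the algebras keep the
    rank, which is why the powers of [A] are replaced by [level_alg]. *)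
Lemma bimodule_dual (k : fieldType) (S T : falgType k) m : dim S = dim T ->
  bimodule_of_rank S T m -> bimodule_of_rank T S m.
Proof.
move=> dST [V [a [b [ab dV]]]].
exists 'Hom(V, k^o : falgType k), (act_pre _ b), (act_preo _ a); split.
  by move=> x y h; apply: pre_preoC => u v w; rewrite ab.
by rewrite dim_hom dV dST -[X in (_ * X)%N]/1%N muln1.
Qed.

Section RankCalculus.
Context (k : fieldType) (A : falgType k) (csA : is_central_simple A).
Context (D : additive_category) (E : functor (dgCat k) D) (addE : is_additive_invariant E).
Context (d n l : nat).
Hypotheses (d0 : (0 < d)%N) (n0 : (0 < n)%N) (le_l : (n + d <= l)%N).
Hypothesis dT : forall u, dim (tens_pow A u) = (d ^ u * d ^ u)%N.
Hypothesis ext : forall i, (0 < i)%N ->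
  exists (X : vectType k) (a : action (opp_alg (tens_pow A i)) X), dim X = (d ^ i * 'C(d, i))%N.
Hypothesis tor : exists (X : vectType k) (a : action (opp_alg (tens_pow A n)) X),
  dim X = (d ^ n)%N.

(* A^(u) (x) M_(d^(l-u)), of dimension d^(2l) for every u <= l. *)
Definition level_alg u : falgType k := tens (tens_pow A u) 'M[k]_((d ^ (l - u)).-1.+1).

Let dpred u : (d ^ (l - u)).-1.+1 = (d ^ (l - u))%N.
Proof. by rewrite prednK // expn_gt0 d0. Qed.

Lemma level_alg_cs u : is_central_simple (level_alg u).
Proof.
by apply: tens_central_simple; [apply: tens_pow_central_simple | apply: matrix_central_simple].
Qed.

Lemma dim_level_alg u : (u <= l)%N -> dim (level_alg u) = (d ^ l * d ^ l)%N.
Proof.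
move=> ul; transitivity (dim (tens_pow A u) * ((d ^ (l - u)).-1.+1 * (d ^ (l - u)).-1.+1))%N => //.
by rewrite dT dpred -[in RHS](subnKC ul) expnD; lia.
Qed.

Let X u : add_ob D := E (alg_dgcat (level_alg u)).

(** Both directions are kept, so that steps down in the exponent can also be used upwards. *)
Definition joined u v m : Prop :=
  (exists f : add_hom (X u) (X v), rank_hom m f) /\
  (exists g : add_hom (X v) (X u), rank_hom m g).

Lemma joined_sym u v m : joined u v m -> joined v u m.
Proof. by case. Qed.

Lemma joined_refl u : joined u u 1.
Proof. by split; exists (add_id _); apply: rank_hom_id. Qed.

Lemma joined_comp u v w m m' : joined u v m -> joined v w m' -> joined u w (m * m').
Proof.
move=> [[f hf] [g hg]] [[f' hf'] [g' hg']]; split.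
  by exists (add_comp f' f); apply: rank_hom_comp => //; apply: level_alg_cs.
by exists (add_comp g g'); rewrite mulnC; apply: rank_hom_comp => //; apply: level_alg_cs.
Qed.

Lemma joined_add u v m m' : joined u v m -> joined u v m' -> joined u v (m + m').
Proof.
move=> [[f hf] [g hg]] [[f' hf'] [g' hg']]; split.
  by exists (f + f'); apply: (rank_hom_add addE) => //; apply: level_alg_cs.
by exists (g + g'); apply: (rank_hom_add addE) => //; apply: level_alg_cs.
Qed.

Lemma joined_mul c u v m : joined u v m -> joined u v (c * m).
Proof.
move=> h; elim: c => [|c IH]; last by rewrite mulSn; apply: joined_add.
by split; exists 0; apply: rank_hom_zero.
Qed.

Lemma joined_bimodule u v m : (u <= l)%N -> (v <= l)%N ->
  bimodule_of_rank (level_alg u) (level_alg v) m -> joined u v m.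
Proof.
move=> ul vl h; have [[_ su] [_ sv]] := (level_alg_cs u, level_alg_cs v).
split; apply: rank_hom_exists => //.
by apply: bimodule_dual h; rewrite !dim_level_alg.
Qed.

(** Between the tensor powers the rank is d^i m. Passing to matrices of sizes d^(l-v-i) and d^(l-v)
    divides it by d^i. *)
Lemma joined_down i v m : (0 < i)%N -> (v + i <= l)%N ->
  (exists (Y : vectType k) (a : action (opp_alg (tens_pow A i)) Y), dim Y = (d ^ i * m)%N) ->
  joined (v + i) v m.
Proof.
case: i => [//|i] _ vil [Y [a dY]]; apply: joined_bimodule => //; first by lia.
apply: (bimodule_matrix (n := dim Y)); last exact: bimodule_pow.
rewrite !dpred dY (_ : l - v = i.+1 + (l - (v + i.+1)))%N; last by lia.
by rewrite expnD; lia.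
Qed.

Lemma joined_period v j : (v + j * n <= l)%N -> joined (v + j * n) v 1.
Proof.
elim: j => [|j IH] vl; first by rewrite mul0n addn0; apply: joined_refl.
have e : (v + j.+1 * n = v + j * n + n)%N by rewrite mulSn; lia.
rewrite e in vl *; rewrite -[1%N]mul1n; apply: (@joined_comp _ (v + j * n)).
  by apply: joined_down => //; have [Y [a dY]] := tor; exists Y, a; rewrite muln1.
by apply: IH; lia.
Qed.

Lemma joined_mod u v : (u <= l)%N -> (v <= l)%N -> u = v %[mod n] -> joined u v 1.
Proof.
move=> ul vl e; rewrite -[1%N]mul1n.
have hm w : (w <= l)%N -> joined w (w %% n) 1.
  move=> wl; have := divn_eq w n; rewrite addnC => ew.
  by rewrite {1}ew; apply: joined_period; rewrite -ew.
apply: (joined_comp (hm _ ul)); rewrite e; apply: joined_sym; exact: hm.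
Qed.

Definition shift_rank delta m : Prop :=
  forall u v, (u <= l)%N -> (v <= l)%N -> u = v + delta %[mod n] -> joined u v m.

Lemma shift_rank0 : shift_rank 0 1.
Proof. by move=> u v ul vl; rewrite addn0; apply: joined_mod. Qed.

Lemma shift_rank_mod delta delta' m : delta = delta' %[mod n] ->
  shift_rank delta m -> shift_rank delta' m.
Proof. by move=> e h u v ul vl euv; apply: h => //; rewrite euv -modnDmr -e modnDmr. Qed.

Lemma shift_rankD delta m m' : shift_rank delta m -> shift_rank delta m' ->
  shift_rank delta (m + m').
Proof. by move=> h h' u v ul vl e; apply: joined_add; [apply: h | apply: h']. Qed.

Lemma shift_rankM c delta m : shift_rank delta m -> shift_rank delta (c * m).
Proof. by move=> h u v ul vl e; apply: joined_mul; apply: h. Qed.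

Lemma shift_rank_step i delta m : (0 < i <= d)%N -> shift_rank delta m ->
  shift_rank (delta + i) ('C(d, i) * m).
Proof.
(* Reduction modulo n keeps [w + i] below [n + d], hence within the bound [l]. *)
move=> /andP[i0 id] h u v ul vl e; set w := ((v + delta) %% n)%N.
have wn : (w < n)%N by rewrite ltn_mod.
have eu : u = w + i %[mod n] by rewrite e modnDml addnA.
rewrite -[X in joined _ _ X]mul1n.
apply: (@joined_comp _ (w + i)); first by apply: joined_mod => //; lia.
apply: (@joined_comp _ w); first by apply: joined_down => //; [lia | exact: ext].
by apply: h; rewrite ?modn_mod //; lia.
Qed.

Lemma shift_rankX i N : (0 < i <= d)%N -> shift_rank (N * i) ('C(d, i) ^ N).
Proof.
move=> hi; elim: N => [|N IH]; first by rewrite mul0n; apply: shift_rank0.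
by rewrite mulSn addnC expnS; apply: shift_rank_step.
Qed.

(** Steps by the p-part i of d have rank C(d, i), prime to p. Since i is prime to h, some multiple
    of g i is congruent to delta modulo g h = n. *)
Lemma shift_rank_prime p g h delta : prime p -> n = (g * h)%N -> coprime p h -> (g %| delta)%N ->
  exists2 m, shift_rank delta m & coprime p m.
Proof.
move=> pp nE ch /dvdnP[r ->]; set i := (p ^ logn p d)%N.
have hi : (0 < i <= d)%N.
  by rewrite expn_gt0 prime_gt0 // dvdn_leq // pfactor_dvdnn.
have ci : coprime i h by rewrite coprimeXl.
pose c := chinese i h 0 r.
have ic : (i %| c)%N by rewrite /dvdn /c chinese_modl // mod0n.
have [N cE] := dvdnP ic.
exists ('C(d, i) ^ (g * N))%N; last first.
  by rewrite coprimeXr // prime_coprime // prime_ndvd_bin.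
apply: (shift_rank_mod _ (shift_rankX (N := (g * N)%N) hi)).
rewrite -mulnA -cE nE (mulnC r) -!muln_modr; congr (_ * _)%N.
exact: chinese_modr.
Qed.

(* Ranks along shifts in h.Z/n include, for every prime other than those dividing
   q, one prime to it; hence one prime to any given c with this property. *)
Lemma shift_rank_coprime q h delta c : n = (h * q)%N -> (h %| delta)%N -> (0 < c)%N -> coprime c q ->
  exists2 m, shift_rank delta m & coprime c m.
Proof.
move=> nE hd c0 cq.
have key s : uniq s -> all prime s -> all (fun p => coprime p q) s ->
    exists2 m, shift_rank delta m & all (fun p => coprime p m) s.
  elim: s => [|p s IH] /=.
    move=> _ _ _; exists 0%N => // u v ul vl _.
    by split; exists 0; apply: rank_hom_zero.
  move=> /andP[ps us] /andP[pp As] /andP[cpq Cs].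
  have [m hm am] := IH us As Cs.
  have [m' hm' cm'] := shift_rank_prime pp nE cpq hd.
  pose P := (\prod_(x <- s) x)%N.
  (* Modulo [p] only [P * m'] remains, and modulo a prime [x] of [s] only [p * m]; each is prime to
     the modulus in question. *)
  exists (p * m + P * m')%N; first by apply: shift_rankD; apply: shift_rankM.
  have cP : coprime p P.
    rewrite /P; elim: (s) ps As => [|x t IHt] /=; first by rewrite big_nil coprimen1.
    rewrite inE negb_or => /andP[px pt] /andP[xp At]; rewrite big_cons coprimeMr IHt // andbT.
    by rewrite prime_coprime // dvdn_prime2.
  apply/andP; split.
    by rewrite prime_coprime // (dvdn_addr _ (dvdn_mulr m (dvdnn p))) -(prime_coprime _ pp) coprimeMr cP.
  apply/allP => x xs; have xP : (x %| P)%N by rewrite /P (big_rem x xs) /= dvdn_mulr.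
  have px : prime x by apply: (allP As).
  rewrite prime_coprime // (dvdn_addl _ (dvdn_mulr m' xP)) -(prime_coprime _ px) coprimeMr (allP am) // andbT.
  rewrite prime_coprime // dvdn_prime2 //.
  by apply: contraNneq ps => <-.
have [||m hm am] := key (primes c) (primes_uniq c).
- by apply/allP => p; rewrite mem_primes => /andP[].
- apply/allP => p; rewrite mem_primes => /and3P[pp _ pc].
  by apply: coprime_dvdl cq.
exists m => //; apply: contraT => nc.
have g1 : (1 < gcdn c m)%N by rewrite ltn_neqAle eq_sym nc gcdn_gt0 c0.
have pp := pdiv_prime g1; have := pdiv_dvd (gcdn c m); rewrite dvdn_gcd => /andP[pc pm].
have : pdiv (gcdn c m) \in primes c by rewrite mem_primes pp c0.
by move=> /(allP am); rewrite prime_coprime // pm.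
Qed.

(* Two classes exchange their components modulo q; here b has degree b and a has
   degree a in the matrix [[b, a y], [a, b x]] of determinant 1. *)
Lemma joined_swap x1 x2 y1 y2 a b : (0 < b)%N -> coprime a b ->
  joined x1 y1 b -> joined x2 y2 b -> joined x1 y2 a -> joined x2 y1 a ->
  @isomorphic D (oplus (X x1) (X x2)) (oplus (X y1) (X y2)).
Proof.
move=> b0 cab [J11 J11'] [J22 J22'] [J12 J12'] [J21 J21'].
have [x [y exy]] : exists x y, (b * (b * x) = a * y * a + 1)%N.
  have cba : coprime (b ^ 2) (a ^ 2) by rewrite coprimeXl ?coprimeXr // coprime_sym.
  have b20 : (0 < b ^ 2)%N by rewrite expn_gt0 b0.
  have [[u v] /= e] := coprimeP (a ^ 2) b20 cba.
  by exists u, v; rewrite -!mulnn in e; lia.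
have mul c u v m (h : exists f : add_hom (X u) (X v), rank_hom m f) :
    exists f : add_hom (X u) (X v), rank_hom (c * m) f.
  elim: c => [|c [f hf]]; first by exists 0; apply: rank_hom_zero.
  have [g hg] := h; exists (g + f); rewrite mulSn.
  by apply: (rank_hom_add addE) => //; apply: level_alg_cs.
have [[p hp] [r hr] [q hq] [s hs]] := And4 J11 J12 (mul y _ _ _ J21) (mul x _ _ _ J22).
have [[p' hp'] [r' hr'] [q' hq'] [s' hs']] := And4 J22' J21' (mul y _ _ _ J12') (mul x _ _ _ J11').
have cs := level_alg_cs.
have comp u v w i j (f : add_hom (X v) (X w)) (g : add_hom (X u) (X v)) :
    rank_hom i f -> rank_hom j g -> rank_hom (j * i) (add_comp f g).
  by move=> hf hg; apply: rank_hom_comp.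
have eq u v i j (f g : add_hom (X u) (X v)) : rank_hom i f -> rank_hom j g -> i = j -> f = g.
  by move=> hf hg ij; apply: (rank_hom_uniq addE (m := i)) => //; rewrite ij.
have det1 u i j (f g : add_hom (X u) (X u)) : rank_hom i f -> rank_hom j g -> i = (j + 1)%N ->
    f - g = add_id (X u).
  move=> hf hg ij; apply/eqP; rewrite subr_eq; apply/eqP.
  apply: (eq _ _ _ _ _ _ hf (rank_hom_add addE (cs u) (cs u) (rank_hom_id E _) hg)).
  by rewrite addnC.
apply: (@oplus_matrix D _ _ _ _ p q r s p' q' r' s').
- by apply: det1 (comp _ _ _ _ _ _ _ hs' hp) (comp _ _ _ _ _ _ _ hq' hr) _; lia.
- by apply: eq (comp _ _ _ _ _ _ _ hs' hq) (comp _ _ _ _ _ _ _ hq' hs) _; lia.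
- by apply: eq (comp _ _ _ _ _ _ _ hp' hr) (comp _ _ _ _ _ _ _ hr' hp) _; lia.
- by apply: det1 (comp _ _ _ _ _ _ _ hp' hs) (comp _ _ _ _ _ _ _ hr' hq) _; lia.
- by apply: det1 (comp _ _ _ _ _ _ _ hp hs') (comp _ _ _ _ _ _ _ hq hr') _; lia.
- by apply: eq (comp _ _ _ _ _ _ _ hp hq') (comp _ _ _ _ _ _ _ hq hp') _; lia.
- by apply: eq (comp _ _ _ _ _ _ _ hr hs') (comp _ _ _ _ _ _ _ hs hr') _; lia.
- by apply: det1 (comp _ _ _ _ _ _ _ hs hp') (comp _ _ _ _ _ _ _ hr hq') _; lia.
Qed.

(** The shift x1 - y2 is divisible by q, which gives a rank [a] prime to p, hence to q. The shift x1
    - y1 is divisible by h, for which ranks prime to any given positive number prime to q exist, in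
    particular one prime to [a]. *)
Lemma class_swap p q h x1 x2 y1 y2 : prime p -> n = (h * q)%N -> (exists r, q = p ^ r)%N ->
  coprime p h -> (x1 <= l)%N -> (x2 <= l)%N -> (y1 <= l)%N -> (y2 <= l)%N ->
  y1 = x1 %[mod h] -> y1 = x2 %[mod q] -> y2 = x2 %[mod h] -> y2 = x1 %[mod q] ->
  @isomorphic D (oplus (X x1) (X x2)) (oplus (X y1) (X y2)).
Proof.
move=> pp nE [r qE] ch x1l x2l y1l y2l e1h e1q e2h e2q.
have cqh : coprime h q by rewrite qE coprime_sym coprimeXl.
have q0 : (0 < q)%N by rewrite qE expn_gt0 prime_gt0.
have crt u v : u = v %[mod h] -> u = v %[mod q] -> u = v %[mod n].
  by move=> /eqP eh /eqP eq; apply/eqP; rewrite nE chinese_remainder // eh.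
(* Modulo n, [w * n.-1] is the opposite of [w]; differences of exponents are written in this way. *)
have nK w : (w + w * n.-1 = w * n)%N by rewrite -mulnS prednK.
have modD m u v w w' : (m %| n)%N -> u + w = v + w' %[mod m] ->
    u = v + (w' + w * n.-1) %[mod m].
  move=> /dvdnP[c cE] e; rewrite addnA -modnDml -e modnDml -addnA nK cE mulnA.
  by rewrite addnC modnMDl.
have divD m u v : (m %| n)%N -> u = v %[mod m] -> (m %| u + v * n.-1)%N.
  move=> mn e; rewrite /dvdn -modnDml e modnDml nK; apply: dvdn_mull; exact: mn.
have hn : (h %| n)%N by rewrite nE dvdn_mulr.
have qn : (q %| n)%N by rewrite nE dvdn_mull.
have addm m u u' v v' : u = u' %[mod m] -> v = v' %[mod m] -> u + v = u' + v' %[mod m].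
  by move=> e e'; rewrite -modnDm e e' modnDm.
have [a ha ca] : exists2 a, shift_rank (x1 + y2 * n.-1) a & coprime p a.
  by apply: (shift_rank_prime pp (g := q) (h := h)) => //; [rewrite nE mulnC | apply: divD].
(* The auxiliary prime [p0] forces b > 0: for a = 1 the rank 0 would be prime to [a], but it is
   never prime to [a * p0]. *)
have [p0 qp0 pp0] := prime_above q.
have a0 : (0 < a)%N.
  case: a ca {ha} => // ; rewrite /coprime gcdn0 => /eqP p1.
  by move: (prime_gt1 pp); rewrite p1.
have cp0 : coprime p0 q by rewrite prime_coprime // gtnNdvd.
have [||b hb] := @shift_rank_coprime q h (x1 + y1 * n.-1) (a * p0) nE (divD _ _ _ hn (esym e1h)).
- by rewrite muln_gt0 a0 prime_gt0.
- by rewrite coprimeMl cp0 andbT qE coprimeXr // coprime_sym.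
rewrite coprimeMl => /andP[cab cp0b].
have b0 : (0 < b)%N.
  case: b cp0b {hb cab} => // ; rewrite /coprime gcdn0 => /eqP p1.
  by move: (prime_gt1 pp0); rewrite p1.
apply: (joined_swap b0 cab).
- by apply: hb => //; apply: modD => //; rewrite addnC.
(* The congruences give y1 + y2 = x1 + x2 modulo n, so y2 - x2 is the same shift as x1 - y1. *)
- apply: joined_sym; apply: hb => //; apply: modD => //.
  by apply: crt; [apply: addm | rewrite addnC; apply: addm; rewrite ?e2q].
- by apply: ha => //; apply: modD => //; rewrite addnC.
- apply: joined_sym; apply: ha => //; apply: modD => //.
  by apply: crt; [rewrite addnC; apply: addm | apply: addm].
Qed.

Lemma class_iso u v : (u <= l)%N -> (v <= l)%N -> u = v %[mod n] -> @isomorphic D (X u) (X v).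
Proof.
move=> ul vl /(joined_mod ul vl)[[f hf] _]; exists f.
apply: (rank_hom_iso addE _ _ _ hf) => //; last by rewrite mul1n !dim_level_alg.
by case: (level_alg_cs u).
Qed.

(** The row space of the matrix factor gives a morphism whose rank is the size of the matrices, and
    this rank satisfies the dimension condition of [rank_hom_iso]. *)
Lemma level_iso u : @isomorphic D (X u) (E (alg_dgcat (tens_pow A u))).
Proof.
have [_ sA] := tens_pow_central_simple csA u.
have [f hf] := rank_hom_exists addE sA
  (bimodule_of_module (tens_pow A u) (act_row k (d ^ (l - u)).-1)).
exists f; apply: (rank_hom_iso addE _ _ _ hf).
- by case: (level_alg_cs u).
- by rewrite /dim /= mul1n.
have -> : dim 'rV[k]_((d ^ (l - u)).-1.+1) = (d ^ (l - u)).-1.+1 by rewrite /dim /= mul1n.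
transitivity (dim (tens_pow A u) * ((d ^ (l - u)).-1.+1 * (d ^ (l - u)).-1.+1))%N => //.
by rewrite mulnC -mulnn.
Qed.

End RankCalculus.

(** * Exponents modulo the primary parts of the period *)

Section PrimaryParts.
Context (n : nat) (n0 : (0 < n)%N).

Lemma partn_mul_part p : (n %/ n`_p * n`_p = n)%N.
Proof. by rewrite divnK ?dvdn_part. Qed.

Lemma partn_compl_coprime p : prime p -> coprime p (n %/ n`_p).
Proof.
move=> pp; have -> : (n %/ n`_p = n`_p^')%N by rewrite -{1}(partnC p n0) mulKn.
by rewrite prime_coprime // -p'natE // part_pnat.
Qed.

Lemma partn_dvd_compl p p' : prime p -> prime p' -> p != p' -> (n`_p' %| n %/ n`_p)%N.
Proof.
move=> pp pp' npp'; have c : coprime n`_p' n`_p.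
  rewrite !p_part coprimeXl ?coprimeXr // prime_coprime // dvdn_prime2 //.
  by rewrite eq_sym.
by rewrite -(Gauss_dvdl _ c) partn_mul_part dvdn_part.
Qed.

Lemma eqn_mod_partn x y : (forall p, p \in primes n -> x = y %[mod n`_p]) -> x = y %[mod n].
Proof.
wlog xy : x y / (y <= x)%N => [hw h|h].
  by case/orP: (leq_total x y) => xy; [symmetry|]; apply: hw => // p /h.
apply/eqP; rewrite eqn_mod_dvd //; apply/dvdn_partP => // p pn.
by rewrite -eqn_mod_dvd //; apply/eqP/h.
Qed.

End PrimaryParts.

Section Marginals.
Context (D : additive_category) (X : nat -> add_ob D) (n l : nat).
Hypotheses (n0 : (0 < n)%N) (le_nl : (n <= l)%N).
Local Notation iso Y Z := (@isomorphic D Y Z).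
Hypothesis class_iso : forall u v, (u <= l)%N -> (v <= l)%N -> u = v %[mod n] -> iso (X u) (X v).
Hypothesis class_swap : forall p x1 x2 y1 y2, prime p -> (x1 <= l)%N -> (x2 <= l)%N ->
  (y1 <= l)%N -> (y2 <= l)%N ->
  y1 = x1 %[mod n %/ n`_p] -> y1 = x2 %[mod n`_p] ->
  y2 = x2 %[mod n %/ n`_p] -> y2 = x1 %[mod n`_p] ->
  iso (oplus (X x1) (X x2)) (oplus (X y1) (X y2)).

Definition same_marginals (s t : seq nat) : Prop :=
  forall p, p \in primes n -> perm_eq [seq u %% n`_p | u <- s]%N [seq u %% n`_p | u <- t]%N.

Let bounded (s : seq nat) := all (fun u => (u <= l)%N) s.

(** One prime at a time: if [x] and [y] differ modulo the p-part of n, some [x2] in [s] has the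
    residue of [y]. Exchanging the p-components of [x] and [x2] corrects the head at p, leaves it
    alone at the other primes, and preserves all marginals. *)
Lemma fix_head ps : uniq ps -> {subset ps <= primes n} -> forall x s y t,
  bounded (x :: s) -> same_marginals (x :: s) (y :: t) ->
  exists x' s', [/\ iso (oplus_seq X (x :: s)) (oplus_seq X (x' :: s')), bounded (x' :: s'),
    same_marginals (x' :: s') (y :: t), size s' = size s &
    forall p, p \in ps -> x' = y %[mod n`_p]].
Proof.
elim: ps => [|p ps IH] /=.
  by move=> _ _ x s y t b m; exists x, s; split=> //; exact: isomorphic_refl.
move=> /andP[pps ups] sub x0 s0 y t b0 m0.
have [|x [s [i0 b m z hx]]] := IH ups _ x0 s0 y t b0 m0.
  by move=> p' hp'; apply: sub; rewrite inE hp' orbT.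
have pn : p \in primes n by apply: sub; rewrite mem_head.
have pp : prime p by move: pn; rewrite mem_primes => /andP[].
have [exy|nxy] := eqVneq (x %% n`_p)%N (y %% n`_p)%N.
  exists x, s; split=> // p'; rewrite inE => /predU1P[->|] //; exact: hx.
have [x2 x2s e2] : exists2 x2, x2 \in s & x2 = y %[mod n`_p].
  have /perm_mem/(_ (y %% n`_p)%N) := m p pn.
  by rewrite /= !inE eqxx eq_sym (negbTE nxy) => /mapP[x2 x2s e]; exists x2.
pose h := (n %/ n`_p)%N; pose q := (n`_p)%N.
have hq : (h * q = n)%N by exact: partn_mul_part.
have chq : coprime h q.
  by rewrite /q p_part coprime_sym coprimeXl // partn_compl_coprime.
(* Reduced modulo n, and n is at most l, so that the new exponents stay bounded by l. *)
pose y1 := (chinese h q x x2 %% n)%N; pose y2 := (chinese h q x2 x %% n)%N.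
have hn : (h %| n)%N by rewrite -hq dvdn_mulr.
have qn : (q %| n)%N by rewrite -hq dvdn_mull.
have e1h : y1 = x %[mod h] by rewrite /y1 modn_dvdm // chinese_modl.
have e1q : y1 = x2 %[mod q] by rewrite /y1 modn_dvdm // chinese_modr.
have e2h : y2 = x2 %[mod h] by rewrite /y2 modn_dvdm // chinese_modl.
have e2q : y2 = x %[mod q] by rewrite /y2 modn_dvdm // chinese_modr.
have ps2 : perm_eq (x :: s) (x :: x2 :: rem x2 s) by rewrite perm_cons perm_to_rem.
have bs : bounded (x :: x2 :: rem x2 s) by rewrite /bounded -(perm_all _ ps2).
have /and3P[xl x2l rl] := bs.
have y1l : (y1 <= l)%N by apply: leq_trans le_nl; apply/ltnW; rewrite ltn_mod.
have y2l : (y2 <= l)%N by apply: leq_trans le_nl; apply/ltnW; rewrite ltn_mod.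
exists y1, (y2 :: rem x2 s); split.
- apply: (isomorphic_trans i0); apply: (isomorphic_trans (oplus_seq_perm X ps2)).
  rewrite !oplus_seq_cons; apply: isomorphic_trans (oplusA _ _ _) _.
  apply: isomorphic_trans (isomorphic_sym (oplusA _ _ _)).
  apply: oplus_congr; last exact: isomorphic_refl.
  exact: (class_swap pp).
- by apply/and3P.
- move=> p' pn'; apply: perm_trans (m p' pn').
  have ps2' := perm_map (fun u => u %% n`_p')%N ps2; rewrite perm_sym in ps2'.
  apply: perm_trans ps2' => /=; have [<-|npp'] := eqVneq p p'.
    rewrite -/q e1q e2q; apply/seq.permP => f /=.
    by rewrite addnCA.
  have pp' : prime p' by move: pn'; rewrite mem_primes => /andP[].
  have dh := partn_dvd_compl n pp pp' npp'.
  by rewrite -(modn_dvdm y1 dh) -(modn_dvdm y2 dh) e1h e2h !modn_dvdm.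
- have := perm_size ps2; rewrite /= => -[<-]; exact: z.
move=> p'; rewrite inE => /predU1P[->|p'ps]; first by rewrite e1q.
have pn' : p' \in primes n by apply: sub; rewrite inE p'ps orbT.
have pp' : prime p' by move: pn'; rewrite mem_primes => /andP[].
have npp' : p != p' by apply: contraNneq pps => ->.
have dh := partn_dvd_compl n pp pp' npp'.
by rewrite -(modn_dvdm y1 dh) e1h modn_dvdm // hx.
Qed.

(** Once the heads agree modulo every primary part, they agree modulo n and can be removed. The
    sizes are compared separately because n = 1 has no primary parts. *)
Lemma same_marginals_iso s t : bounded s -> bounded t -> size s = size t ->
  same_marginals s t -> iso (oplus_seq X s) (oplus_seq X t).
Proof.
elim: t s => [|y t IH] [|x s] //= bs bt es m; first exact: isomorphic_refl.
have [x' [s' [i b m' z hx]]] := fix_head (primes_uniq n) (fun p h => h) bs m.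
apply: (isomorphic_trans i); rewrite !oplus_seq_cons.
have /andP[x'l s'l] := b; have /andP[yl tl] := bt.
apply: oplus_congr; first by apply: class_iso => //; apply: eqn_mod_partn.
apply: IH => //; first by rewrite z; case: es.
by move=> p pn; have := m' p pn; rewrite /= (hx p pn) perm_cons.
Qed.

End Marginals.

Section Exponents.
Implicit Types p q : {poly nat}.

Definition exponents p : seq nat := flatten [seq nseq (p`_i)%R i | i <- iota 0 (size p)].

Lemma exponents_lt p u : u \in exponents p -> (u < size p)%N.
Proof.
move=> /flattenP[_ /mapP[i ip ->]]; rewrite mem_nseq => /andP[_ /eqP ->].
by move: ip; rewrite mem_iota.
Qed.

Definition weight (a : pred nat) p : nat := (\sum_(i < size p) (p`_i)%R * a i)%N.

Lemma count_exponents a p : count a (exponents p) = weight a p.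
Proof.
rewrite /weight /exponents count_flatten -map_comp sumnE big_map.
rewrite -(big_mkord xpredT (fun i => (p`_i)%R * a i)%N) /index_iota subn0.
by apply: eq_bigr => i _; rewrite /= count_nseq mulnC.
Qed.

Lemma weight_widen a p N : (size p <= N)%N -> weight a p = (\sum_(i < N) (p`_i)%R * a i)%N.
Proof.
move=> h; rewrite /weight -!(big_mkord xpredT (fun i => (p`_i)%R * a i)%N).
rewrite [RHS](big_cat_nat (n := size p)) //= [X in _ = (_ + X)%N]big_nat_cond.
rewrite [X in _ = (_ + X)%N]big1 ?addn0 // => i.
by rewrite andbT => /andP[hi _]; rewrite nth_default.
Qed.

Lemma weightD a p q : weight a (p + q) = (weight a p + weight a q)%N.
Proof.
pose N := maxn (size (p + q)) (maxn (size p) (size q)).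
rewrite !(@weight_widen a _ N) ?leq_max ?leqnn ?orbT // -big_split /=.
by apply: eq_bigr => i _; rewrite coefD mulnDl.
Qed.

Lemma weight_mulXn r n p : weight (fun u => u %% n == r)%N ('X^n * p) =
  weight (fun u => u %% n == r)%N p.
Proof.
have [->|np] := eqVneq p 0; first by rewrite mulr0.
rewrite (@weight_widen _ _ (n + size p)); last first.
  apply: leq_trans (size_polyMleq _ _) _; rewrite size_polyXn addSn /=.
  by [].
rewrite big_split_ord /= big1 ?add0n => [|i _]; last by rewrite coefXnM ltn_ord.
apply: eq_bigr => i _; rewrite coefXnM ltnNge leq_addr /= addKn.
by rewrite modnDl.
Qed.

Definition geometric n : {poly nat} := \sum_(j < n) 'X^j.

(** The identity (X - 1)(1 + ... + X^(n-1)) = X^n - 1, rearranged for natural coefficients. *)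
Lemma geometric_shift n : 'X * geometric n + 1 = 'X^n + geometric n.
Proof.
transitivity (\sum_(j < n.+1) 'X^j : {poly nat}); last by rewrite big_ord_recr addrC.
rewrite big_ord_recl expr0 [LHS]addrC /geometric mulr_sumr.
by congr (_ + _); apply: eq_bigr => i _; rewrite -exprS.
Qed.

(* 'X * p + q = 'X^n * q + p, and 'X^n does not change residues modulo n. *)
Lemma weight_geometric r n p q : p = geometric n * q ->
  weight (fun u => u %% n == r)%N ('X * p) = weight (fun u => u %% n == r)%N p.
Proof.
move=> pE; apply/eqP; rewrite -(eqn_add2r (weight (fun u => u %% n == r)%N q)) -weightD.
have -> : 'X * p + q = 'X^n * q + p.
  by rewrite pE mulrA -{2}[q]mul1r -mulrDl geometric_shift mulrDl.
by rewrite weightD weight_mulXn addnC.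
Qed.

Lemma exponents_mod_perm n p q : p = geometric n * q ->
  perm_eq [seq u %% n | u <- exponents p]%N [seq u %% n | u <- exponents ('X * p)]%N.
Proof.
move=> pE; apply/allP => r _ /=; rewrite !count_map; apply/eqP.
by rewrite !(count_exponents (fun u => u %% n == r)%N) (weight_geometric r pE).
Qed.

Lemma size_exponents p : size (exponents ('X * p)) = size (exponents p).
Proof.
(* Modulo 1 all residues vanish, so the permutation of residues says only that the lengths agree. *)
have /exponents_mod_perm : p = geometric 1 * p.
  by rewrite /geometric big_ord1 expr0 mul1r.
by move/perm_size; rewrite !size_map.
Qed.

End Exponents.

Section InvariantOfPolynomials.
Context (k : fieldType) (A : falgType k) (D : additive_category) (E : functor (dgCat k) D).

Lemma inv_poly_iso p : @isomorphic D (inv_poly E A p)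
  (oplus_seq (fun u => E (alg_dgcat (tens_pow A u))) (exponents p)).
Proof.
rewrite /inv_poly /exponents.
rewrite -(big_mkord xpredT (fun i => \big[oplus/add_zero]_(j < (p`_i)%R) E (alg_dgcat (tens_pow A i)))).
rewrite /index_iota subn0; elim: (iota _ _) => [|i r IH].
  by rewrite big_nil /oplus_seq big_nil; apply: isomorphic_refl.
rewrite big_cons /=; apply: isomorphic_trans (isomorphic_sym (oplus_seq_cat _ _ _)).
apply: oplus_congr; last exact: IH.
rewrite /oplus_seq big_nseq big_const_ord; exact: isomorphic_refl.
Qed.

End InvariantOfPolynomials.

(** Finite order excludes the default value 0 of [period]. *)
Lemma period_torsion (k : fieldType) (A : falgType k) :
  (exists n, brauer_torsion A n) -> brauer_torsion A (period A).
Proof. by rewrite /period; case: pselect => // h _; case: ex_minnP. Qed.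

Theorem proposition3p3 (k : fieldType) (A : falgType k)
    (csA : is_central_simple A)
    (D : additive_category) (E : functor (dgCat k) D)
    (addE : is_additive_invariant E) :
  isomorphic (inv_poly E A (period_poly A))
             (inv_poly E A ('X * period_poly A)).
Proof.
have [d [d0 dT ext tor mod_tor]] := tens_pow_modules csA.
have tor_n := period_torsion tor; have /andP[n0 _] := tor_n.
have modn := mod_tor _ tor_n; set n := period A in tor_n n0 modn.
(* Any common level will do that leaves room for a step of length d from a residue modulo n and
   exceeds all exponents of both polynomials. *)
set P := period_poly A; pose l := (n + d + size P + size ('X * P)%R)%N.
have le_l : (n + d <= l)%N by rewrite /l; lia.
apply: isomorphic_trans (inv_poly_iso _ _ _) _.
apply: isomorphic_trans (isomorphic_sym (inv_poly_iso _ _ _)).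
pose X u := E (alg_dgcat (level_alg A d l u)).
have hX s : @isomorphic D (oplus_seq X s) (oplus_seq (fun u => E (alg_dgcat (tens_pow A u))) s).
  by apply: oplus_seq_congr => u _; apply: level_iso.
apply: isomorphic_trans (isomorphic_sym (hX _)) _; apply: isomorphic_trans (hX _).
apply: (@same_marginals_iso D X n l) => //.
- by rewrite /l; lia.
- by move=> u v ul vl e; apply: (class_iso csA addE d0 n0 le_l dT modn).
- move=> p x1 x2 y1 y2 pp x1l x2l y1l y2l.
  apply: (class_swap csA addE d0 n0 le_l dT ext modn pp) => //.
  + by rewrite partn_mul_part.
  + by exists (logn p n); rewrite p_part.
  + exact: partn_compl_coprime.
- by apply/allP => u /exponents_lt; rewrite /l; lia.
- by apply/allP => u /exponents_lt; rewrite /l; lia.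
- by rewrite size_exponents.
(* The factor of [period_poly A] at [p] is [geometric] of the p-part of the period. *)
move=> p pn; apply: exponents_mod_perm; rewrite p_part.
by rewrite /P /period_poly (big_rem p) // -/n.
Qed.
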